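(* Let $(L\rightrightarrows L_M;G\rightrightarrows M)$ be a line bundle groupoid and let $\theta\in\Omega^1(G,L)$ be a multiplicative $1$-form. Then $TG\oplus L\rightrightarrows TM\oplus L_M$, with the structure maps $$s(v,\lambda)=\big(s(v),s(\lambda)\big),\qquad t(v,\lambda)=\big(t(v),t(\lambda+\theta(v))\big)\qquad (v\in TG,\ \lambda\in L),$$ $$u(v,\lambda)=\big(u(v),u(\lambda)\big)\qquad(v\in TM,\ \lambda\in L_M),$$ $$(v,\lambda)^{-1}=\Big(v^{-1},\,s_{g^{-1}}^{-1}\big(t(\lambda+\theta(v))\big)\Big)\qquad(v\in T_gG,\ \lambda\in L_g),$$ $$(v,\lambda)(v',\lambda')=\Big(vv',\,s_{gg'}^{-1}\big(s(\lambda')\big)\Big)\qquad\text{for }(v,\lambda)\in T_gG\oplus L_g,\ (v',\lambda')\in T_{g'}G\oplus L_{g'}\text{ with }s(v,\lambda)=t(v',\lambda'),$$ is a VB groupoid over $G\rightrightarrows M$ (called the Morita kernel of $\theta$).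
   Context: A VB groupoid (VBG) $(V\rightrightarrows V_M;G\rightrightarrows M)$ consists of Lie groupoids $V\rightrightarrows V_M$, $G\rightrightarrows M$ and vector bundles $V\to G$, $V_M\to M$ such that all structure maps of $V$ are vector bundle morphisms covering the corresponding structure maps of $G$. Source, target, multiplication, inversion, unit are denoted $s,t,m,i,u$ for all groupoids involved; a product $gg'$ is defined when $s(g)=t(g')$. A line bundle groupoid is a VBG $(L\rightrightarrows L_M;G\rightrightarrows M)$ with $L\to G$ and $L_M\to M$ line bundles; all its structure maps (and face maps of its nerve) are automatically isomorphisms on fibers, and $s_g\colon L_g\to L_{M,s(g)}$ denotes the restriction of $s$. On $TG\rightrightarrows TM$ we use the tangent groupoid structure (structure maps $ds,dt,dm,di,du$, written $s(v),t(v),vv',v^{-1},u(v)$). The form $\theta\in\Omega^1(G,L)$ is multiplicative if $\partial\theta=\mathrm{pr}_2^*\theta-m^*\theta+\mathrm{pr}_1^*\theta=0$, where $m,\mathrm{pr}_1,\mathrm{pr}_2\colon L^{(2)}=L\,{}_s\!\times_tL\to L$ are the multiplication and the projections (covering those of $G^{(2)}\to G$), and $F^*\theta=F^{-1}\circ\theta\circ df$ for a fiberwise invertible morphism $(F,f)$ of line bundles. *)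

(* Defs.v *)
From HB Require Import structures.
From mathcomp Require Import all_boot all_order all_algebra.
From mathcomp Require Import all_classical all_reals all_analysis.

Set Implicit Arguments.
Unset Strict Implicit.
Unset Printing Implicit Defensive.

Import Order.TTheory GRing.Theory Num.Theory.
Import numFieldNormedType.Exports.

Local Open Scope classical_set_scope.
Local Open Scope ring_scope.

(* Every structure below is split into a record of data and a predicate
   [is_...] stating its axioms.  Operations that are only meaningful on part of
   their domain (inverse charts, trivialisations, multiplication) are total
   functions whose values elsewhere are irrelevant. *)

(* f is C^k at every point of the open set D. *)
Fixpoint Ck (R : realType) (m n k : nat) (D : set 'rV[R]_m)
    (f : 'rV[R]_m -> 'rV[R]_n) : Prop :=
  match k with
  | 0%N => forall x, D x -> {for x, continuous f}
  | k'.+1 => (forall x, D x -> differentiable f x) /\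
             forall v, Ck k' D (fun x => 'd f x v)
  end.

Definition Cinfty (R : realType) (m n : nat) (D : set 'rV[R]_m)
    (f : 'rV[R]_m -> 'rV[R]_n) : Prop :=
  forall k, Ck k D f.

(* A set with an indexed atlas; the topology is the one defined by the atlas
   (see [mopen]).  [prm i] is the inverse of the chart [crd i], and [chart_at x]
   is a chart around [x], fixed once and for all. *)
Record manifold_data (R : realType) := ManifoldData {
  pt :> Type;
  mdim : nat;
  chart : Type;
  dom : chart -> set pt;
  crd : chart -> pt -> 'rV[R]_mdim;
  prm : chart -> 'rV[R]_mdim -> pt;
  chart_at : pt -> chart
}.

Definition mopen (R : realType) (X : manifold_data R) (W : set X) : Prop :=
  forall i : chart X, open (crd i @` (W `&` dom i)).

Record is_manifold (R : realType) (X : manifold_data R) : Prop := IsManifold {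
  dom_chart_at : forall x : X, dom (chart_at x) x;
  crdK : forall (i : chart X) (x : X), dom i x -> prm i (crd i x) = x;
  open_overlap : forall i j : chart X, open (crd i @` (dom i `&` dom j));
  smooth_transition : forall i j : chart X,
    Cinfty (crd i @` (dom i `&` dom j)) (crd j \o prm i);
  mhausdorff : forall x y : X, x <> y ->
    exists U V : set X,
      [/\ mopen U, mopen V, U x, V y & U `&` V = set0];
  msecond_countable : exists B : nat -> set X,
    (forall k, mopen (B k)) /\
    forall (W : set X) (x : X), mopen W -> W x ->
      exists2 k, B k x & B k `<=` W
}.

(* Smoothness of f on an open subset O of X. *)
Definition smooth_on_open (R : realType) (X Y : manifold_data R) (O : set X)
    (f : X -> Y) : Prop :=
  forall (i : chart X) (j : chart Y),
    let D := crd i @` (O `&` dom i `&` f @^-1` (dom j)) in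
    open D /\ Cinfty D (crd j \o f \o prm i).

Definition smooth (R : realType) (X Y : manifold_data R) (f : X -> Y) : Prop :=
  smooth_on_open setT f.

(* F is a smooth map on an open neighbourhood O of a, equal to f on A near a. *)
Definition local_extension (R : realType) (X Y : manifold_data R) (A : set X)
    (f : X -> Y) (a : X) (O : set X) (F : X -> Y) : Prop :=
  [/\ mopen O, O a, smooth_on_open O F & forall x, A x -> O x -> F x = f x].

(* Smoothness on an arbitrary subset A of X; if A is an embedded submanifold,
   this is smoothness on that submanifold. *)
Definition smooth_on (R : realType) (X Y : manifold_data R) (A : set X)
    (f : X -> Y) : Prop :=
  forall a, A a -> exists O F, local_extension A f a O F.

Definition prodm (R : realType) (X Y : manifold_data R) : manifold_data R :=
  {| pt := (X * Y)%type;
     mdim := (mdim X + mdim Y)%N;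
     chart := (chart X * chart Y)%type;
     dom := fun ij => dom ij.1 `*` dom ij.2;
     crd := fun ij p => row_mx (crd ij.1 p.1) (crd ij.2 p.2);
     prm := fun ij y => (prm ij.1 (lsubmx y), prm ij.2 (rsubmx y));
     chart_at := fun p => (chart_at p.1, chart_at p.2) |}.

(* The tangent space at x is identified with R^(mdim X) by means of the chart
   [chart_at x]; accordingly, the tangent map of f at x is the differential of
   f read in the charts [chart_at x] and [chart_at (f x)]. *)
Definition tmap (R : realType) (X Y : manifold_data R) (f : X -> Y) (x : X)
    (v : 'rV[R]_(mdim X)) : 'rV[R]_(mdim Y) :=
  'd (crd (chart_at (f x)) \o f \o prm (chart_at x)) (crd (chart_at x) x) v.

(* Tangent map at a of a map f that is smooth on A, for v tangent to A: apply
   the tangent map of a smooth local extension of f (if A is an embedded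
   submanifold the result does not depend on the extension). *)
Definition tmap_on (R : realType) (X Y : manifold_data R) (A : set X)
    (f : X -> Y) (a : X) (v : 'rV[R]_(mdim X)) : 'rV[R]_(mdim Y) :=
  xget 0 [set w | exists O F, local_extension A f a O F /\ w = tmap F a v
                              :> 'rV[R]_(mdim Y)].

Definition submersion (R : realType) (X Y : manifold_data R) (f : X -> Y) :
    Prop :=
  smooth f /\
  forall (x : X) (w : 'rV[R]_(mdim Y)), exists v, tmap f x v = w.

(* [tcrd a x] is the local trivialisation a on the fibre over x, and
   [tprm a x] its inverse. *)
Record vbundle_data (R : realType) (X : manifold_data R) := VBundleData {
  fib :> X -> lmodType R;
  rank : nat;
  triv : Type;
  tdom : triv -> set X;
  tcrd : triv -> forall x, fib x -> 'rV[R]_rank;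
  tprm : triv -> forall x, 'rV[R]_rank -> fib x;
  triv_at : X -> triv
}.

(* The total space; its charts are pairs of a chart of the base and a local
   trivialisation. *)
Definition total_space (R : realType) (X : manifold_data R)
    (E : vbundle_data X) : manifold_data R :=
  {| pt := {x : X & E x};
     mdim := (mdim X + rank E)%N;
     chart := (chart X * triv E)%type;
     dom := fun ia => [set e | dom ia.1 (tag e) /\ tdom ia.2 (tag e)];
     crd := fun ia e => row_mx (crd ia.1 (tag e)) (tcrd ia.2 (tagged e));
     prm := fun ia y => let x := prm ia.1 (lsubmx y) in
                        Tagged (fib E) (tprm ia.2 x (rsubmx y));
     chart_at := fun e => (chart_at (tag e), triv_at E (tag e)) |}.

Definition vec (R : realType) (X : manifold_data R) (E : vbundle_data X)
    (x : X) (e : E x) : total_space E := Tagged (fib E) e.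

(* Openness of the domains of the trivialisations and smoothness of the
   transition functions are part of [is_manifold (total_space E)]. *)
Record is_vbundle (R : realType) (X : manifold_data R) (E : vbundle_data X) :
    Prop := IsVBundle {
  base_manifold : is_manifold X;
  total_manifold : is_manifold (total_space E);
  tdom_triv_at : forall x : X, tdom (triv_at E x) x;
  tcrd_linear : forall (a : triv E) (x : X), tdom a x ->
    linear (@tcrd _ _ E a x);
  tcrdK : forall (a : triv E) (x : X), tdom a x ->
    cancel (@tcrd _ _ E a x) (tprm a x);
  tprmK : forall (a : triv E) (x : X), tdom a x ->
    cancel (tprm a x) (@tcrd _ _ E a x)
}.

Definition tangent (R : realType) (X : manifold_data R) : vbundle_data X :=
  {| fib := fun _ => 'rV[R]_(mdim X);
     rank := mdim X;
     triv := chart X;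
     tdom := @dom R X;
     tcrd := fun i x v =>
       'd (crd i \o prm (chart_at x)) (crd (chart_at x) x) v;
     tprm := fun i x v =>
       'd (crd (chart_at x) \o prm i) (crd i x) v;
     triv_at := @chart_at R X |}.

Definition whitney_sum (R : realType) (X : manifold_data R)
    (E F : vbundle_data X) : vbundle_data X :=
  {| fib := fun x => (E x * F x)%type;
     rank := (rank E + rank F)%N;
     triv := (triv E * triv F)%type;
     tdom := fun ab => tdom ab.1 `&` tdom ab.2;
     tcrd := fun ab x e => row_mx (tcrd ab.1 e.1) (tcrd ab.2 e.2);
     tprm := fun ab x y => (tprm ab.1 x (lsubmx y), tprm ab.2 x (rsubmx y));
     triv_at := fun x => (triv_at E x, triv_at F x) |}.

Record groupoid_data (R : realType) (G M : manifold_data R) := GroupoidData {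
  src : G -> M;
  tgt : G -> M;
  gone : M -> G;
  ginv : G -> G;
  gmul : G -> G -> G
}.

Definition composable (R : realType) (G M : manifold_data R)
    (GG : groupoid_data G M) : set (prodm G G) :=
  [set p | src GG p.1 = tgt GG p.2].

Definition gmul2 (R : realType) (G M : manifold_data R)
    (GG : groupoid_data G M) (p : prodm G G) : G := gmul GG p.1 p.2.

Record is_lie_groupoid (R : realType) (G M : manifold_data R)
    (GG : groupoid_data G M) : Prop := IsLieGroupoid {
  arrows_manifold : is_manifold G;
  objects_manifold : is_manifold M;
  src_submersion : submersion (src GG);
  tgt_submersion : submersion (tgt GG);
  gone_smooth : smooth (gone GG);
  ginv_smooth : smooth (ginv GG);
  gmul_smooth : smooth_on (composable GG) (gmul2 GG);
  src_gone : forall x, src GG (gone GG x) = x;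
  tgt_gone : forall x, tgt GG (gone GG x) = x;
  src_gmul : forall g h, src GG g = tgt GG h ->
    src GG (gmul GG g h) = src GG h;
  tgt_gmul : forall g h, src GG g = tgt GG h ->
    tgt GG (gmul GG g h) = tgt GG g;
  gmulA : forall g h k, src GG g = tgt GG h -> src GG h = tgt GG k ->
    gmul GG g (gmul GG h k) = gmul GG (gmul GG g h) k;
  gmul1 : forall g, gmul GG g (gone GG (src GG g)) = g;
  gmul1g : forall g, gmul GG (gone GG (tgt GG g)) g = g;
  src_ginv : forall g, src GG (ginv GG g) = tgt GG g;
  tgt_ginv : forall g, tgt GG (ginv GG g) = src GG g;
  gmulV : forall g, gmul GG g (ginv GG g) = gone GG (tgt GG g);
  gmulVg : forall g, gmul GG (ginv GG g) g = gone GG (src GG g)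
}.

(* Structure maps of V => V_M covering those of G => M, given on the fibres. *)
Record vbgroupoid_data (R : realType) (G M : manifold_data R)
    (GG : groupoid_data G M) (V : vbundle_data G) (VM : vbundle_data M) :=
  VBGroupoidData {
  vsrc : forall g, V g -> VM (src GG g);
  vtgt : forall g, V g -> VM (tgt GG g);
  vone : forall x, VM x -> V (gone GG x);
  vinv : forall g, V g -> V (ginv GG g);
  vmul : forall g h, V g -> V h -> V (gmul GG g h)
}.

Section VBGroupoids.
Variables (R : realType) (G M : manifold_data R) (GG : groupoid_data G M).

Definition total_groupoid (V : vbundle_data G) (VM : vbundle_data M)
    (VV : vbgroupoid_data GG V VM) :
    groupoid_data (total_space V) (total_space VM) :=
  {| src := fun e : total_space V => vec (vsrc VV (tagged e));
     tgt := fun e : total_space V => vec (vtgt VV (tagged e));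
     gone := fun e : total_space VM => vec (vone VV (tagged e));
     ginv := fun e : total_space V => vec (vinv VV (tagged e));
     gmul := fun e f : total_space V => vec (vmul VV (tagged e) (tagged f)) |}.

(* s(v) = t(w); the equality is between points of the total space of V_M. *)
Definition vcomposable (V : vbundle_data G) (VM : vbundle_data M)
    (VV : vbgroupoid_data GG V VM) (g h : G) (v : V g) (w : V h) : Prop :=
  vec (vsrc VV v) = vec (vtgt VV w).

Record is_vbgroupoid (V : vbundle_data G) (VM : vbundle_data M)
    (VV : vbgroupoid_data GG V VM) : Prop := IsVBGroupoid {
  base_groupoid : is_lie_groupoid GG;
  arrows_vbundle : is_vbundle V;
  objects_vbundle : is_vbundle VM;
  total_lie_groupoid : is_lie_groupoid (total_groupoid VV);
  vsrc_linear : forall g, linear (@vsrc _ _ _ _ _ _ VV g);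
  vtgt_linear : forall g, linear (@vtgt _ _ _ _ _ _ VV g);
  vone_linear : forall x, linear (@vone _ _ _ _ _ _ VV x);
  vinv_linear : forall g, linear (@vinv _ _ _ _ _ _ VV g);
  vmul_linear : forall g h (c : R) (v v' : V g) (w w' : V h),
    vcomposable VV v w -> vcomposable VV v' w' ->
    vmul VV (c *: v + v') (c *: w + w') = c *: vmul VV v w + vmul VV v' w'
}.

Definition is_lbgroupoid (L : vbundle_data G) (LM : vbundle_data M)
    (LL : vbgroupoid_data GG L LM) : Prop :=
  [/\ is_vbgroupoid LL, rank L = 1%N & rank LM = 1%N].

Definition tangent_groupoid :
    vbgroupoid_data GG (tangent G) (tangent M) :=
  @VBGroupoidData R G M GG (tangent G) (tangent M)
    (fun g v => tmap (src GG) g v)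
    (fun g v => tmap (tgt GG) g v)
    (fun x v => tmap (gone GG) x v)
    (fun g v => tmap (ginv GG) g v)
    (fun g h v w =>
       tmap_on (composable GG) (gmul2 GG) (g, h) (row_mx v w)).

Variables (L : vbundle_data G) (LM : vbundle_data M).
Variable LL : vbgroupoid_data GG L LM.

Definition is_one_form (theta : forall g, tangent G g -> L g) : Prop :=
  (forall g, linear (theta g)) /\
  smooth (fun v : total_space (tangent G) =>
            vec (theta (tag v) (tagged v))).

(* F^{-1}(y), where F is the restriction to the fibre of L^(2) over (g, h) of
   a face map of the nerve of L. *)
Definition face_inv (g h k : G) (F : L g * L h -> L k) (y : L k) :
    L g * L h :=
  xget 0 [set l | vcomposable LL l.1 l.2 /\ F l = y].

(* pr_2^* theta - m^* theta + pr_1^* theta = 0, evaluated at the vector (v, w)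
   of T_(g, h) G^(2); the equality takes place in the fibre of L^(2), a
   subspace of L_g x L_h. *)
Definition multiplicative_form (theta : forall g, tangent G g -> L g) : Prop :=
  forall (g h : G), src GG g = tgt GG h ->
  forall (v : tangent G g) (w : tangent G h),
    vcomposable tangent_groupoid v w ->
    face_inv (fun l => l.2) (theta h w)
    - face_inv (fun l => vmul LL l.1 l.2)
        (theta (gmul GG g h) (vmul tangent_groupoid v w))
    + face_inv (fun l => l.1) (theta g v) = 0.

(* s_g^{-1}(y), for y in the fibre of L_M over s(g). *)
Definition vsrc_inv (g : G) (y : total_space LM) : L g :=
  xget 0 [set l : L g | vec (vsrc LL l) = y].

Definition morita_kernel (theta : forall g, tangent G g -> L g) :
    vbgroupoid_data GG (whitney_sum (tangent G) L)
                       (whitney_sum (tangent M) LM) :=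
  let TT := tangent_groupoid in
  @VBGroupoidData R G M GG
    (whitney_sum (tangent G) L) (whitney_sum (tangent M) LM)
    (fun g e => (vsrc TT e.1, vsrc LL e.2))
    (fun g e => (vtgt TT e.1, vtgt LL (e.2 + theta g e.1)))
    (fun x e => (vone TT e.1, vone LL e.2))
    (fun g e => (vinv TT e.1,
                 vsrc_inv (ginv GG g) (vec (vtgt LL (e.2 + theta g e.1)))))
    (fun g h e f => (vmul TT e.1 f.1,
                     vsrc_inv (gmul GG g h) (vec (vsrc LL f.2)))).

End VBGroupoids.

(* Main.v *)
Require Import Defs.
From HB Require Import structures.
From mathcomp Require Import all_boot all_order all_algebra.
From mathcomp Require Import ring lra.
From mathcomp Require Import all_classical all_reals all_analysis.

(** The groupoid axioms split into a tangent part and a line bundle part.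

    Tangent part.  Every vector (v, w) with ds(v) = dt(w) is the velocity at 0
    of a curve of composable pairs, differentiable at 0: lift the curve t(h(.))
    through the submersion s by solving s(g(.)) = t(h(.)) with a Newton
    iteration.  Hence vv' does not depend on the local extension of the
    multiplication, and each identity of the tangent groupoid is read off from
    the same identity between curves.

    Line bundle part.  s_g is injective: a vector of its kernel is moved to a
    unit fibre by multiplying with a zero vector, and there s is inverse to u
    for dimension reasons.  So s_g and t_g are isomorphisms, and the product of
    lambda and lambda' in the kernel is the product a lambda' in L with
    s(a) = t(lambda').  Theta enters only through theta(u(v)) = 0 and
    t(ee') = t(e), which follow from the first component of the
    multiplicativity equation.

    Smoothness of the product: a local extension F of the multiplication
    gives the tangent map of F on the tangent part, and in trivialisations of L
    and L_M the map s_g^-1 is division by a nonvanishing smooth function. *)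

Set Implicit Arguments.
Unset Strict Implicit.
Unset Printing Implicit Defensive.

Import Order.TTheory GRing.Theory Num.Theory.
Import numFieldNormedType.Exports.

Local Open Scope classical_set_scope.
Local Open Scope ring_scope.

(** * Calculus on R^n *)

(** The obstacle is that the multiplication of [GG] is smooth only in the sense of local extensions
    off the composable pairs, and [tmap_on] selects the differential of an unspecified one. Two
    extensions agree only on composable pairs, so their differentials can be compared only along
    velocities of composable curves; no manifold structure on the set of composable pairs is ever
    built. The curves need no regularity away from 0, so the Newton iteration may be solved for each
    parameter value separately, without an implicit function theorem.

    Line components over the same arrow are compared by their sources alone. The target of an
    inverse is obtained as t(e^-1) = t(e^-1 e), which avoids a formula for [theta] on inverses.

    Fibres over g(hk) and (gh)k are different types, so identities of this kind are stated between
    points of total spaces, through [vec]. *)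

Section Differential.
Variables (R : realType) (m n p : nat).

Lemma rV_linear_continuous (f : {linear 'rV[R]_m -> 'rV[R]_n}) : continuous f.
Proof.
have -> : (f : _ -> _) = \sum_i fun x : 'rV[R]_m => x 0 i *: f (delta_mx 0 i).
  apply/funext => x; rewrite [in LHS](row_sum_delta x) linear_sum fct_sumE.
  by apply: eq_bigr => i _; rewrite linearZ.
move=> x; apply/differentiable_continuous/differentiable_sum => i.
exact/differentiableZl/differentiable_coord.
Qed.

(** ['d] is a chosen linear map, so agreement near [x] does not identify the differentials by
    computation: the expansion of [f] is transported to [g], and uniqueness of the linear part does
    the rest. *)
Lemma near_eq_diff (K : numFieldType) (V W : normedModType K) (f g : V -> W) (x : V) :
  {near x, f =1 g} -> differentiable f x ->
  differentiable g x /\ 'd g x = 'd f x :> (V -> W).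
Proof.
move=> fg df; have fgx := nbhs_singleton fg.
have [dfc dfE] := (diff_locallyP _ _).1 df.
have gE : g \o shift x = cst (g x) + 'd f x +o_ 0 id.
  apply/eqaddoP => _/posnumP[e].
  have /eqaddoP /(_ e%:num (gt0 e)) := dfE.
  have : \forall y \near (0 : V), f (y + x) = g (y + x).
    by move: fg; rewrite (near_shift 0)/=; apply: filterS => y; rewrite subr0.
  apply: filterS2 => y fgy.
  by rewrite /= !fctE /= -fgx -fgy.
have dE := diff_unique dfc gE.
split=> //; apply/diff_locallyP.
by rewrite dE; split.
Qed.

Lemma near_eq_differentiable (K : numFieldType) (V W : normedModType K) (f g : V -> W) (x : V) :
  {near x, f =1 g} -> differentiable f x -> differentiable g x.
Proof. by move=> fg df; have [] := near_eq_diff fg df. Qed.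

Lemma near_eq_diffE (K : numFieldType) (V W : normedModType K) (f g : V -> W) (x v : V) :
  {near x, f =1 g} -> differentiable f x -> 'd g x v = 'd f x v.
Proof. by move=> fg df; have [_ E] := near_eq_diff fg df; exact: (congr1 (@^~ v) E). Qed.

(** Scalar functions occur only as a coordinate [f y 0 i] of a vector-valued map, since [Ck] speaks
    about row vectors. The product rule is that of the bilinear map sending [(u, w)] to
    [u 0 i *: w]. *)
Lemma diff_scale (f : 'rV[R]_m -> 'rV[R]_n) (g : 'rV[R]_m -> 'rV[R]_p) i x :
  differentiable f x -> differentiable g x ->
  differentiable (fun y => f y 0 i *: g y) x /\
  forall v, 'd (fun y => f y 0 i *: g y) x v =
            'd f x v 0 i *: g x + f x 0 i *: 'd g x v.
Proof.
pose B (u : 'rV[R]_n) (w : 'rV[R]_p) := u 0 i *: w.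
have Bbil : bilinear_for (GRing.Scale.Law.clone _ _ *:%R _) (GRing.Scale.Law.clone _ _ *:%R _) B.
  split=> [u|u] a y z /=; rewrite /B.
    by rewrite !mxE scalerDl scalerA.
  by rewrite scalerDr !scalerA mulrC.
pose BB : {bilinear _ -> _ -> _} := HB.pack B (bilinear_isBilinear.Build _ _ _ _ _ _ B Bbil).
have Bc : continuous (fun q : 'rV[R]_n * 'rV[R]_p => BB q.1 q.2).
  move=> q; apply: (@cvgZ _ _ _ _ _ (fun q : 'rV[R]_n * 'rV[R]_p => q.1 0 i : R) snd).
    apply: (@continuous_comp _ _ _ fst (fun N : 'rV[R]_n => N 0 i)).
      exact: cvg_fst.
    exact: coord_continuous.
  exact: cvg_snd.
move=> df dg.
have dp := differentiable_pair df dg.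
have dB := @differentiable_bilin _ _ _ _ BB (f x, g x) Bc.
split; first exact: (differentiable_comp dp dB).
move=> v.
have E1 := congr1 (@^~ v) (diff_comp dp dB).
have E2 := congr1 (@^~ ('d (fun y => (f y, g y)) x v)) (@diff_bilin _ _ _ _ BB (f x, g x) Bc).
have E3 := congr1 (@^~ v) (diff_pair df dg).
etransitivity; first exact: E1.
etransitivity; first exact: E2.
rewrite [X in BB _ X.2 + BB X.1 _]E3.
by rewrite addrC.
Qed.

Lemma differentiable_scale (f : 'rV[R]_m -> 'rV[R]_n) (g : 'rV[R]_m -> 'rV[R]_p) i x :
  differentiable f x -> differentiable g x ->
  differentiable (fun y => f y 0 i *: g y) x.
Proof. by move=> df dg; have [] := diff_scale i df dg. Qed.

Lemma diff_scaleE (f : 'rV[R]_m -> 'rV[R]_n) (g : 'rV[R]_m -> 'rV[R]_p) i x v :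
  differentiable f x -> differentiable g x ->
  'd (fun y => f y 0 i *: g y) x v =
  'd f x v 0 i *: g x + f x 0 i *: 'd g x v.
Proof. by move=> df dg; have [_] := diff_scale i df dg; exact. Qed.

End Differential.

(** * Closure properties of C^k and smooth maps *)

Section Ck.
Variable R : realType.

Lemma diff_compE (K : numFieldType) (U V W : normedModType K) (f : U -> V) (g : V -> W) x v :
  differentiable f x -> differentiable g (f x) ->
  'd (g \o f) x v = 'd g (f x) ('d f x v).
Proof. by move=> df dg; have := congr1 (@^~ v) (diff_comp df dg). Qed.

Lemma Ck_sub m n k (D E : set 'rV[R]_m) (f : 'rV[R]_m -> 'rV[R]_n) :
  E `<=` D -> Ck k D f -> Ck k E f.
Proof.
elim: k f => [|k IH] f ED /=; first by move=> H x /ED/H.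
by move=> [df H]; split=> [x /ED/df//|v]; exact: IH.
Qed.

Lemma Ck_ext m n k (D : set 'rV[R]_m) (f g : 'rV[R]_m -> 'rV[R]_n) :
  open D -> (forall x, D x -> f x = g x) -> Ck k D f -> Ck k D g.
Proof.
elim: k f g => [|k IH] f g oD fg /=.
  move=> H x Dx; have fgx : {near x, f =1 g}.
    by near=> y; apply: fg; near: y; exact: open_nbhs_nbhs.
  have := H x Dx; rewrite /prop_for /continuous_at -(fg x Dx).
  exact: cvg_trans (near_eq_cvg fgx).
have fgx x (Dx : D x) : {near x, f =1 g}.
  by near=> y; apply: fg; near: y; exact: open_nbhs_nbhs.
move=> [df H]; split=> [x Dx|v].
  exact: (near_eq_differentiable (fgx x Dx) (df x Dx)).
refine (IH _ _ oD _ (H v)) => x Dx.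
exact: (esym (near_eq_diffE _ (fgx x Dx) (df x Dx))).
Unshelve. all: end_near. Qed.

(** The conditions in [Ck] concern the total function [f] at single points of the set, so the sets
    [U] need not be open. *)
Lemma Ck_loc m n k (D : set 'rV[R]_m) (f : 'rV[R]_m -> 'rV[R]_n) :
  (forall x, D x -> exists2 U, U x & Ck k U f) -> Ck k D f.
Proof.
elim: k f => [|k IH] f H /=.
  by move=> x Dx; have [U Ux HU] := H x Dx; exact: HU.
split=> [x Dx|v]; first by have [U Ux [+ _]] := H x Dx; apply.
by apply: IH => x Dx; have [U Ux [_ Hd]] := H x Dx; exists U => //; exact: Hd.
Qed.

Lemma CkS m n k (D : set 'rV[R]_m) (f : 'rV[R]_m -> 'rV[R]_n) :
  Ck k.+1 D f -> Ck k D f.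
Proof.
elim: k f => [|k IH] f [df H] /=.
  by move=> x /df/differentiable_continuous.
by split=> // v; apply: IH; exact: H.
Qed.

Lemma Ck_continuous m n k (D : set 'rV[R]_m) (f : 'rV[R]_m -> 'rV[R]_n) :
  Ck k D f -> forall x, D x -> {for x, continuous f}.
Proof. by elim: k => [//|k IH] /CkS. Qed.

Lemma Ck_cst m n k (D : set 'rV[R]_m) (a : 'rV[R]_n) : Ck k D (cst a).
Proof.
elim: k a => [|k IH] a /=; first by move=> x _; exact/differentiable_continuous/differentiable_cst.
split=> [x _|v]; first exact: differentiable_cst.
have -> : (fun x => 'd (cst a) x v) = cst (0 : 'rV[R]_n).
  by apply/funext => x; rewrite (diff_cst a x).
exact: IH.
Qed.

Lemma Ck_linear m n k (D : set 'rV[R]_m) (f : {linear 'rV[R]_m -> 'rV[R]_n}) :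
  Ck k D f.
Proof.
have fc := @rV_linear_continuous _ _ _ f.
case: k => [|k] /=; first by move=> x _; exact: fc.
split=> [x _|v]; first exact: linear_differentiable.
have -> : (fun x => 'd f x v) = cst (f v).
  by apply/funext => x; rewrite (diff_lin x fc).
exact: Ck_cst.
Qed.

Lemma Ck_add m n k (D : set 'rV[R]_m) (f g : 'rV[R]_m -> 'rV[R]_n) :
  open D -> Ck k D f -> Ck k D g -> Ck k D (fun x => f x + g x).
Proof.
move=> oD; elim: k f g => [|k IH] f g /=.
  move=> cf cg x Dx; exact: (cvgD (cf x Dx) (cg x Dx)).
move=> [df Hf] [dg Hg]; split=> [x Dx|v].
  exact: (differentiableD (df x Dx) (dg x Dx)).
refine (Ck_ext oD _ (IH _ _ (Hf v) (Hg v))) => x Dx.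
exact: (esym (congr1 (@^~ v) (diffD (df x Dx) (dg x Dx)))).
Qed.

Lemma Ck_sum m n k (D : set 'rV[R]_m) (I : Type) (r : seq I)
  (f : I -> 'rV[R]_m -> 'rV[R]_n) :
  open D -> (forall i, Ck k D (f i)) -> Ck k D (fun x => \sum_(i <- r) f i x).
Proof.
move=> oD H; elim: r => [|i r IH].
  by under eq_fun do rewrite big_nil; exact: Ck_cst.
by under eq_fun do rewrite big_cons; exact: Ck_add.
Qed.

Lemma Ck_scale m n p k (D : set 'rV[R]_m) (f : 'rV[R]_m -> 'rV[R]_n) i
  (g : 'rV[R]_m -> 'rV[R]_p) :
  open D -> Ck k D f -> Ck k D g -> Ck k D (fun x => f x 0 i *: g x).
Proof.
move=> oD; elim: k p f g => [|k IH] q f g.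
  move=> cf cg x Dx; refine (cvgZ _ (cg x Dx)).
  apply: (@continuous_comp _ _ _ f (fun N : 'rV[R]_n => N 0 i)); first exact: (cf x Dx).
  exact: coord_continuous.
move=> Cf Cg; have [df Hf] := Cf; have [dg Hg] := Cg.
split=> [x Dx|v].
  exact: (differentiable_scale i (df x Dx) (dg x Dx)).
have C1 := IH _ _ _ (Hf v) (CkS Cg).
have C2 := IH _ _ _ (CkS Cf) (Hg v).
refine (Ck_ext oD _ (Ck_add oD C1 C2)) => x Dx.
exact: (esym (diff_scaleE i _ (df x Dx) (dg x Dx))).
Qed.

(** The derivative of [g \o f] in a fixed direction is a sum of coordinates of ['d f x v] times
    derivatives of [g] along basis vectors, composed with [f]. Fixing the directions is what lets
    the induction hypothesis apply. *)
Lemma Ck_comp m n p k (D : set 'rV[R]_m) (E : set 'rV[R]_n)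
  (f : 'rV[R]_m -> 'rV[R]_n) (g : 'rV[R]_n -> 'rV[R]_p) :
  open D -> (forall x, D x -> E (f x)) -> Ck k D f -> Ck k E g ->
  Ck k D (g \o f).
Proof.
move=> oD DE; elim: k g => [|k IH] g.
  move=> cf cg x Dx; exact: (continuous_comp (cf x Dx) (cg _ (DE x Dx))).
move=> Cf Cg; have [df Hf] := Cf; have [dg Hg] := Cg.
split=> [x Dx|v].
  exact: (differentiable_comp (df x Dx) (dg _ (DE x Dx))).
have C j : Ck k D (fun x => 'd f x v 0 j *: 'd g (f x) (delta_mx 0 j)).
  exact: (Ck_scale j oD (Hf v) (IH _ (CkS Cf) (Hg (delta_mx 0 j)))).
refine (Ck_ext oD _ (Ck_sum (index_enum _) oD C)) => x Dx.
rewrite (diff_compE v (df x Dx) (dg _ (DE x Dx))).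
rewrite [in RHS](row_sum_delta ('d f x v)) linear_sum.
by apply: eq_bigr => j _; rewrite linearZ.
Qed.

Lemma diff_coord n (i : 'I_n) (x v : 'rV[R]_n) :
  'd (fun N : 'rV[R]_n => N 0 i : R) x v = v 0 i.
Proof.
have L : linear (fun N : 'rV[R]_n => N 0 i : R) by move=> a u w; rewrite !mxE.
pose f : {linear 'rV[R]_n -> R} :=
  HB.pack (fun N : 'rV[R]_n => N 0 i : R) (GRing.isLinear.Build _ _ _ _ _ L).
have fc : continuous f by exact: coord_continuous.
exact: (congr1 (@^~ v) (diff_lin x fc)).
Qed.

(** One order of differentiability is given up: the base case takes continuity from
    differentiability, and nothing is lost for [Cinfty]. The derivative is 1/f_i times 1/f_i times
    the vector -f_i' w, and the induction hypothesis covers each factor 1/f_i. *)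
Lemma Ck_inv m n p k (D : set 'rV[R]_m) (f : 'rV[R]_m -> 'rV[R]_n) i
  (w : 'rV[R]_p) :
  open D -> (forall x, D x -> f x 0 i != 0) -> Ck k.+1 D f ->
  Ck k D (fun x => (f x 0 i)^-1 *: w).
Proof.
move=> oD f0.
have dc x : differentiable f x -> differentiable (fun y => f y 0 i : R) x.
  by move=> df; exact: (differentiable_comp df (differentiable_coord _ _ _)).
have df1 q (w' : 'rV[R]_q) x : D x -> differentiable f x ->
    differentiable (fun y => (f y 0 i)^-1 *: w') x.
  by move=> Dx df; exact: (differentiableZl _ (differentiableV (dc x df) (f0 x Dx))).
have dfE q (w' : 'rV[R]_q) x v : D x -> differentiable f x ->
    'd (fun y => (f y 0 i)^-1 *: w') x v =
      (f x 0 i)^-1 *: ((f x 0 i)^-1 *: ('d f x v 0 i *: - w')).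
  move=> Dx df; have dV := differentiableV (dc x df) (f0 x Dx).
  have E1 := congr1 (@^~ v) (diffZl w' dV).
  have E2 := congr1 (@^~ v) (diffV (dc x df) (f0 x Dx)).
  have E3 : 'd (fun y => f y 0 i : R) x v = 'd f x v 0 i.
    rewrite -[RHS](diff_coord i (f x)).
    exact: (diff_compE _ df (differentiable_coord _ _ _)).
  rewrite [LHS]E1 [X in X *: w']E2 /= E3.
  rewrite scalerN !scalerN !scalerA -scaleNr; congr (_ *: _).
  by rewrite /GRing.scale /= expr2 invfM mulNr.
elim: k p w => [|k IH] q w Cf.
  have [df _] := Cf.
  by move=> x Dx; exact: (differentiable_continuous (df1 _ _ _ Dx (df x Dx))).
have [df Hf] := Cf.
split=> [x Dx|v]; first exact: (df1 _ _ _ Dx (df x Dx)).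
(* The scalar 1/f_i is encoded as a row vector of length one, the form that [Ck_scale] accepts. *)
have C1 := IH _ (const_mx 1 : 'rV[R]_1) (CkS Cf).
have C2 := Ck_scale i oD (CkS (Hf v)) (Ck_cst k D (- w)).
refine (Ck_ext oD _ (Ck_scale ord0 oD C1 (Ck_scale ord0 oD C1 C2))) => x Dx.
by rewrite (dfE _ _ _ _ Dx (df x Dx)) !mxE !mulr1.
Qed.

End Ck.

Section Cinfty.
Variable R : realType.
Implicit Types m n p : nat.

Lemma Cinfty_differentiable m n (D : set 'rV[R]_m) (f : 'rV[R]_m -> 'rV[R]_n) x :
  Cinfty D f -> D x -> differentiable f x.
Proof. by move=> Cf Dx; have [df _] := Cf 1%N; exact: df. Qed.

Lemma Cinfty_sub m n (D E : set 'rV[R]_m) (f : 'rV[R]_m -> 'rV[R]_n) :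
  E `<=` D -> Cinfty D f -> Cinfty E f.
Proof. by move=> ED Cf k; exact: Ck_sub (Cf k). Qed.

Lemma Cinfty_ext m n (D : set 'rV[R]_m) (f g : 'rV[R]_m -> 'rV[R]_n) :
  open D -> (forall x, D x -> f x = g x) -> Cinfty D f -> Cinfty D g.
Proof. by move=> oD fg Cf k; exact: (Ck_ext oD fg (Cf k)). Qed.

Lemma Cinfty_loc m n (D : set 'rV[R]_m) (f : 'rV[R]_m -> 'rV[R]_n) :
  (forall x, D x -> exists2 U, U x & Cinfty U f) -> Cinfty D f.
Proof.
move=> H k; apply: Ck_loc => x Dx; have [U Ux CU] := H x Dx.
by exists U => //; exact: CU.
Qed.

Lemma Cinfty_cst m n (D : set 'rV[R]_m) (a : 'rV[R]_n) : Cinfty D (cst a).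
Proof. by move=> k; exact: Ck_cst. Qed.

Lemma Cinfty_linear m n (D : set 'rV[R]_m) (f : {linear 'rV[R]_m -> 'rV[R]_n}) :
  Cinfty D f.
Proof. by move=> k; exact: Ck_linear. Qed.

Lemma Cinfty_id m (D : set 'rV[R]_m) : Cinfty D (fun x => x).
Proof. exact: (@Cinfty_linear _ _ _ idfun). Qed.

Lemma Cinfty_lsubmx m n (D : set 'rV[R]_(m + n)) : Cinfty D (fun x => lsubmx x).
Proof. exact: (@Cinfty_linear _ _ _ lsubmx). Qed.

Lemma Cinfty_rsubmx m n (D : set 'rV[R]_(m + n)) : Cinfty D (fun x => rsubmx x).
Proof. exact: (@Cinfty_linear _ _ _ rsubmx). Qed.

Lemma Cinfty_add m n (D : set 'rV[R]_m) (f g : 'rV[R]_m -> 'rV[R]_n) :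
  open D -> Cinfty D f -> Cinfty D g -> Cinfty D (fun x => f x + g x).
Proof. by move=> oD Cf Cg k; exact: Ck_add (Cf k) (Cg k). Qed.

Lemma Cinfty_sum m n (D : set 'rV[R]_m) (I : Type) (r : seq I)
  (f : I -> 'rV[R]_m -> 'rV[R]_n) :
  open D -> (forall i, Cinfty D (f i)) ->
  Cinfty D (fun x => \sum_(i <- r) f i x).
Proof. by move=> oD Cf k; apply: Ck_sum => // i; exact: Cf. Qed.

Lemma Cinfty_scale m n p (D : set 'rV[R]_m) (f : 'rV[R]_m -> 'rV[R]_n) i
  (g : 'rV[R]_m -> 'rV[R]_p) :
  open D -> Cinfty D f -> Cinfty D g -> Cinfty D (fun x => f x 0 i *: g x).
Proof. by move=> oD Cf Cg k; exact: Ck_scale (Cf k) (Cg k). Qed.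

Lemma Cinfty_inv m n p (D : set 'rV[R]_m) (f : 'rV[R]_m -> 'rV[R]_n) i
  (w : 'rV[R]_p) :
  open D -> (forall x, D x -> f x 0 i != 0) -> Cinfty D f ->
  Cinfty D (fun x => (f x 0 i)^-1 *: w).
Proof. by move=> oD f0 Cf k; exact: (Ck_inv w oD f0 (Cf k.+1)). Qed.

Lemma Cinfty_comp m n p (D : set 'rV[R]_m) (E : set 'rV[R]_n)
  (f : 'rV[R]_m -> 'rV[R]_n) (g : 'rV[R]_n -> 'rV[R]_p) :
  open D -> (forall x, D x -> E (f x)) -> Cinfty D f -> Cinfty E g ->
  Cinfty D (g \o f).
Proof. by move=> oD DE Cf Cg k; exact: (Ck_comp oD DE (Cf k) (Cg k)). Qed.

Lemma Cinfty_row_mx m n p (D : set 'rV[R]_m) (f : 'rV[R]_m -> 'rV[R]_n)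
  (g : 'rV[R]_m -> 'rV[R]_p) :
  open D -> Cinfty D f -> Cinfty D g -> Cinfty D (fun x => row_mx (f x) (g x)).
Proof.
move=> oD Cf Cg.
have C1 := Cinfty_comp (E := setT) oD (fun _ _ => I) Cf
  (@Cinfty_linear _ _ _ (mulmxr (row_mx 1%:M (0 : 'M[R]_(n, p))))).
have C2 := Cinfty_comp (E := setT) oD (fun _ _ => I) Cg
  (@Cinfty_linear _ _ _ (mulmxr (row_mx (0 : 'M[R]_(p, n)) 1%:M))).
refine (Cinfty_ext oD _ (Cinfty_add oD C1 C2)) => x _ /=.
by rewrite !mul_mx_row !mulmx0 !mulmx1 add_row_mx addr0 add0r.
Qed.

Lemma open_Cinfty_preimage m n (D : set 'rV[R]_m) (f : 'rV[R]_m -> 'rV[R]_n) U :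
  open D -> Cinfty D f -> open U -> open (D `&` f @^-1` U).
Proof.
move=> oD Cf oU; rewrite openE => x [Dx Ux]; rewrite /interior.
have cf : {for x, continuous f} by exact: (Ck_continuous (Cf 0%N)).
near=> y; split; first by near: y; exact: open_nbhs_nbhs.
by near: y; apply: cf; exact: open_nbhs_nbhs.
Unshelve. all: end_near. Qed.

(** Smoothness in the point and the vector jointly, as tangent bundles require: linearity in the
    vector reduces it to the derivatives along basis vectors. *)
Lemma Cinfty_diff m n (D : set 'rV[R]_m) (f : 'rV[R]_m -> 'rV[R]_n) :
  open D -> Cinfty D f ->
  Cinfty [set y | D (lsubmx y)] (fun y => 'd f (lsubmx y) (rsubmx y)).
Proof.
move=> oD Cf.
have oD' : open [set y : 'rV[R]_(m + m) | D (lsubmx y)].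
  rewrite -[X in open X]setTI.
  exact: (open_Cinfty_preimage openT (@Cinfty_lsubmx _ _ _) oD).
have C j : Cinfty [set y : 'rV[R]_(m + m) | D (lsubmx y)]
    (fun y => rsubmx y 0 j *: 'd f (lsubmx y) (delta_mx 0 j)).
  apply: Cinfty_scale => //; first exact: Cinfty_rsubmx.
  apply: (Cinfty_comp (E := D) (g := fun x => 'd f x (delta_mx 0 j))) => //.
    exact: Cinfty_lsubmx.
  by move=> k; have [_ H] := Cf k.+1; exact: H.
refine (Cinfty_ext oD' _ (Cinfty_sum (index_enum _) oD' C)) => x _.
rewrite [in RHS](row_sum_delta (rsubmx x)) linear_sum.
by apply: eq_bigr => j _; rewrite linearZ.
Qed.

End Cinfty.

(* Locked: terms in ['d f x] carry the normed module structures along, which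
   makes unification very slow. *)
HB.lock Definition dif (R : realType) m n (f : 'rV[R]_m -> 'rV[R]_n)
  (x v : 'rV[R]_m) : 'rV[R]_n := 'd f x v.

Section Dif.
Variable R : realType.

Lemma dif_diff m n (f : 'rV[R]_m -> 'rV[R]_n) x v : dif f x v = 'd f x v.
Proof. by rewrite dif.unlock. Qed.

Lemma dif_is_linear m n (f : 'rV[R]_m -> 'rV[R]_n) x : linear (dif f x).
Proof. by move=> a u v; rewrite dif.unlock linearP. Qed.

HB.instance Definition _ m n (f : 'rV[R]_m -> 'rV[R]_n) x :=
  GRing.isLinear.Build R 'rV[R]_m 'rV[R]_n _ (dif f x) (dif_is_linear f x).

Lemma difE m n (f : 'rV[R]_m -> 'rV[R]_n) x v :
  dif f x v = \sum_j v 0 j *: dif f x (delta_mx 0 j).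
Proof.
rewrite [in LHS](row_sum_delta v) linear_sum.
by apply: eq_bigr => j _; rewrite linearZ.
Qed.

Lemma Cinfty_dif_cst m n (D : set 'rV[R]_m) (f : 'rV[R]_m -> 'rV[R]_n) v :
  Cinfty D f -> Cinfty D (fun x => dif f x v).
Proof. by rewrite dif.unlock => Cf k; have [_ H] := Cf k.+1; exact: H. Qed.

Lemma Cinfty_dif m n (D : set 'rV[R]_m) (f : 'rV[R]_m -> 'rV[R]_n) :
  open D -> Cinfty D f ->
  Cinfty [set y | D (lsubmx y)] (fun y => dif f (lsubmx y) (rsubmx y)).
Proof. by rewrite dif.unlock; exact: Cinfty_diff. Qed.

Lemma Cinfty_continuous m n (D : set 'rV[R]_m) (f : 'rV[R]_m -> 'rV[R]_n) x :
  Cinfty D f -> D x -> {for x, continuous f}.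
Proof. by move=> Cf; exact: (Ck_continuous (Cf 0%N)). Qed.

Lemma dif_ext m n (D : set 'rV[R]_m) (f g : 'rV[R]_m -> 'rV[R]_n) x v :
  open D -> D x -> (forall y, D y -> f y = g y) -> differentiable f x ->
  dif f x v = dif g x v.
Proof.
move=> oD Dx fg df; rewrite !dif_diff; apply/esym/near_eq_diffE => //.
by near=> y; apply: fg; near: y; exact: open_nbhs_nbhs.
Unshelve. all: end_near. Qed.

Lemma dif_comp m n p (f : 'rV[R]_m -> 'rV[R]_n) (g : 'rV[R]_n -> 'rV[R]_p) x v :
  differentiable f x -> differentiable g (f x) ->
  dif (g \o f) x v = dif g (f x) (dif f x v).
Proof. by rewrite !dif_diff; exact: diff_compE. Qed.

Lemma dif_linear m n (f : {linear 'rV[R]_m -> 'rV[R]_n}) x v : dif f x v = f v.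
Proof. by rewrite !dif_diff; exact: (congr1 (@^~ v) (diff_lin x (@rV_linear_continuous _ _ _ f))). Qed.

Lemma dif_id m (x v : 'rV[R]_m) : dif id x v = v.
Proof. exact: (@dif_linear _ _ idfun). Qed.

End Dif.

(** * Strict differentiability of smooth maps *)

Section StrictDifferential.
Variable R : realType.

Lemma rV_norm_le n (x : 'rV[R]_n) (e : R) :
  0 <= e -> (forall j, `|x 0 j| <= e) -> `|x| <= e.
Proof.
move=> e0 H; rewrite /Num.Def.normr/= mx_normrE (bigmax_le _ e0)//= => -[i j] _ /=.
by rewrite ord1.
Qed.

Lemma rV_coord_norm_le n (x : 'rV[R]_n) j : `|x 0 j| <= `|x|.
Proof.
by rewrite [leRHS]/Num.Def.normr/= mx_normrE; exact: (le_bigmax _ _ (ord0, j)).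
Qed.

Lemma rV_linear_lipschitz m n (f : {linear 'rV[R]_m -> 'rV[R]_n}) :
  exists2 k, k > 0 & forall x, `|f x| <= k * `|x|.
Proof. exact: (linear_lipschitz (@rV_linear_continuous _ _ _ f)). Qed.

(** In finite dimension, continuity of the finitely many partial derivatives at [x] is continuity of
    the differential in operator norm. *)
Lemma diff_near_bound m n (D : set 'rV[R]_m) (f : 'rV[R]_m -> 'rV[R]_n) x (e : R) :
  open D -> Cinfty D f -> D x -> 0 < e ->
  \forall z \near x, forall h, `|dif f z h - dif f x h| <= e * `|h|.
Proof.
move=> oD Cf Dx e0.
(* [m.+1] instead of [m] keeps the bound positive when [m = 0]; the sum of [m] such terms is still
   at most [e]. *)
have e1 : 0 < e / m.+1%:R by rewrite divr_gt0.
have cd (j : 'I_m) : \forall z \near x,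
    `|dif f z (delta_mx 0 j) - dif f x (delta_mx 0 j)| <= e / m.+1%:R.
  have /cvgrPdist_le /(_ _ e1) :=
    Cinfty_continuous (Cinfty_dif_cst (delta_mx 0 j) Cf) Dx.
  by apply: filterS => z; rewrite distrC.
have := filter_forall (nbhs_filter x) cd; apply: filterS => z Hz h.
have -> : dif f z h - dif f x h =
    \sum_j h 0 j *: (dif f z (delta_mx 0 j) - dif f x (delta_mx 0 j)).
  rewrite [dif f z h]difE [dif f x h]difE -sumrB.
  by apply: eq_bigr => j _; rewrite scalerBr.
apply: le_trans (ler_norm_sum _ _ _) _.
apply: (@le_trans _ _ (\sum_(j < m) `|h| * (e / m.+1%:R))).
  apply: ler_sum => j _; rewrite normrZ.
  by apply: ler_pM => //; exact: rV_coord_norm_le.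
have N0 : 0 <= `|h| by [].
move: (`|h| : R) N0 => N N0.
rewrite -mulr_sumr mulrC ler_wpM2r // sumr_const card_ord -[leLHS]mulr_natr.
rewrite mulrAC ler_pdivrMr // ler_wpM2l ?ltW //.
by rewrite ltr_nat.
Qed.

(* Mean value inequality applied coordinatewise to f - dif f x on a segment *)
Lemma strict_diff m n (D : set 'rV[R]_m) (f : 'rV[R]_m -> 'rV[R]_n) x (e : R) :
  open D -> Cinfty D f -> D x -> 0 < e ->
  exists2 d, 0 < d & forall y z, `|y - x| < d -> `|z - x| < d ->
    `|f y - f z - dif f x (y - z)| <= e * `|y - z|.
Proof.
move=> oD Cf Dx e0.
have nD : \forall z \near x, D z by exact: open_nbhs_nbhs.
have /nbhs_ballP [d /= d0 Hd] : nbhs x [set z | D z /\ forall h, `|dif f z h - dif f x h| <= e * `|h|].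
  exact: filterI nD (diff_near_bound oD Cf Dx e0).
exists d => // y z yd zd; pose h : 'rV[R]_m := y - z; rewrite -/h.
(* Balls are convex, and the point is a convex combination of [y] and [z]. *)
have seg (s : R) : 0 <= s <= 1 -> ball x d (z + s *: h).
  move=> /andP[s0 s1]; rewrite -ball_normE /= distrC.
  have -> : z + s *: h - x = (1 - s) *: (z - x) + s *: (y - x).
    by apply/rowP => j; rewrite !mxE; ring.
  apply: le_lt_trans (ler_normD _ _) _; rewrite !normrZ.
  rewrite (ger0_norm s0) ger0_norm ?subr_ge0//.
  apply: (@le_lt_trans _ _ (Num.max `|z - x| `|y - x|)); last first.
    by rewrite gt_max zd.
  have -> : Num.max `|z - x| `|y - x| =
      (1 - s) * Num.max `|z - x| `|y - x| + s * Num.max `|z - x| `|y - x|.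
    by rewrite -mulrDl subrK mul1r.
  by rewrite lerD // ler_wpM2l ?subr_ge0 // le_max lexx ?orbT.
apply: rV_norm_le => [|j]; first by rewrite mulr_ge0 // ltW.
pose phi s : R := (f (z + s *: h) - s *: dif f x h) 0 j.
pose dphi s : R := (dif f (z + s *: h) h - dif f x h) 0 j.
have dphiP (s : R) : 0 <= s <= 1 -> is_derive s 1 phi (dphi s).
  move=> /seg/Hd[Ds _].
  pose A (t : R) := z + t *: h.
  pose w := dif f x h.
  have iA : is_diff s A (fun t : R => t *: h).
    by apply: is_diff_eq; rewrite add0r.
  have iF : is_diff (A s) f (dif f (A s)).
    apply: DiffDef; first exact: Cinfty_differentiable Cf Ds.
    by apply/funext => u; rewrite dif_diff.
  have iFA := is_diff_comp iA iF.
  have iB := is_diffB iFA (is_diff_scalel s w).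
  have iC (N : 'rV[R]_n) : is_diff N (fun N : 'rV[R]_n => N 0 j : R) (fun N => N 0 j).
    apply: DiffDef; first exact: differentiable_coord.
    by apply/funext => u; rewrite diff_coord.
  have iphi : is_diff s phi _ := is_diff_comp iB (iC _).
  split; first exact/diff_derivable/ex_diff.
  rewrite deriveE; last exact: ex_diff.
  by rewrite diff_val /= !fctE /= !scale1r.
have [||s /[!in_itv]/= /andP[s0 s1] E] := @MVT _ phi dphi 0 1 ltr01.
- move=> s; rewrite in_itv /= => /andP[s0 s1]; apply: dphiP.
  by rewrite !ltW.
- apply: derivable_within_continuous => s; rewrite in_itv /= => s01.
  by have [] := dphiP s s01.
have -> : (f y - f z - dif f x h) 0 j = phi 1 - phi 0.
  rewrite /phi !scale1r !scale0r !addr0 subr0 /h [z + _]addrC subrK.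
  by rewrite !mxE addrAC.
rewrite E subr0 mulr1 /dphi.
apply: le_trans (rV_coord_norm_le _ _) _.
have [|_] := Hd (z + s *: h); last exact.
by apply: seg; rewrite !ltW.
Qed.
End StrictDifferential.

(** * Velocities at 0 of curves in R^n *)

Section Velocity.
Variable R : realType.

(* c(t) = a + t v + o(t) at t = 0 *)
Definition has_velocity n (c : R -> 'rV[R]_n) (a v : 'rV[R]_n) : Prop :=
  forall e : R, 0 < e -> \forall t \near (0 : R), `|c t - a - t *: v| <= e * `|t|.

Lemma has_velocity_line n (a v : 'rV[R]_n) : has_velocity (fun t => a + t *: v) a v.
Proof.
move=> e e0; near=> t.
by rewrite (addrC a) addrK subrr normr0 mulr_ge0 // ltW.
Unshelve. all: end_near. Qed.

Lemma has_velocity_ext n (c c' : R -> 'rV[R]_n) a v :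
  (\forall t \near (0 : R), c t = c' t) -> has_velocity c a v -> has_velocity c' a v.
Proof.
move=> cc' H e e0; apply: filterS2 cc' (H e e0) => t E H1.
by rewrite -E.
Qed.

Lemma has_velocity_cvg n (c : R -> 'rV[R]_n) a v :
  has_velocity c a v -> c t @[t --> (0 : R)] --> a.
Proof.
move=> H; apply/cvgrPdist_le => e e0.
have k0 : 0 < 1 + `|v| by rewrite ltr_pwDl.
have n1 := H 1 ltr01.
have n2 : \forall t \near (0 : R), `|t| <= e / (1 + `|v|).
  apply/nbhs_ballP; exists (e / (1 + `|v|)) => /=; first by rewrite divr_gt0.
  by move=> t; rewrite -ball_normE /= sub0r normrN => /ltW.
apply: filterS2 n1 n2 => t H1 H2.
rewrite distrC -(subrK (t *: v) (c t - a)).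
apply: le_trans (ler_normD _ _) _; rewrite normrZ.
rewrite ler_pdivlMr // in H2.
apply: le_trans H2; rewrite mulrDr mulr1 mulrC lerD2r.
by rewrite mul1r in H1.
Qed.

Lemma has_velocity_unique n (c : R -> 'rV[R]_n) a v w :
  has_velocity c a v -> has_velocity c a w -> v = w.
Proof.
move=> Hv Hw; apply/eqP; rewrite -subr_eq0 -normr_le0; apply/ler_addgt0Pl => e e0.
have e2 : 0 < e / 2 by rewrite divr_gt0.
have /nbhs_ballP[d /= d0 Hd] : nbhs (0 : R) [set t | `|c t - a - t *: v| <= e / 2 * `|t| /\ `|c t - a - t *: w| <= e / 2 * `|t|].
  exact: filterI (Hv _ e2) (Hw _ e2).
have d20 : 0 < d / 2 by rewrite divr_gt0.
have [] := Hd (d / 2).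
  by rewrite -ball_normE /= sub0r normrN gtr0_norm // ltr_pdivrMr // ltr_pMr // ltr1n.
rewrite (gtr0_norm d20); set t := d / 2 => H1 H2.
have H : `|t *: (v - w)| <= e / 2 * t + e / 2 * t.
  have -> : t *: (v - w) = (c t - a - t *: w) - (c t - a - t *: v).
    by apply/rowP => j; rewrite !mxE; ring.
  by apply: le_trans (ler_normB _ _) _; rewrite lerD.
rewrite -mulrDl -splitr normrZ (gtr0_norm d20) mulrC ler_pM2r // in H.
by rewrite addr0.
Qed.

Lemma has_velocity_comp m n (D : set 'rV[R]_m) (f : 'rV[R]_m -> 'rV[R]_n) c a v :
  open D -> Cinfty D f -> D a -> has_velocity c a v ->
  has_velocity (f \o c) (f a) (dif f a v).
Proof.
move=> oD Cf Da Hc e e0.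
have [k k0 Hk] := rV_linear_lipschitz (dif f a).
have K0 : 0 < 1 + `|v| by rewrite ltr_pwDl.
(* Near 0 the curve stays within [(1 + |v|) * |t|] of [a], so with this constant the Taylor
   remainder of [f] contributes at most [e / 2 * |t|]. The constant with [k] does the same for the
   image of the error of [c] under the differential. *)
have e1 : 0 < e / 2 / (1 + `|v|) by rewrite !divr_gt0.
have e2 : 0 < e / 2 / k by rewrite !divr_gt0.
have [d d0 Hd] := strict_diff oD Cf Da e1.
have n1 : \forall t \near (0 : R), `|c t - a| < d.
  have /cvgrPdist_lt/(_ d d0) := has_velocity_cvg Hc.
  by apply: filterS => t; rewrite distrC.
apply: filterS3 n1 (Hc _ e2) (Hc _ ltr01) => t Ht H1 H2.
have {}Hd := Hd (c t) a Ht; rewrite subrr normr0 in Hd.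
have {}Hd := Hd d0.
have -> : (f \o c) t - f a - t *: dif f a v =
  (f (c t) - f a - dif f a (c t - a)) + dif f a (c t - a - t *: v).
  by rewrite [X in _ = _ + X]linearB [in RHS]linearZ /= addrA subrK.
apply: le_trans (ler_normD _ _) _; rewrite (splitr e) mulrDl lerD //.
  apply: le_trans Hd _; have E0 : 0 <= e / 2 by rewrite divr_ge0 // ltW.
  move: (e / 2) E0 => E E0; rewrite mulrAC ler_pdivrMr // -mulrA ler_wpM2l //.
  rewrite -(subrK (t *: v) (c t - a)).
  apply: le_trans (ler_normD _ _) _; rewrite normrZ mulrDr mulr1 lerD2r.
  by rewrite mul1r in H2.
apply: le_trans (Hk _) _; rewrite mulrC -ler_pdivlMr // mulrAC.
exact: H1.
Qed.

Lemma has_velocity_row_mx m n (c : R -> 'rV[R]_m) (c' : R -> 'rV[R]_n) a v a' v' :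
  has_velocity c a v -> has_velocity c' a' v' ->
  has_velocity (fun t => row_mx (c t) (c' t)) (row_mx a a') (row_mx v v').
Proof.
move=> H H' e e0; apply: filterS2 (H e e0) (H' e e0) => t H1 H2.
apply: rV_norm_le => [|j]; first by rewrite mulr_ge0 // ltW.
rewrite scale_row_mx !opp_row_mx !add_row_mx mxE.
by case: splitP => i _; [apply: le_trans H1|apply: le_trans H2]; exact: rV_coord_norm_le.
Qed.

End Velocity.

(** * Lifting curves through a submersion *)

Section Lifting.
Variable R : realType.

Lemma rV_right_inverse m n (A : {linear 'rV[R]_m -> 'rV[R]_n}) :
  (forall w, exists u, A u = w) ->
  exists B : {linear 'rV[R]_n -> 'rV[R]_m}, forall w, A (B w) = w.
Proof.
move=> sA; have [u Hu] := choice (fun j : 'I_n => sA (delta_mx 0 j)).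
exists (mulmxr (\matrix_j u j)) => w /=.
rewrite mulmx_sum_row linear_sum [RHS]row_sum_delta.
by apply: eq_bigr => j _; rewrite linearZ rowK Hu.
Qed.

Lemma rV_banach_fixed_point n (U : set 'rV[R]_n) (T : 'rV[R]_n -> 'rV[R]_n)
  (q : {nonneg R}) :
  {homo T : y / U y} -> q%:num < 1 ->
  (forall y z, U y -> U z -> `|T y - T z| <= q%:num * `|y - z|) ->
  closed U -> U !=set0 -> exists2 y, U y & T y = y.
Proof.
move=> UT q1 lip cU nU.
pose X : completeNormedModType R := HB.pack 'rV[R]_n (Complete.on 'rV[R]_n) (NormedModule.on 'rV[R]_n).
have [|//|//|y Uy Ey] := @banach_fixed_point R X U (mkfun_fun UT).
  by exists q; split => //; move=> [y z] [Uy Uz]; exact: lip.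
by exists y.
Qed.

(* Newton's method with the frozen derivative: for t small, the map
   y |-> y - (f (x + t v + B y) - c t), with B a right inverse of the
   differential, is a 1/2-contraction of a ball of radius o(t). *)
Lemma has_velocity_lift m n (D : set 'rV[R]_m) (f : 'rV[R]_m -> 'rV[R]_n) x v c :
  open D -> Cinfty D f -> D x -> (forall w, exists u, dif f x u = w) ->
  has_velocity c (f x) (dif f x v) ->
  exists2 g : R -> 'rV[R]_m, has_velocity g x v &
    \forall t \near (0 : R), f (g t) = c t.
Proof.
move=> oD Cf Dx sA Hc.
have [B AB] := @rV_right_inverse _ _ (dif f x) sA.
have [k k0 Hk] := rV_linear_lipschitz B.
(* [B] expands norms by at most [k], so an error constant 1/(2k) for [f] makes the iteration a
   contraction with ratio 1/2. *)
have e1 : 0 < (2 * k)^-1 by rewrite invr_gt0 mulr_gt0.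
have [d d0 Hd] := strict_diff oD Cf Dx e1.
pose q t := x + t *: v.
pose r t : R := `|f (q t) - c t|.
have Hr (e : R) : 0 < e -> \forall t \near (0 : R), r t <= e * `|t|.
  move=> e0; have e2 : 0 < e / 2 by rewrite divr_gt0.
  have H1 := has_velocity_comp oD Cf Dx (has_velocity_line x v).
  apply: filterS2 (H1 _ e2) (Hc _ e2) => t Ht1 Ht2.
  have -> : r t = `|(f (q t) - f x - t *: dif f x v) - (c t - f x - t *: dif f x v)|.
    by rewrite /r; congr (`|_|); apply/rowP => j; rewrite !mxE; ring.
  by apply: le_trans (ler_normB _ _) _; rewrite (splitr e) mulrDl lerD.
have fixp : \forall t \near (0 : R), exists2 y, f (q t + B y) = c t & `|y| <= 2 * r t.
  have V0 : 0 < 1 + `|v| by rewrite ltr_pwDl.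
  have n1 : \forall t \near (0 : R), `|q t - x| < d / 2.
    have d2 : 0 < d / 2 by rewrite divr_gt0.
    have /cvgrPdist_lt/(_ _ d2) := has_velocity_cvg (has_velocity_line x v).
    by apply: filterS => t; rewrite distrC.
  have n2 : \forall t \near (0 : R), k * (2 * r t) < d / 2.
    have e0 : 0 < d / 4 / k by rewrite !divr_gt0.
    have n3 : \forall t \near (0 : R), `|t| < 1.
      apply/nbhs_ballP; exists 1 => //= t.
      by rewrite -ball_normE /= sub0r normrN.
    apply: filterS2 n3 (Hr _ e0) => t t1 Ht.
    have : r t < d / 4 / k.
      by apply: le_lt_trans Ht _; rewrite gtr_pMr.
    rewrite ltr_pdivlMr // => H.
    rewrite mulrCA (mulrC k).
    by move: H; set z := r t * k; lra.
  apply: filterS2 n1 n2 => t Ht1 Ht2.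
  (* With ratio 1/2 and [|T 0| = r t], a ball of radius [2 * r t] around 0 is mapped into itself by
     [T]. *)
  pose U := [set y : 'rV[R]_n | `|y| <= 2 * r t].
  pose T y := y - (f (q t + B y) - c t).
  have r0 : 0 <= r t by exact: normr_ge0.
  have inD y : U y -> `|q t + B y - x| < d.
    move=> Uy; rewrite addrAC (splitr d); apply: le_lt_trans (ler_normD _ _) _.
    rewrite ltrD //; apply: le_lt_trans (Hk _) _.
    by apply: le_lt_trans Ht2; rewrite ler_wpM2l // ltW.
  have lip y z : U y -> U z -> `|T y - T z| <= 2^-1 * `|y - z|.
    move=> /inD Uy /inD Uz; have := Hd _ _ Uy Uz.
    have -> : q t + B y - (q t + B z) = B (y - z).
      by rewrite linearB /= opprD addrACA subrr add0r.
    rewrite AB => H.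
    have -> : T y - T z = - (f (q t + B y) - f (q t + B z) - (y - z)).
      by apply/rowP => j; rewrite !mxE; ring.
    rewrite normrN; apply: le_trans H _.
    rewrite invfM -mulrA ler_wpM2l //.
    by rewrite -ler_pdivlMl ?invr_gt0 // invrK.
  have T0 : `|T 0| = r t by rewrite /T linear0 addr0 sub0r normrN.
  have U0 : U 0 by rewrite /U /= normr0 mulr_ge0.
  have UT : {homo T : y / U y}.
    move=> y Uy; rewrite /U /= -(subrK (T 0) (T y)).
    apply: le_trans (ler_normD _ _) _; rewrite T0.
    have := lip y 0 Uy U0; rewrite subr0; move: Uy; rewrite /U /=.
    by move: (r t) (`|y|) (`|T y - T 0|) => a b e; lra.
  have UE : U = closed_ball_ Num.norm 0 (2 * r t).
    by apply/funext => y; rewrite /U /closed_ball_ /= sub0r normrN.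
  have q0 : 0 <= 2^-1 :> R by rewrite invr_ge0.
  have [||||y Uy Ey] := @rV_banach_fixed_point _ U T (NngNum q0) UT.
  - by rewrite /= invf_lt1 // ltr1n.
  - exact: lip.
  - by rewrite UE; exact: closed_closed_ball_.
  - by exists 0.
  exists y => //; apply/eqP; rewrite -subr_eq0; apply/eqP.
  have : y - T y = 0 by rewrite Ey subrr.
  by rewrite /T opprB addrC subrK.
(* The solutions are picked for each [t] independently. No continuity in [t] is needed: the bound
   [2 * r t] is o(t), which already gives the lifted curve velocity [v] at 0. *)
pose P t y := f (q t + B y) = c t /\ `|y| <= 2 * r t.
pose y t := xget 0 (P t).
have nP : \forall t \near (0 : R), P t (y t).
  by apply: filterS fixp => t [z Hz1 Hz2]; exact: (@xgetPex _ 0 (P t) (ex_intro _ z (conj Hz1 Hz2))).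
exists (fun t => q t + B (y t)); last by apply: filterS nP => t [].
move=> e e0; have e2 : 0 < e / (2 * k) by rewrite divr_gt0 // mulr_gt0.
apply: filterS2 nP (Hr _ e2) => t [_ Ht1] Ht2.
have -> : q t + B (y t) - x - t *: v = B (y t).
  by rewrite /q; apply/rowP => j; rewrite !mxE; ring.
apply: le_trans (Hk _) _; rewrite -ler_pdivlMl //.
apply: le_trans Ht1 _; rewrite -ler_pdivlMl //.
apply: le_trans Ht2 _; rewrite le_eqVlt; apply/orP; left; apply/eqP.
by field; rewrite gt_eqF.
Qed.
End Lifting.

(** * Manifolds and tangent maps *)

(* [is_manifold] without the Hausdorff and countability axioms, so that it need
   not be checked in full for the products that occur as domains of maps. *)
Record is_atlas (R : realType) (X : manifold_data R) : Prop := IsAtlas {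
  atlas_dom : forall x : X, dom (chart_at x) x;
  atlas_crdK : forall (i : chart X) (x : X), dom i x -> prm i (crd i x) = x;
  atlas_open : forall i j : chart X, open (crd i @` (dom i `&` dom j));
  atlas_smooth : forall i j : chart X,
    Cinfty (crd i @` (dom i `&` dom j)) (crd j \o prm i)
}.

Arguments atlas_open {R X} _ i j.
Arguments atlas_smooth {R X} _ i j.

Lemma manifold_atlas (R : realType) (X : manifold_data R) :
  is_manifold X -> is_atlas X.
Proof. by case. Qed.

(** * Local smoothness, tested in one pair of charts *)

Definition smooth_near (R : realType) (X Y : manifold_data R) (f : X -> Y)
  (x : X) : Prop := exists O, [/\ mopen O, O x & smooth_on_open O f].

(** [smooth_on_open] asks for openness and smoothness in all pairs of charts. Checking one pair near
    one point is enough, by [smooth_in_near]; this predicate is the hypothesis of that test. *)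
Definition smooth_in (R : realType) (X Y : manifold_data R) (i : chart X)
  (j : chart Y) (f : X -> Y) (U : set 'rV[R]_(mdim X)) : Prop :=
  [/\ open U, U `<=` crd i @` dom i, forall y, U y -> dom j (f (prm i y)) &
      Cinfty U (crd j \o f \o prm i)].

Section Atlas.
Variables (R : realType) (X : manifold_data R).
Hypothesis aX : is_atlas X.
Implicit Types (A W : set X) (i j : chart X) (x : X).

Lemma crd_inj i x y : dom i x -> dom i y -> crd i x = crd i y -> x = y.
Proof. by move=> dx dy E; rewrite -(atlas_crdK aX dx) E (atlas_crdK aX dy). Qed.

Lemma crd_image i x A : dom i x -> (crd i @` (A `&` dom i)) (crd i x) <-> A x.
Proof.
move=> dx; split=> [[y [Ay dy]]|Ax]; last by exists x.
by move/(crd_inj dy dx) => <-.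
Qed.

Lemma open_crd_dom i : open (crd i @` dom i).
Proof. by have := atlas_open aX i i; rewrite setIid. Qed.

Lemma mopen_dom i : mopen (dom i).
Proof. by move=> j; rewrite setIC; exact: atlas_open. Qed.

Lemma mopenT : mopen [set: X].
Proof. by move=> i; rewrite setTI; exact: open_crd_dom. Qed.

Lemma mopenI A W : mopen A -> mopen W -> mopen (A `&` W).
Proof.
move=> oA oW i.
have -> : crd i @` ((A `&` W) `&` dom i) =
    (crd i @` (A `&` dom i)) `&` (crd i @` (W `&` dom i)).
  apply/seteqP; split=> y.
    by move=> [x [[Ax Wx] dx] <-]; split; exists x.
  move=> [[x [Ax dx] <-]] [z [Wz dz]] E.
  by exists x => //; split=> //; split=> //; rewrite -(crd_inj dz dx E).
exact: openI.
Qed.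

Lemma mopen_chart i (U : set 'rV[R]_(mdim X)) :
  open U -> mopen [set x | dom i x /\ U (crd i x)].
Proof.
move=> oU j.
suff -> : crd j @` ([set x | dom i x /\ U (crd i x)] `&` dom j) =
    (crd j @` (dom j `&` dom i)) `&` (crd i \o prm j) @^-1` U.
  exact: open_Cinfty_preimage (atlas_open aX j i) (atlas_smooth aX j i) oU.
apply/seteqP; split=> y; last first.
  move=> [[x [dj di] <-]] /=; rewrite (atlas_crdK aX dj) => Ux.
  by exists x.
move=> [x [[di Ux] dj] <-]; split; first by exists x.
by rewrite /= (atlas_crdK aX dj).
Qed.

Lemma mopen_loc W :
  (forall x, W x -> exists O, [/\ mopen O, O x & O `<=` W]) -> mopen W.
Proof.
move=> H i; rewrite openE => y [x [Wx dx] <-]; have [V [oO Ox OW]] := H x Wx.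
rewrite /interior; apply: (@filterS _ _ _ (crd i @` (V `&` dom i))).
  by move=> z [t [Ot dt] <-]; exists t => //; split=> //; exact: OW.
by apply: open_nbhs_nbhs; split; [exact: oO|exists x].
Qed.

Lemma mopen_chartP W x i : mopen W -> W x -> dom i x ->
  exists U, [/\ open U, U (crd i x), U `<=` crd i @` dom i &
    forall y, U y -> W (prm i y)].
Proof.
move=> oW Wx dx; exists (crd i @` (W `&` dom i)); split.
- exact: oW.
- by exists x.
- by move=> _ [y [Wy dy] <-]; exists y.
- by move=> _ [y [Wy dy] <-]; rewrite (atlas_crdK aX dy).
Qed.

End Atlas.

Arguments open_crd_dom {R X} aX i.
Arguments mopen_dom {R X} aX i.

Section SmoothNear.
Variables (R : realType) (X Y : manifold_data R).
Hypotheses (aX : is_atlas X) (aY : is_atlas Y).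
Implicit Types (f g : X -> Y) (O : set X).

(** The new domain is cut down twice: first so that the point lies in the old source chart, then so
    that its image lies in the new target chart. Injectivity of charts turns membership in
    coordinate images back into membership of points. *)
Lemma smooth_in_transition i j i' j' f U x :
  smooth_in i j f U -> dom i x -> U (crd i x) -> dom i' x -> dom j' (f x) ->
  exists W, [/\ smooth_in i' j' f W, W (crd i' x) &
    forall y, W y -> dom i (prm i' y) /\ U (crd i (prm i' y))].
Proof.
move=> [oU Udom Uj Cf] dx Ux dx' fx'.
have dj z : dom i z -> U (crd i z) -> dom j (f z).
  by move=> dz /Uj; rewrite (atlas_crdK aX dz).
pose A := crd i' @` (dom i' `&` dom i).
pose T := crd i \o prm i'.
have CT : Cinfty A T by exact: atlas_smooth.
have oA : open A by exact: atlas_open.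
pose D1 := A `&` T @^-1` U.
have oD1 : open D1 by exact: open_Cinfty_preimage.
pose g := crd j \o f \o prm i.
have C1 : Cinfty D1 (g \o T).
  apply: (Cinfty_comp (E := U)) => //; first by move=> y [].
  by apply: Cinfty_sub CT => y [].
pose B := crd j @` (dom j `&` dom j').
have oB : open B by exact: atlas_open.
pose D2 := D1 `&` (g \o T) @^-1` B.
have oD2 : open D2 by exact: open_Cinfty_preimage.
have D2P y : D2 y -> exists z, [/\ dom i' z, dom i z, U (crd i z), dom j' (f z) & y = crd i' z].
  move=> [[[z [dz' dz] <-]]]; rewrite /T /= (atlas_crdK aX dz') => Uz.
  rewrite /g /= (atlas_crdK aX dz) => -[w [dw dw'] E].
  exists z; split=> //.
  by rewrite -(crd_inj aY dw (dj _ dz Uz) E).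
exists D2; split; last first.
- by move=> _ /D2P[z [dz' dz Uz _ ->]]; rewrite (atlas_crdK aX dz').
- split; first split; first by exists x.
  + by rewrite /T /= (atlas_crdK aX dx').
  + rewrite /g /T /= (atlas_crdK aX dx') (atlas_crdK aX dx).
    by exists (f x) => //; split=> //; exact: dj.
- split=> //.
  + by move=> _ /D2P[z [dz' _ _ _ ->]]; exists z.
  + by move=> _ /D2P[z [dz' _ _ fz ->]]; rewrite (atlas_crdK aX dz').
  + have C2 : Cinfty D2 ((crd j' \o prm j) \o (g \o T)).
      apply: (Cinfty_comp (E := B)) => //; first by move=> y [].
        by apply: Cinfty_sub C1 => y [].
      exact: atlas_smooth.
    refine (Cinfty_ext oD2 _ C2) => _ /D2P[z [dz' dz Uz fz ->]].
    rewrite /T /g /= (atlas_crdK aX dz') (atlas_crdK aX dz).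
    by rewrite (atlas_crdK aY (dj _ dz Uz)).
Qed.

Lemma smooth_near_in i j f x : smooth_near f x -> dom i x -> dom j (f x) ->
  exists2 U, smooth_in i j f U & U (crd i x).
Proof.
move=> [V [oO Ox sf]] dx dfx; have [oD CD] := sf i j.
exists (crd i @` (V `&` dom i `&` f @^-1` dom j)); last by exists x.
split=> //.
  by move=> _ [z [[_ dz] _] <-]; exists z.
by move=> _ [z [[_ dz] fz] <-]; rewrite (atlas_crdK aX dz).
Qed.

Lemma smooth_in_near i j f U x : smooth_in i j f U -> dom i x -> U (crd i x) ->
  smooth_near f x.
Proof.
move=> sf dx Ux; have [oU _ _ _] := sf.
pose O := [set z | dom i z /\ U (crd i z)].
exists O; split=> //; first exact: mopen_chart.
move=> i' j' D.
have H y : D y -> exists W, [/\ open W, W y, W `<=` D & Cinfty W (crd j' \o f \o prm i')].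
  move=> [z [[[dz Uz] dz'] fz] <-].
  have [W [[oW Wi Wj CW] Wz WU]] := smooth_in_transition sf dz Uz dz' fz.
  exists W; split=> // u Wu; have [t dt E] := Wi u Wu; exists t => //.
  by move: (WU u Wu) (Wj u Wu); rewrite -E (atlas_crdK aX dt).
split.
  rewrite openE => y /H [W [oW Wy WD _]]; rewrite /interior.
  by apply: filterS WD _; exact: open_nbhs_nbhs.
by apply: Cinfty_loc => y /H [W [oW Wy WD CW]]; exists W.
Qed.

Lemma smooth_on_openP O f : mopen O ->
  smooth_on_open O f <-> forall x, O x -> smooth_near f x.
Proof.
move=> oO; split=> [sf x Ox|H i j D]; first by exists O.
have H' y : D y -> exists W, [/\ open W, W y, W `<=` D & Cinfty W (crd j \o f \o prm i)].
  move=> [x [[Ox dx] fx] <-].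
  have [U [oU Udom Uj CU] Ux] := smooth_near_in (H x Ox) dx fx.
  exists (U `&` crd i @` (O `&` dom i)); split.
  - by apply: openI => //; exact: oO.
  - by split=> //; exists x.
  - move=> _ [/[swap] [[z [Oz dz] <-]] Uz]; exists z => //; split=> //.
    by have := Uj _ Uz; rewrite (atlas_crdK aX dz).
  - by apply: Cinfty_sub CU => z [].
split.
  rewrite openE => y /H' [W [oW Wy WD _]]; rewrite /interior.
  by apply: filterS WD _; exact: open_nbhs_nbhs.
by apply: Cinfty_loc => y /H' [W [oW Wy WD CW]]; exists W.
Qed.

Lemma smoothP f : smooth f <-> forall x, smooth_near f x.
Proof.
rewrite /smooth smooth_on_openP; last exact: mopenT.
by split=> H x //; exact: H.
Qed.

Lemma smooth_near_preimage f x W : smooth_near f x -> mopen W -> W (f x) ->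
  exists O, [/\ mopen O, O x & forall y, O y -> W (f y)].
Proof.
move=> sf oW Wfx; have dx := atlas_dom aX x; have dfx := atlas_dom aY (f x).
have [U [oU Udom Uj CU] Ux] := smooth_near_in sf dx dfx.
set i := chart_at x; set j := chart_at (f x).
pose V := U `&` (crd j \o f \o prm i) @^-1` (crd j @` (W `&` dom j)).
have oV : open V by apply: open_Cinfty_preimage => //; exact: oW.
exists [set z | dom i z /\ V (crd i z)]; split.
- exact: mopen_chart.
- split=> //; split=> //; exists (f x) => //=.
  by rewrite (atlas_crdK aX dx).
- move=> y [dy [Uy]] /=; rewrite (atlas_crdK aX dy).
  by move=> /(crd_image aY) H; apply: H; have := Uj _ Uy; rewrite (atlas_crdK aX dy).
Qed.

Lemma smooth_near_ext f g x O : mopen O -> O x -> (forall y, O y -> f y = g y) ->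
  smooth_near f x -> smooth_near g x.
Proof.
move=> oO Ox fg sf; have dx := atlas_dom aX x; have dfx := atlas_dom aY (f x).
have [U [oU Udom Uj CU] Ux] := smooth_near_in sf dx dfx.
have [V [oV Vx Vdom VO]] := mopen_chartP aX oO Ox dx.
have oUV : open (U `&` V) by exact: openI.
apply: (@smooth_in_near _ (chart_at (f x)) _ (U `&` V) _ _ dx) => //.
split=> //.
- by move=> y [_ /Vdom].
- by move=> y [Uy Vy]; rewrite -(fg _ (VO _ Vy)); exact: Uj.
- refine (Cinfty_ext oUV _ (Cinfty_sub _ CU)) => [y [_ Vy]|y []//].
  by rewrite /= (fg _ (VO _ Vy)).
Qed.

End SmoothNear.

(** R^n as a manifold with one chart. Charts, inverse charts and fibre coordinates thereby become
    smooth maps of manifolds, and the chain rule for [tmap] applies to them. *)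
Definition model_space (R : realType) (n : nat) : manifold_data R :=
  {| pt := 'rV[R]_n; mdim := n; chart := unit; dom := fun _ => setT;
     crd := fun _ => id; prm := fun _ => id; chart_at := fun _ => tt |}.

Section ModelSpace.
Variables (R : realType).

Lemma model_atlas n : is_atlas (model_space R n).
Proof.
split=> //= _ _; first by rewrite image_id setIT; exact: openT.
exact: Cinfty_id.
Qed.

End ModelSpace.

Section Composition.
Variables (R : realType) (X Y Z : manifold_data R).
Hypotheses (aX : is_atlas X) (aY : is_atlas Y) (aZ : is_atlas Z).

Lemma smooth_near_comp (f : X -> Y) (g : Y -> Z) x :
  smooth_near f x -> smooth_near g (f x) -> smooth_near (g \o f) x.
Proof.
move=> sf sg; have dx := atlas_dom aX x; have dfx := atlas_dom aY (f x).
have dgx := atlas_dom aZ (g (f x)).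
have [U [oU Ui Uj CU] Ux] := smooth_near_in aX sf dx dfx.
have [V [oV Vj Vk CV] Vfx] := smooth_near_in aY sg dfx dgx.
move: Ui Uj CU Ux Vj Vk CV Vfx dx dfx dgx.
set i := chart_at x; set j := chart_at (f x); set k := chart_at (g (f x)).
move=> Ui Uj CU Ux Vj Vk CV Vfx dx dfx dgx.
pose W := U `&` (crd j \o f \o prm i) @^-1` V.
have oW : open W by exact: open_Cinfty_preimage.
apply: (@smooth_in_near _ _ _ aX aZ i k _ W _ _ dx) => //; last first.
  by split=> //=; rewrite (atlas_crdK aX dx).
have E y : W y -> prm j (crd j (f (prm i y))) = f (prm i y).
  by move=> [Uy _]; rewrite (atlas_crdK aY) //; exact: Uj.
split=> //.
- by move=> y [/Ui].
- by move=> y Wy; have [_ /Vk] := Wy; rewrite /= (E _ Wy).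
- have C : Cinfty W ((crd k \o g \o prm j) \o (crd j \o f \o prm i)).
    apply: (Cinfty_comp (E := V)) => //; first by move=> y [].
    by apply: Cinfty_sub CU => y [].
  by refine (Cinfty_ext oW _ C) => y Wy; rewrite /= (E _ Wy).
Qed.

Lemma smooth_near_id x : smooth_near (@id X) x.
Proof.
have dx := atlas_dom aX x.
apply: (@smooth_in_near _ _ _ aX aX (chart_at x) (chart_at x) _ (crd (chart_at x) @` dom (chart_at x)) _ _ dx) => //.
  split=> //; first exact: open_crd_dom.
    by move=> _ [y dy <-]; rewrite (atlas_crdK aX dy).
  refine (Cinfty_ext (open_crd_dom aX _) _ (@Cinfty_id _ _ _)).
  by move=> _ [y dy <-] /=; rewrite (atlas_crdK aX dy).
Qed.

Lemma smooth_near_cst (y : Y) x : smooth_near (fun _ : X => y) x.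
Proof.
have dx := atlas_dom aX x.
apply: (@smooth_in_near _ _ _ aX aY (chart_at x) (chart_at y) _ (crd (chart_at x) @` dom (chart_at x)) _ _ dx) => //.
  split=> //; first exact: open_crd_dom.
    by move=> _ _; exact: atlas_dom.
  exact: Cinfty_cst.
Qed.

Lemma smooth_near_crd i x :
  dom i x -> smooth_near (crd i : X -> model_space R (mdim X)) x.
Proof.
move=> dx.
apply: (@smooth_in_near R X (model_space R _) aX (model_atlas R _) i tt _ (crd i @` dom i) _ _ dx) => //.
  split=> //; first exact: open_crd_dom.
  refine (Cinfty_ext (open_crd_dom aX _) _ (@Cinfty_id _ _ _)).
  by move=> _ [y dy <-] /=; rewrite (atlas_crdK aX dy).
Qed.

Lemma smooth_near_prm i x :
  dom i x -> smooth_near (prm i : model_space R (mdim X) -> X) (crd i x).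
Proof.
move=> dx.
apply: (@smooth_in_near R (model_space R _) X (model_atlas R _) aX tt i _ (crd i @` dom i)) => //.
  split=> //; first exact: (open_crd_dom aX i).
  - by move=> y _; exists y.
  - by move=> _ [y dy <-]; rewrite (atlas_crdK aX dy).
  refine (Cinfty_ext (open_crd_dom aX _) _ (@Cinfty_id _ _ _)).
  by move=> _ [y dy <-] /=; rewrite (atlas_crdK aX dy).
by exists x.
Qed.

Lemma smooth_near_op2 m n p (op : 'rV[R]_m -> 'rV[R]_n -> 'rV[R]_p)
  (f : X -> model_space R m) (g : X -> model_space R n) x :
  (forall (D : set 'rV[R]_(mdim X)) F G, open D -> Cinfty D F -> Cinfty D G ->
    Cinfty D (fun y => op (F y) (G y))) ->
  smooth_near f x -> smooth_near g x ->
  smooth_near (fun y => op (f y) (g y) : model_space R p) x.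
Proof.
move=> Hop sf sg; have dx := atlas_dom aX x.
have [U [oU Ui _ CU] Ux] := @smooth_near_in R X (model_space R _) aX _ tt _ _ sf dx I.
have [V [oV _ _ CV] Vx] := @smooth_near_in R X (model_space R _) aX _ tt _ _ sg dx I.
have oUV : open (U `&` V) by exact: openI.
apply: (@smooth_in_near R X (model_space R _) aX (model_atlas R _) (chart_at x) tt _ (U `&` V) _ _ dx) => //.
split=> //; first by move=> y [/Ui].
apply: (Hop _ (f \o prm (chart_at x)) (g \o prm (chart_at x))) => //.
  by apply: Cinfty_sub CU => y [].
by apply: Cinfty_sub CV => y [].
Qed.

Lemma smooth_near_op1 m p (op : 'rV[R]_m -> 'rV[R]_p) (U : set 'rV[R]_m)
  (f : X -> model_space R m) x :
  open U -> U (f x) -> Cinfty U op -> smooth_near f x ->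
  smooth_near (fun y => op (f y) : model_space R p) x.
Proof.
move=> oU Ux Cop sf; have dx := atlas_dom aX x.
have [V [oV Vi _ CV] Vx] := @smooth_near_in R X (model_space R _) aX _ tt _ _ sf dx I.
set i := chart_at x.
have oW : open (V `&` (f \o prm i) @^-1` U) by exact: open_Cinfty_preimage.
apply: (@smooth_in_near R X (model_space R _) aX (model_atlas R _) i tt _ (V `&` (f \o prm i) @^-1` U) _ _ dx) => //.
  split=> //; first by move=> y [/Vi].
  apply: (Cinfty_comp (E := U) (f := f \o prm i)) => //; first by move=> y [].
  by apply: Cinfty_sub CV => y [].
by split=> //=; rewrite (atlas_crdK aX dx).
Qed.

End Composition.

Section Coordinates.
Variables (R : realType) (X Y : manifold_data R).
Hypotheses (aX : is_atlas X) (aY : is_atlas Y).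

Lemma smooth_near_of_crd (f : X -> Y) x j O : mopen O -> O x ->
  (forall y, O y -> dom j (f y)) ->
  smooth_near (fun y => crd j (f y) : model_space R (mdim Y)) x ->
  smooth_near f x.
Proof.
move=> oO Ox Oj sf.
have H : smooth_near (prm j \o (fun y => crd j (f y) : model_space R (mdim Y))) x.
  apply: smooth_near_comp sf _ => //; first exact: model_atlas.
  by apply: smooth_near_prm => //; exact: Oj.
apply: smooth_near_ext oO Ox _ H => // y Oy /=.
by rewrite (atlas_crdK aY) //; exact: Oj.
Qed.

Lemma smooth_near_crd_comp (f : X -> Y) x j : dom j (f x) -> smooth_near f x ->
  smooth_near (fun y => crd j (f y) : model_space R (mdim Y)) x.
Proof.
move=> dfx sf; have sc := smooth_near_crd aY dfx.
exact: (smooth_near_comp aX aY (model_atlas R _) sf sc).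
Qed.

End Coordinates.

Section Product.
Variables (R : realType) (X Y Z : manifold_data R).
Hypotheses (aX : is_atlas X) (aY : is_atlas Y) (aZ : is_atlas Z).

Lemma open_lrsubmx m n (A : set 'rV[R]_m) (B : set 'rV[R]_n) : open A -> open B ->
  open [set y : 'rV[R]_(m + n) | A (lsubmx y) /\ B (rsubmx y)].
Proof.
move=> oA oB; apply: openI.
  rewrite -[X in open X]setTI.
  exact: (open_Cinfty_preimage openT (@Cinfty_lsubmx _ _ _ _) oA).
rewrite -[X in open X]setTI.
exact: (open_Cinfty_preimage openT (@Cinfty_rsubmx _ _ _ _) oB).
Qed.

Lemma prodm_atlas : is_atlas (prodm X Y).
Proof.
have E (i i' : chart X) (j j' : chart Y) :
    crd ((i, j) : chart (prodm X Y)) @`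
      (dom ((i, j) : chart (prodm X Y)) `&` dom ((i', j') : chart (prodm X Y)))
    = [set y | (crd i @` (dom i `&` dom i')) (lsubmx y) /\
               (crd j @` (dom j `&` dom j')) (rsubmx y)].
  apply/seteqP; split=> y.
    move=> [[a b] [[/= da db] [da' db']] <-] /=.
    by rewrite row_mxKl row_mxKr; split; [exists a|exists b].
  move=> [[a [da da'] Ea] [b [db db'] Eb]].
  by exists (a, b) => //=; rewrite Ea Eb hsubmxK.
split.
- by move=> [a b]; split; exact: atlas_dom.
- move=> [i j] [a b] [/= da db].
  by rewrite row_mxKl row_mxKr (atlas_crdK aX da) (atlas_crdK aY db).
- by move=> [i j] [i' j']; rewrite E; apply: open_lrsubmx; exact: atlas_open.
- move=> [i j] [i' j']; rewrite E.
  have oE := open_lrsubmx (atlas_open aX i i') (atlas_open aY j j').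
  apply: Cinfty_row_mx => //.
    apply: (Cinfty_comp (f := lsubmx) (E := crd i @` (dom i `&` dom i')) (g := crd i' \o prm i)) => //.
    - by move=> y [].
    - exact: Cinfty_lsubmx.
    - exact: atlas_smooth.
  apply: (Cinfty_comp (f := rsubmx) (E := crd j @` (dom j `&` dom j')) (g := crd j' \o prm j)) => //.
  - by move=> y [].
  - exact: Cinfty_rsubmx.
  - exact: atlas_smooth.
Qed.

Lemma smooth_near_fst (p : prodm X Y) : smooth_near (fst : prodm X Y -> X) p.
Proof.
have dp := atlas_dom prodm_atlas p.
apply: (@smooth_in_near _ _ _ prodm_atlas aX (chart_at p) (chart_at p.1) _
  (crd (chart_at p) @` dom (chart_at p)) _ _ dp) => //.
have oD := open_crd_dom prodm_atlas (chart_at p).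
split=> //.
  by move=> _ [q [dq _] <-] /=; rewrite row_mxKl (atlas_crdK aX dq).
refine (Cinfty_ext oD _ (@Cinfty_lsubmx _ _ _ _)) => _ [q [dq _] <-] /=.
by rewrite row_mxKl (atlas_crdK aX dq).
Qed.

Lemma smooth_near_snd (p : prodm X Y) : smooth_near (snd : prodm X Y -> Y) p.
Proof.
have dp := atlas_dom prodm_atlas p.
apply: (@smooth_in_near _ _ _ prodm_atlas aY (chart_at p) (chart_at p.2) _
  (crd (chart_at p) @` dom (chart_at p)) _ _ dp) => //.
have oD := open_crd_dom prodm_atlas (chart_at p).
split=> //.
  by move=> _ [q [_ dq] <-] /=; rewrite row_mxKr (atlas_crdK aY dq).
refine (Cinfty_ext oD _ (@Cinfty_rsubmx _ _ _ _)) => _ [q [_ dq] <-] /=.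
by rewrite row_mxKr (atlas_crdK aY dq).
Qed.

Lemma smooth_near_row_mx m n (f : Z -> model_space R m) (g : Z -> model_space R n) z :
  smooth_near f z -> smooth_near g z ->
  smooth_near (fun y => row_mx (f y) (g y) : model_space R (m + n)) z.
Proof. by apply: smooth_near_op2 => // D F G; exact: Cinfty_row_mx. Qed.

Lemma smooth_near_pair (f : Z -> X) (g : Z -> Y) z :
  smooth_near f z -> smooth_near g z ->
  smooth_near (fun y => (f y, g y) : prodm X Y) z.
Proof.
move=> sf sg.
have df := atlas_dom aX (f z); have dg := atlas_dom aY (g z).
have [ O [oO Oz Of]] := smooth_near_preimage aZ aX sf (mopen_dom aX _) df.
have [W [oO' Oz' Og]] := smooth_near_preimage aZ aY sg (mopen_dom aY _) dg.
apply: (@smooth_near_of_crd _ _ _ aZ prodm_atlas _ _ (chart_at (f z), chart_at (g z)) (O `&` W)).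
- exact: mopenI.
- by [].
- by move=> y [/Of ? /Og].
- by apply: smooth_near_row_mx; exact: smooth_near_crd_comp.
Qed.

End Product.

(** * Tangent maps, and curves on manifolds *)

Section TangentMap.
Variable R : realType.

Lemma dif_row_mx m n p (f : 'rV[R]_m -> 'rV[R]_n) (g : 'rV[R]_m -> 'rV[R]_p)
  (D : set 'rV[R]_m) x v :
  open D -> D x -> Cinfty D f -> Cinfty D g ->
  dif (fun y => row_mx (f y) (g y)) x v = row_mx (dif f x v) (dif g x v).
Proof.
move=> oD Dx Cf Cg; have Cr := Cinfty_row_mx oD Cf Cg.
have dr := Cinfty_differentiable Cr Dx.
rewrite -[LHS]hsubmxK; congr row_mx.
  have := dif_comp v dr (differentiable_lsubmx (row_mx (f x) (g x))).
  rewrite dif_linear => <-; congr (dif _ x v).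
  by apply/funext => y; rewrite /= row_mxKl.
have := dif_comp v dr (differentiable_rsubmx (row_mx (f x) (g x))).
rewrite dif_linear => <-; congr (dif _ x v).
by apply/funext => y; rewrite /= row_mxKr.
Qed.

Lemma tmapE (X Y : manifold_data R) (f : X -> Y) x v :
  tmap f x v =
  dif (crd (chart_at (f x)) \o f \o prm (chart_at x)) (crd (chart_at x) x) v.
Proof. by rewrite dif_diff. Qed.

Lemma tmap_is_linear (X Y : manifold_data R) (f : X -> Y) x : linear (tmap f x).
Proof. by move=> a u v; rewrite !tmapE linearP. Qed.

HB.instance Definition _ (X Y : manifold_data R) (f : X -> Y) x :=
  GRing.isLinear.Build R 'rV[R]_(mdim X) 'rV[R]_(mdim Y) _ (tmap f x)
    (tmap_is_linear f x).

Section Calculus.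
Variables (X Y Z : manifold_data R).
Hypotheses (aX : is_atlas X) (aY : is_atlas Y) (aZ : is_atlas Z).

Lemma smooth_near_differentiable (f : X -> Y) x i j :
  smooth_near f x -> dom i x -> dom j (f x) ->
  differentiable (crd j \o f \o prm i) (crd i x).
Proof.
move=> sf dx dfx; have [U [_ _ _ CU] Ux] := smooth_near_in aX sf dx dfx.
exact: Cinfty_differentiable CU Ux.
Qed.

Lemma tmap_ext (f g : X -> Y) x v O : mopen O -> O x ->
  (forall y, O y -> f y = g y) -> smooth_near f x -> tmap f x v = tmap g x v.
Proof.
move=> oO Ox fg sf; have dx := atlas_dom aX x.
have [V [oV Vx Vdom VO]] := mopen_chartP aX oO Ox dx.
rewrite !tmapE -(fg x Ox); apply: (dif_ext _ oV Vx) => [y Vy|].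
  by rewrite /= (fg _ (VO _ Vy)).
by apply: smooth_near_differentiable => //; exact: atlas_dom.
Qed.

(** The chart [chart_at (f x)] is both the target chart for [f] and the source chart for [g], so the
    two differentials compose with no transition function in between. *)
Lemma tmap_comp (f : X -> Y) (g : Y -> Z) x v :
  smooth_near f x -> smooth_near g (f x) ->
  tmap (g \o f) x v = tmap g (f x) (tmap f x v).
Proof.
move=> sf sg; have dx := atlas_dom aX x; have dfx := atlas_dom aY (f x).
have dgx := atlas_dom aZ (g (f x)).
have [U [oU Ui Uj CU] Ux] := smooth_near_in aX sf dx dfx.
have d1 := smooth_near_differentiable sf dx dfx.
have [V [_ _ _ CV] Vfx] := smooth_near_in aY sg dfx dgx.
rewrite !tmapE.
have E : (crd (chart_at (f x)) \o f \o prm (chart_at x)) (crd (chart_at x) x) =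
    crd (chart_at (f x)) (f x) by rewrite /= (atlas_crdK aX dx).
have d2 := Cinfty_differentiable CV Vfx.
rewrite -E in d2 *; rewrite -(dif_comp v d1 d2).
apply/esym/(dif_ext _ oU Ux) => [y Uy|].
  by rewrite /= (atlas_crdK aY) //; exact: Uj.
exact: differentiable_comp d1 d2.
Qed.

Lemma tmap_id x v : tmap (@id X) x v = v.
Proof.
rewrite tmapE -[RHS](dif_id (crd (chart_at x) x)).
have dx := atlas_dom aX x.
apply/esym/(dif_ext _ (open_crd_dom aX (chart_at x))).
- by exists x.
- by move=> _ [y dy <-] /=; rewrite (atlas_crdK aX dy).
- exact: (Cinfty_differentiable (D := setT) (@Cinfty_id _ _ _) Logic.I).
Qed.

End Calculus.

Section Pairs.
Variables (X Y Z : manifold_data R).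
Hypotheses (aX : is_atlas X) (aY : is_atlas Y) (aZ : is_atlas Z).

Lemma tmap_pair (f : Z -> X) (g : Z -> Y) z v :
  smooth_near f z -> smooth_near g z ->
  tmap (fun y => (f y, g y) : prodm X Y) z v =
  row_mx (tmap f z v) (tmap g z v).
Proof.
move=> sf sg; have dz := atlas_dom aZ z.
have [U [oU _ _ CU] Uz] := smooth_near_in aZ sf dz (atlas_dom aX _).
have [V [oV _ _ CV] Vz] := smooth_near_in aZ sg dz (atlas_dom aY _).
rewrite !tmapE; apply: (@dif_row_mx _ _ _ _ _ (U `&` V)) => //.
- exact: openI.
- by apply: Cinfty_sub CU => y [].
- by apply: Cinfty_sub CV => y [].
Qed.

Lemma tmap_fst (p : prodm X Y) u : tmap (fst : prodm X Y -> X) p u = lsubmx u.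
Proof.
have dp := atlas_dom (prodm_atlas aX aY) p.
rewrite tmapE -(dif_linear lsubmx (crd (chart_at p) p)).
apply/esym/(dif_ext _ (open_crd_dom (prodm_atlas aX aY) (chart_at p))).
- by exists p.
- by move=> _ [q [dq _] <-] /=; rewrite !row_mxKl (atlas_crdK aX dq).
- exact: differentiable_lsubmx.
Qed.

Lemma tmap_snd (p : prodm X Y) u : tmap (snd : prodm X Y -> Y) p u = rsubmx u.
Proof.
have dp := atlas_dom (prodm_atlas aX aY) p.
rewrite tmapE -(dif_linear rsubmx (crd (chart_at p) p)).
apply/esym/(dif_ext _ (open_crd_dom (prodm_atlas aX aY) (chart_at p))).
- by exists p.
- by move=> _ [q [_ dq] <-] /=; rewrite !row_mxKr (atlas_crdK aY dq).
- exact: differentiable_rsubmx.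
Qed.

End Pairs.

(* The curve g, defined near 0, satisfies g(0) = x and g'(0) = v; it is only
   required to be differentiable at 0. *)
Definition curve_velocity (X : manifold_data R) (g : R -> X) (x : X)
  (v : 'rV[R]_(mdim X)) : Prop :=
  (\forall t \near (0 : R), dom (chart_at x) (g t)) /\
  has_velocity (crd (chart_at x) \o g) (crd (chart_at x) x) v.

Lemma curve_velocity_ext (X : manifold_data R) (g h : R -> X) x v :
  (\forall t \near (0 : R), g t = h t) ->
  curve_velocity g x v -> curve_velocity h x v.
Proof.
move=> gh [d H]; split; first by apply: filterS2 gh d => t <-.
by apply: has_velocity_ext H; apply: filterS gh => t /= ->.
Qed.

Section Curves.
Variables (X Y : manifold_data R).
Hypotheses (aX : is_atlas X) (aY : is_atlas Y).

Lemma has_velocity_near n (c : R -> 'rV[R]_n) a v (U : set 'rV[R]_n) :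
  has_velocity c a v -> open U -> U a -> \forall t \near (0 : R), U (c t).
Proof.
move=> Hc oU Ua; apply: (has_velocity_cvg Hc).
exact: open_nbhs_nbhs.
Qed.

Lemma curve_velocity_exists x v : exists g, curve_velocity (X := X) g x v.
Proof.
pose i := chart_at x; have dx := atlas_dom aX x.
have H := has_velocity_line (crd i x) v.
have nU : \forall t \near (0 : R), (crd i @` dom i) (crd i x + t *: v).
  by apply: has_velocity_near H _ _; [exact: open_crd_dom|exists x].
exists (fun t => prm i (crd i x + t *: v)); split.
  by apply: filterS nU => t [y dy <-]; rewrite (atlas_crdK aX dy).
apply: has_velocity_ext H.
by apply: filterS nU => t [y dy] /= <-; rewrite (atlas_crdK aX dy).
Qed.

Lemma curve_velocity_comp (f : X -> Y) g x v : smooth_near f x ->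
  curve_velocity g x v -> curve_velocity (f \o g) (f x) (tmap f x v).
Proof.
move=> sf [d H]; have dx := atlas_dom aX x; have dfx := atlas_dom aY (f x).
have [U [oU Ui Uj CU] Ux] := smooth_near_in aX sf dx dfx.
have nU := has_velocity_near H oU Ux.
split.
  by apply: filterS2 nU d => t /Uj /=; rewrite /= => + dt; rewrite (atlas_crdK aX dt).
have := has_velocity_comp oU CU Ux H.
rewrite tmapE /= (atlas_crdK aX dx).
by apply: has_velocity_ext; apply: filterS d => t dt /=; rewrite (atlas_crdK aX dt).
Qed.

Lemma curve_velocity_lift (f : X -> Y) c x v : smooth_near f x ->
  (forall w, exists u, tmap f x u = w) ->
  curve_velocity c (f x) (tmap f x v) ->
  exists2 g, curve_velocity g x v & \forall t \near (0 : R), f (g t) = c t.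
Proof.
move=> sf surj [d H]; have dx := atlas_dom aX x; have dfx := atlas_dom aY (f x).
have [U [oU Ui Uj CU] Ux] := smooth_near_in aX sf dx dfx.
have surj' w : exists u, dif (crd (chart_at (f x)) \o f \o prm (chart_at x)) (crd (chart_at x) x) u = w.
  by have [u <-] := surj w; exists u; rewrite tmapE.
have H' : has_velocity (crd (chart_at (f x)) \o c)
    ((crd (chart_at (f x)) \o f \o prm (chart_at x)) (crd (chart_at x) x))
    (dif (crd (chart_at (f x)) \o f \o prm (chart_at x)) (crd (chart_at x) x) v).
  by rewrite -tmapE /= (atlas_crdK aX dx).
have [g Hg Eg] := has_velocity_lift oU CU Ux surj' H'.
have nU := has_velocity_near Hg oU Ux.
(* [prm] is meaningful only on the image of the chart, and [f (g t) = c t] follows from equal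
   coordinates only inside the chart of [f x]. *)
have nU' : \forall t \near (0 : R), exists y, [/\ dom (chart_at x) y,
    g t = crd (chart_at x) y & dom (chart_at (f x)) (f y)].
  apply: filterS nU => t Ut; have [y dy E] := Ui _ Ut.
  by exists y; split=> //; have := Uj _ Ut; rewrite -E (atlas_crdK aX dy).
exists (prm (chart_at x) \o g); first split.
- by apply: filterS nU' => t [y [dy E _]] /=; rewrite E (atlas_crdK aX dy).
- apply: has_velocity_ext Hg.
  by apply: filterS nU' => t [y [dy E _]] /=; rewrite E (atlas_crdK aX dy).
- apply: filterS3 nU' Eg d => t [y [dy E dfy]] /=.
  rewrite E (atlas_crdK aX dy) => E2 dc.
  exact: (crd_inj aY dfy dc E2).
Qed.

Lemma curve_velocity_unique g x v w :
  curve_velocity (X := X) g x v -> curve_velocity g x w -> v = w.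
Proof. by move=> [_ H1] [_ H2]; exact: has_velocity_unique H1 H2. Qed.

Lemma curve_velocity_pair g h x y v w :
  curve_velocity (X := X) g x v -> curve_velocity (X := Y) h y w ->
  curve_velocity (X := prodm X Y) (fun t => (g t, h t)) (x, y) (row_mx v w).
Proof.
move=> [d H] [d' H']; split.
  by apply: filterS2 d d' => t dt dt'; split.
exact: has_velocity_row_mx H H'.
Qed.

End Curves.

End TangentMap.

(** * Vector bundles *)

Section Topology.
Variables (R : realType) (X Y : manifold_data R).
Hypotheses (aX : is_atlas X) (aY : is_atlas Y).

Lemma mopen_preimage (f : X -> Y) W :
  (forall x, smooth_near f x) -> mopen W -> mopen (f @^-1` W).
Proof.
move=> sf oW; apply: mopen_loc => // x Wx.
have [V [oV Vx VW]] := smooth_near_preimage aX aY (sf x) oW Wx.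
by exists V.
Qed.

Lemma rV_separate n (p q : 'rV[R]_n) : p <> q ->
  exists A B : set 'rV[R]_n, [/\ open A, open B, A p, B q & A `&` B = set0].
Proof.
move=> /eqP pq; have H : hausdorff_space 'rV[R]_n by exact: norm_hausdorff.
rewrite open_hausdorff in H; have [[A B] /= [Ap Bq] [oA oB /eqP AB]] := H p q pq.
by exists A, B; split=> //; [exact: set_mem Ap|exact: set_mem Bq].
Qed.

Lemma rV_rat_ball n (p : 'rV[R]_n) (e : R) : 0 < e ->
  exists (q : 'rV[rat]_n) (m : nat), ball (map_mx ratr q : 'rV[R]_n) m.+1%:R^-1 p /\
    ball (map_mx ratr q : 'rV[R]_n) m.+1%:R^-1 `<=` ball p e.
Proof.
move=> e0; have e2 : 0 < e / 2 by rewrite divr_gt0.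
have [m Hm] : exists m : nat, m.+1%:R^-1 < e / 2.
  by have [m _ Hm] := near_infty_natSinv_lt (PosNum e2); exists m; exact: (Hm m (leqnn m)).
have m0 : 0 < m.+1%:R^-1 / 2 :> R by rewrite divr_gt0 // invr_gt0.
have Hq (j : 'I_n) : exists q : rat, `|ratr q - p 0 j| <= m.+1%:R^-1 / 2.
  have /rat_in_itvoo[q] : p 0 j < p 0 j + m.+1%:R^-1 / 2 by rewrite ltrDl.
  rewrite in_itv /= => /andP[q1 q2]; exists q.
  by rewrite ger0_norm ?subr_ge0 ?ltW // ltrBlDl.
have [q Hq'] := choice Hq.
have pq : `|map_mx ratr (\row_j q j) - p| < m.+1%:R^-1.
  apply: (@le_lt_trans _ _ (m.+1%:R^-1 / 2)).
    apply: rV_norm_le => [|j]; first exact: ltW.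
    by rewrite !mxE; exact: Hq'.
  by rewrite ltr_pdivrMr // ltr_pMr ?invr_gt0 // ltr1n.
exists (\row_j q j), m; rewrite -ball_normE; split=> // z /= Hz.
rewrite -(subrK (map_mx ratr (\row_j q j)) p) -addrA (splitr e).
apply: le_lt_trans (ler_normD _ _) _; rewrite distrC ltrD //.
  exact: lt_trans Hm.
exact: lt_trans Hm.
Qed.

(** The base consists of preimages of balls with rational centre and radius 1/(m+1) in the listed
    charts. The value [None] pads the list at indices that name no chart. *)
Lemma msecond_countable_of_charts (c : nat -> option (chart X)) :
  (forall x, exists k i, c k = Some i /\ dom i x) ->
  exists B : nat -> set X, (forall k, mopen (B k)) /\
    forall (W : set X) (x : X), mopen W -> W x -> exists2 k, B k x & B k `<=` W.
Proof.
move=> Hc.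
pose Q i (q : 'rV[rat]_(mdim X)) (m : nat) :=
  [set x : X | dom i x /\ ball (map_mx ratr q : 'rV[R]_(mdim X)) m.+1%:R^-1 (crd i x)].
pose B k : set X := if @unpickle (nat * 'rV[rat]_(mdim X) * nat)%type k is Some (l, q, m)
  then if c l is Some i then Q i q m else set0 else set0.
have o0 : mopen (set0 : set X) by apply: mopen_loc => // x [].
exists B; split=> [k|W x oW Wx].
  rewrite /B; case: unpickle => // -[[l q] m]; case: (c l) => // i.
  by apply: mopen_chart => //; exact: ball_open.
have [l [i [ci dx]]] := Hc x.
have : nbhs (crd i x) (crd i @` (W `&` dom i)).
  by apply: open_nbhs_nbhs; split; [exact: oW|exists x].
move=> /nbhs_ballP[e /= e0 He].
have [q [m [qp qe]]] := rV_rat_ball (crd i x) e0.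
exists (pickle (l, q, m)); rewrite /B pickleK ci //.
by move=> y [dy /qe/He]; move=> /(crd_image aX _ dy).
Qed.

End Topology.

(* [is_vbundle] with the conditions on the total space replaced by conditions on
   the domains of the trivialisations and on the transition functions. *)
Record is_locally_trivial (R : realType) (X : manifold_data R)
  (E : vbundle_data X) : Prop := IsLocallyTrivial {
  lt_tdom_open : forall a : triv E, mopen (tdom a);
  lt_triv_at : forall x : X, tdom (triv_at E x) x;
  lt_linear : forall (a : triv E) (x : X), tdom a x ->
    linear (@tcrd _ _ E a x);
  lt_tcrdK : forall (a : triv E) (x : X), tdom a x ->
    cancel (@tcrd _ _ E a x) (tprm a x);
  lt_tprmK : forall (a : triv E) (x : X), tdom a x ->
    cancel (tprm a x) (@tcrd _ _ E a x);
  lt_smooth : forall (i : chart X) (a b : triv E),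
    Cinfty [set y | (crd i @` ((tdom a `&` tdom b) `&` dom i)) (lsubmx y)]
      (fun y : 'rV[R]_(mdim X + rank E) =>
        tcrd b (tprm a (prm i (lsubmx y)) (rsubmx y)))
}.
Arguments lt_tdom_open {R X E} _ a.
Arguments lt_triv_at {R X E} _ x.
Arguments lt_smooth {R X E} _ i a b.

(** * Total spaces of vector bundles *)

Section TotalSpace.
Variables (R : realType) (X : manifold_data R) (E : vbundle_data X).

Section Atlas.
Hypotheses (aX : is_atlas X) (tE : is_locally_trivial E).

Lemma open_lsubmx m n (A : set 'rV[R]_m) : open A ->
  open [set y : 'rV[R]_(m + n) | A (lsubmx y)].
Proof.
move=> oA; rewrite -[X in open X]setTI.
exact: (open_Cinfty_preimage openT (@Cinfty_lsubmx _ _ _ _) oA).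
Qed.

Lemma total_space_overlap (i j : chart X) (a b : triv E) :
  crd ((i, a) : chart (total_space E)) @`
    (dom ((i, a) : chart (total_space E)) `&` dom ((j, b) : chart (total_space E)))
  = [set y | (crd i @` (((tdom a `&` tdom b) `&` dom j) `&` dom i)) (lsubmx y)].
Proof.
apply/seteqP; split=> y.
  move=> [[x v] [[/= di ta] [dj tb]] <-] /=; rewrite row_mxKl.
  by exists x.
move=> [x [[[ta tb] dj] di] Ey].
exists (vec (tprm a x (rsubmx y))) => //=.
by rewrite (lt_tprmK tE ta) Ey hsubmxK.
Qed.

Lemma total_space_atlas : is_atlas (total_space E).
Proof.
have oW (a b : triv E) (i j : chart X) :
    open (crd i @` (((tdom a `&` tdom b) `&` dom j) `&` dom i)).
  have oab := mopenI aX (lt_tdom_open tE a) (lt_tdom_open tE b).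
  exact: (mopenI aX oab (mopen_dom aX j)).
split.
- by move=> [x v]; split; [exact: atlas_dom|exact: lt_triv_at].
- move=> [i a] [x v] [/= di ta].
  by rewrite row_mxKl row_mxKr (atlas_crdK aX di) (lt_tcrdK tE ta).
- move=> [i a] [j b]; rewrite total_space_overlap.
  exact: open_lsubmx.
- move=> [i a] [j b]; rewrite total_space_overlap.
  have oO := open_lsubmx (n := rank E) (oW a b i j).
  apply: Cinfty_row_mx => //.
    apply: (Cinfty_comp (f := lsubmx) (E := crd i @` (dom i `&` dom j)) (g := crd j \o prm i)) => //.
    - by move=> y [x [[_ dj] di] <-]; exists x.
    - exact: Cinfty_lsubmx.
    - exact: atlas_smooth.
  apply: Cinfty_sub (lt_smooth tE i a b) => y [x [[[ta tb] dj] di] Ey].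
  by exists x.
Qed.

Lemma smooth_near_tag (e : total_space E) : smooth_near (tag : total_space E -> X) e.
Proof.
have de := atlas_dom total_space_atlas e.
apply: (@smooth_in_near _ _ _ total_space_atlas aX (chart_at e) (chart_at (tag e)) _
  (crd (chart_at e) @` dom (chart_at e)) _ _ de) => //.
have oD := open_crd_dom total_space_atlas (chart_at e).
split=> //.
  by move=> _ [q [dq _] <-] /=; rewrite row_mxKl (atlas_crdK aX dq).
refine (Cinfty_ext oD _ (@Cinfty_lsubmx _ _ _ _)) => _ [q [dq _] <-] /=.
by rewrite row_mxKl (atlas_crdK aX dq).
Qed.

Lemma smooth_near_tcrd (a : triv E) (e : total_space E) : tdom a (tag e) ->
  smooth_near (fun e : total_space E => tcrd a (tagged e) : model_space R (rank E)) e.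
Proof.
move=> ta; have dx := atlas_dom aX (tag e).
have de : dom ((chart_at (tag e), a) : chart (total_space E)) e by [].
have sc := smooth_near_crd total_space_atlas de.
have := @smooth_near_op1 _ _ total_space_atlas _ _
  (rsubmx : 'rV[R]_(mdim X + rank E) -> 'rV[R]_(rank E)) setT _ e openT Logic.I
  (@Cinfty_rsubmx _ _ _ _) sc.
by congr smooth_near; apply/funext => f; rewrite /= row_mxKr.
Qed.

Lemma smooth_near_total (Z : manifold_data R) (aZ : is_atlas Z)
  (F : Z -> total_space E) z a :
  tdom a (tag (F z)) -> smooth_near (fun z => tag (F z)) z ->
  smooth_near (fun z => tcrd a (tagged (F z)) : model_space R (rank E)) z ->
  smooth_near F z.
Proof.
move=> ta st sc.
have oW : mopen (tdom a `&` dom (chart_at (tag (F z)))).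
  by apply: mopenI => //; [exact: lt_tdom_open|exact: mopen_dom].
have Wz : (tdom a `&` dom (chart_at (tag (F z)))) (tag (F z)).
  by split=> //; exact: atlas_dom.
have [ O [oO Oz HO]] := smooth_near_preimage aZ aX st oW Wz.
apply: (@smooth_near_of_crd _ _ _ aZ total_space_atlas F z (chart_at (tag (F z)), a) O) => //.
  by move=> y /HO[].
apply: smooth_near_row_mx => //.
by apply: (smooth_near_crd_comp aZ aX (j := chart_at (tag (F z)))) => //; exact: atlas_dom.
Qed.

Lemma smooth_near_tprm (Z : manifold_data R) (aZ : is_atlas Z) (f : Z -> X)
  (c : Z -> model_space R (rank E)) z a :
  tdom a (f z) -> smooth_near f z -> smooth_near c z ->
  smooth_near (fun z => vec (tprm a (f z) (c z))) z.
Proof.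
move=> ta sf sc; apply: (@smooth_near_total _ aZ _ z a) => //=.
have [ O [oO Oz HO]] := smooth_near_preimage aZ aX sf (lt_tdom_open tE a) ta.
apply: (smooth_near_ext aZ (model_atlas R _) oO Oz) sc => y Oy.
by rewrite (lt_tprmK tE) //; exact: HO.
Qed.

End Atlas.

Lemma vbundle_locally_trivial : is_vbundle E -> is_locally_trivial E.
Proof.
move=> [mX mE ta tl tK tK']; have aX := manifold_atlas mX; have aE := manifold_atlas mE.
split=> //.
- move=> a i.
  have := atlas_open aE (i, a) (i, a); rewrite setIid => oD.
  (* This is the zero section in coordinates: pulling the open chart image of the total space back
     along it gives openness of [tdom a] in the base chart. *)
  have C : Cinfty [set: 'rV[R]_(mdim X)] (fun y => row_mx y (0 : 'rV[R]_(rank E))).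
    apply: Cinfty_row_mx => //; first exact: openT.
      exact: Cinfty_id.
    exact: Cinfty_cst.
  have := open_Cinfty_preimage openT C oD.
  rewrite setTI => oD'.
  suff -> : crd i @` (tdom a `&` dom i) =
      (fun y => row_mx y (0 : 'rV[R]_(rank E))) @^-1`
        (crd ((i, a) : chart (total_space E)) @` dom ((i, a) : chart (total_space E))).
    exact: oD'.
  apply/seteqP; split=> y.
    move=> [x [tx dx] <-]; exists (vec (tprm a x 0)) => //=.
    by rewrite tK'.
  move=> [[x v] [/= dx tx]] /eq_row_mx [<- _].
  by exists x.
- move=> i a b.
  have := atlas_smooth aE (i, a) (i, b) => CD.
  have oD := atlas_open aE (i, a) (i, b).
  have sub : [set y : 'rV[R]_(mdim X + rank E) |
      (crd i @` ((tdom a `&` tdom b) `&` dom i)) (lsubmx y)] `<=`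
      crd ((i, a) : chart (total_space E)) @`
      (dom ((i, a) : chart (total_space E)) `&` dom ((i, b) : chart (total_space E))).
    move=> y [x [[tx tx'] dx] Ey]; exists (vec (tprm a x (rsubmx y))) => //=.
    by rewrite tK' // Ey hsubmxK.
  apply: (Cinfty_sub sub).
  refine (Cinfty_ext oD _ (Cinfty_comp (E := setT) oD (fun _ _ => Logic.I) CD (@Cinfty_rsubmx _ _ _ _))).
  by move=> y _ /=; rewrite row_mxKr.
Qed.

Lemma locally_trivial_vbundle :
  is_manifold X -> is_locally_trivial E -> is_vbundle E.
Proof.
move=> mX tE; have aX := manifold_atlas mX; have aE := total_space_atlas aX tE.
split=> //; try by case: tE.
have [aE1 aE2 aE3 aE4] := aE.
split=> //.
- move=> e f ef.
  (* Distinct base points are separated in the base; two vectors of one fibre lie in a common chart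
     and are separated there. *)
  have [te|te] := pselect (tag e = tag f); last first.
    have [U [V [oU oV Ue Vf UV]]] := mhausdorff mX te.
    exists (tag @^-1` U), (tag @^-1` V); split=> //.
    + by apply: mopen_preimage => //; exact: smooth_near_tag.
    + by apply: mopen_preimage => //; exact: smooth_near_tag.
    + by rewrite -preimage_setI UV preimage_set0.
  have de := aE1 e; have df : dom (chart_at e) f by move: (aE1 f); rewrite /= te.
  have [|A [B [oA oB Ae Bf AB]]] := @rV_separate _ _ (crd (chart_at e) e) (crd (chart_at e) f).
    by move=> /(crd_inj aE de df).
  exists [set z | dom (chart_at e) z /\ A (crd (chart_at e) z)],
    [set z | dom (chart_at e) z /\ B (crd (chart_at e) z)]; split=> //.
  + exact: mopen_chart.
  + exact: mopen_chart.
  + apply/seteqP; split=> // z [[_ Az] [_ Bz]].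
    have : (A `&` B) (crd (chart_at e) z) by [].
    by rewrite AB.
- have [B [oB HB]] := msecond_countable mX.
  (* Each basic open set of the base that fits into the domains of some chart and trivialisation is
     assigned one such pair. These countably many pairs cover the total space because every
     neighbourhood contains a basic open set around its point. *)
  pose P k (ia : chart X * triv E) := B k `<=` dom ia.1 `&` tdom ia.2.
  pose c k : option (chart (total_space E)) :=
    match pselect (exists ia, P k ia) with
    | left h => Some (sval (cid h)) | right _ => None end.
  apply: (msecond_countable_of_charts aE (c := c)) => e.
  have oW := mopenI aX (mopen_dom aX (chart_at (tag e))) (lt_tdom_open tE (triv_at E (tag e))).
  have [k Bk BW] := HB _ (tag e) oW (conj (atlas_dom aX _) (lt_triv_at tE _)).
  exists k; rewrite /c; case: pselect => [h|[]]; last by exists (chart_at (tag e), triv_at E (tag e)).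
  by exists (sval (cid h)); split=> //; exact: (svalP (cid h)) _ Bk.
Qed.

End TotalSpace.

(** * Local triviality of the tangent bundle *)

Section TangentBundle.
Variables (R : realType) (X : manifold_data R).

(** A trivialisation of the tangent bundle is by definition the tangent map of a chart into the
    model space. Cancellation laws and transition functions then follow from the chain rule. *)
Lemma tangent_tcrdE (i : chart X) (x : X) (v : 'rV[R]_(mdim X)) :
  @tcrd _ _ (tangent X) i x v =
  tmap (crd i : X -> model_space R (mdim X)) x v.
Proof. by []. Qed.

Hypothesis aX : is_atlas X.

Lemma tangent_tprmE (i : chart X) (x : X) (v : 'rV[R]_(mdim X)) : dom i x ->
  @tprm _ _ (tangent X) i x v =
  tmap (prm i : model_space R (mdim X) -> X) (crd i x) v.
Proof. by move=> dx; rewrite /tmap /= (atlas_crdK aX dx). Qed.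

Lemma tmap_crdK (i : chart X) (x : X) v : dom i x ->
  tmap (prm i : model_space R (mdim X) -> X) (crd i x)
    (tmap (crd i : X -> model_space R (mdim X)) x v) = v.
Proof.
move=> dx; have aM := model_atlas R (mdim X).
rewrite -(tmap_comp aX aM aX); last 2 first.
- exact: smooth_near_crd.
- exact: smooth_near_prm.
rewrite -[RHS](tmap_id aX x).
apply/esym/(tmap_ext aX aX _ (mopen_dom aX i) dx) => [y dy|].
  by rewrite /= (atlas_crdK aX dy).
exact: smooth_near_id.
Qed.

Lemma tmap_prmK (i : chart X) (x : X) v : dom i x ->
  tmap (crd i : X -> model_space R (mdim X)) x
    (tmap (prm i : model_space R (mdim X) -> X) (crd i x) v) = v.
Proof.
move=> dx; have aM := model_atlas R (mdim X).
have Ex := atlas_crdK aX dx.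
have sc : smooth_near (crd i : X -> model_space R (mdim X)) (prm i (crd i x)).
  by rewrite Ex; exact: smooth_near_crd.
have := tmap_comp aM aX aM v (smooth_near_prm aX dx) sc.
rewrite /= Ex => <-.
rewrite -[RHS](tmap_id aM (crd i x)).
have oD : mopen (crd i @` dom i : set (model_space R (mdim X))).
  by move=> [] /=; rewrite setIT image_id; exact: open_crd_dom.
have Dx : (crd i @` dom i) (crd i x) by exists x.
apply/esym/(tmap_ext aM aM _ oD Dx) => [_ [y dy <-]|].
  by rewrite /= (atlas_crdK aX dy).
exact: smooth_near_id.
Qed.

(** The transition function from [a] to [b] is the differential of [crd b \o prm a], jointly smooth
    by [Cinfty_dif]. The base chart [i] is independent of [a], so the base coordinate is first moved
    from [i] to [a]. *)
Lemma tangent_locally_trivial : is_locally_trivial (tangent X).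
Proof.
have aM := model_atlas R (mdim X).
split.
- exact: mopen_dom.
- exact: atlas_dom.
- move=> i x _; exact: (tmap_is_linear (crd i : X -> model_space R (mdim X)) x).
- by move=> i x dx v; rewrite tangent_tcrdE tangent_tprmE // tmap_crdK.
- by move=> i x dx v; rewrite tangent_tcrdE tangent_tprmE // tmap_prmK.
- move=> i a b.
  have oA : open (crd i @` ((dom a `&` dom b) `&` dom i)).
    exact: (mopenI aX (mopen_dom aX a) (mopen_dom aX b)).
  have oO := open_lsubmx (n := mdim X) oA.
  pose T := crd a \o prm i \o (lsubmx : 'rV[R]_(mdim X + mdim X) -> _).
  have CT : Cinfty [set y | (crd i @` ((dom a `&` dom b) `&` dom i)) (lsubmx y)] T.
    apply: (Cinfty_comp (f := lsubmx) (E := crd i @` (dom i `&` dom a)) (g := crd a \o prm i)) => //.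
    - by move=> y [x [[da _] di] <-]; exists x.
    - exact: Cinfty_lsubmx.
    - exact: atlas_smooth.
  have oab := atlas_open aX a b.
  have Cd := Cinfty_dif oab (atlas_smooth aX a b).
  have Cr := Cinfty_row_mx oO CT (@Cinfty_rsubmx _ _ _ _).
  have C := Cinfty_comp oO _ Cr Cd.
  refine (Cinfty_ext oO _ (C _)).
    move=> y [x [[da db] di] Ey].
    rewrite /= row_mxKl row_mxKr /T /= -Ey (atlas_crdK aX di).
    rewrite -[RHS]/(@tcrd _ _ (tangent X) b x (@tprm _ _ (tangent X) a x (rsubmx y))).
    rewrite tangent_tcrdE tangent_tprmE //.
    have sp := smooth_near_prm aX da.
    have sc : smooth_near (crd b : X -> model_space R (mdim X)) (prm a (crd a x)).
      by rewrite (atlas_crdK aX da); exact: smooth_near_crd.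
    have := tmap_comp aM aX aM (rsubmx y) sp sc.
    by rewrite /= (atlas_crdK aX da) => <-; rewrite tmapE.
  move=> y [x [[da db] di] Ey].
  by rewrite /= row_mxKl /T /= -Ey (atlas_crdK aX di); exists x.
Qed.

End TangentBundle.

Lemma tangent_vbundle (R : realType) (X : manifold_data R) :
  is_manifold X -> is_vbundle (tangent X).
Proof.
move=> mX; apply: locally_trivial_vbundle => //.
exact/tangent_locally_trivial/manifold_atlas.
Qed.

Section WhitneySum.
Variables (R : realType) (X : manifold_data R) (E F : vbundle_data X).

Lemma whitney_locally_trivial : is_atlas X -> is_locally_trivial E ->
  is_locally_trivial F -> is_locally_trivial (whitney_sum E F).
Proof.
move=> aX tE tF; split.
- by move=> [a b]; apply: mopenI => //; exact: lt_tdom_open.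
- by move=> x; split; exact: lt_triv_at.
- move=> [a b] x [/= ta tb] c u v /=.
  by rewrite (lt_linear tE ta) (lt_linear tF tb) scale_row_mx add_row_mx.
- move=> [a b] x [/= ta tb] [u v] /=.
  by rewrite row_mxKl row_mxKr (lt_tcrdK tE ta) (lt_tcrdK tF tb).
- move=> [a b] x [/= ta tb] u /=.
  by rewrite (lt_tprmK tE ta) (lt_tprmK tF tb) hsubmxK.
- move=> i [a b] [a' b'].
  pose S := ((tdom ((a, b) : triv (whitney_sum E F)) `&`
    tdom ((a', b') : triv (whitney_sum E F)))).
  have oW : mopen S.
    by apply: mopenI => //; apply: mopenI => //; exact: lt_tdom_open.
  have oO := open_lsubmx (n := rank E + rank F) (oW i).
  have H (G : vbundle_data X) (c c' : triv G)
      (p : {linear 'rV[R]_(rank E + rank F) -> 'rV[R]_(rank G)}) :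
      is_locally_trivial G -> S `<=` tdom c `&` tdom c' ->
      Cinfty [set y : 'rV[R]_(mdim X + (rank E + rank F)) |
          (crd i @` (S `&` dom i)) (lsubmx y)]
        (fun y => tcrd c' (tprm c (prm i (lsubmx y)) (p (rsubmx y)))).
    move=> tG SG.
    have Cp := Cinfty_comp (E := setT) oO (fun _ _ => Logic.I)
      (@Cinfty_rsubmx _ _ _ _) (@Cinfty_linear _ _ _ setT p).
    have Cr := Cinfty_row_mx oO (@Cinfty_lsubmx _ _ _ _) Cp.
    have C := Cinfty_comp oO _ Cr (lt_smooth tG i c c').
    refine (Cinfty_ext oO _ (C _)) => [y _|y [x [Sx dx] Ey]] /=.
      by rewrite row_mxKl row_mxKr.
    by rewrite row_mxKl; exists x => //; split=> //; exact: SG.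
  apply: Cinfty_row_mx => //.
    apply: (H E a a' lsubmx tE).
    by move=> x [[? _] [? _]].
  apply: (H F b b' rsubmx tF).
  by move=> x [[_ ?] [_ ?]].
Qed.

Lemma whitney_vbundle : is_vbundle E -> is_vbundle F ->
  is_vbundle (whitney_sum E F).
Proof.
move=> vE vF; have mX := base_manifold vE.
apply: locally_trivial_vbundle => //.
by apply: whitney_locally_trivial; [exact: manifold_atlas| |]; exact: vbundle_locally_trivial.
Qed.

End WhitneySum.

Section TangentFunctor.
Variables (R : realType) (X Y : manifold_data R).
Hypotheses (aX : is_atlas X) (aY : is_atlas Y).

(** [tmap] is read in the charts [chart_at], whose choice need not vary continuously with the point.
    Fixed charts [i] and [j] give an expression that can be shown to be smooth in the point. *)
Lemma tcrd_tmap (f : X -> Y) i j x v :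
  smooth_near f x -> dom i x -> dom j (f x) ->
  @tcrd _ _ (tangent Y) j (f x) (tmap f x v) =
  dif (crd j \o f \o prm i) (crd i x) (@tcrd _ _ (tangent X) i x v).
Proof.
move=> sf dx dfx; have aM := model_atlas R (mdim X); have aN := model_atlas R (mdim Y).
rewrite !tangent_tcrdE -(tmap_comp aX aY aN) //; last exact: smooth_near_crd.
have sc := smooth_near_crd_comp aX aY dfx sf.
have sp := smooth_near_prm aX dx.
pose h : model_space R (mdim X) -> model_space R (mdim Y) := crd j \o f \o prm i.
have sh : smooth_near h (crd i x).
  apply: (smooth_near_comp aM aX aN sp).
  by rewrite (atlas_crdK aX dx).
transitivity (tmap (h \o (crd i : X -> model_space R (mdim X))) x v).
  apply: (tmap_ext aX aN _ (mopen_dom aX i) dx) => [y dy|//].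
  by rewrite /h /= (atlas_crdK aX dy).
rewrite (tmap_comp aX aM aN) //; last exact: smooth_near_crd.
by rewrite tmapE.
Qed.

Definition tangent_map (f : X -> Y) (e : total_space (tangent X)) :
  total_space (tangent Y) :=
  @vec _ _ (tangent Y) (f (tag e)) (tmap f (tag e) (tagged e)).

Lemma smooth_near_tangent_map (f : X -> Y) (e : total_space (tangent X)) :
  smooth_near f (tag e) -> smooth_near (tangent_map f) e.
Proof.
move=> sf; have tX := tangent_locally_trivial aX; have tY := tangent_locally_trivial aY.
have aTX := total_space_atlas aX tX.
pose i := chart_at (tag e); pose j := chart_at (f (tag e)).
have dx : dom i (tag e) := atlas_dom aX _.
have dfx : dom j (f (tag e)) := atlas_dom aY _.
have [U sU Ux] := smooth_near_in aX sf dx dfx.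
have [oU Ui Uj CU] := sU.
have stag := smooth_near_tag aX tX.
apply: (@smooth_near_total _ _ _ aY tY _ aTX _ e j) => //.
  exact: (smooth_near_comp aTX aX aY (stag e) sf).
have oO : mopen (tag @^-1` [set x | dom i x /\ U (crd i x)] : set (total_space (tangent X))).
  exact: (mopen_preimage aTX aX stag (mopen_chart aX oU)).
have de : dom ((i, i) : chart (total_space (tangent X))) e by [].
have sc := smooth_near_crd aTX de.
have oU' := open_lsubmx (n := mdim X) oU.
have Ue : U (lsubmx (crd ((i, i) : chart (total_space (tangent X))) e)).
  by rewrite row_mxKl.
have := @smooth_near_op1 _ _ aTX _ _ _ _ _ e oU' Ue (Cinfty_dif oU CU) sc.
have aN := model_atlas R (mdim Y).
apply: (smooth_near_ext aTX aN oO (conj dx Ux)) => -[x v] [/= dix Uxx].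
rewrite row_mxKl row_mxKr; apply/esym/tcrd_tmap => //.
  exact: (smooth_in_near aX aY sU).
by have := Uj _ Uxx; rewrite (atlas_crdK aX dix).
Qed.

End TangentFunctor.

(** * Smooth sections along maps, and bundle maps *)

Section Sections.
Variables (R : realType) (X Z : manifold_data R).
Hypotheses (aX : is_atlas X) (aZ : is_atlas Z).

Lemma smooth_near_total_tcrd (E : vbundle_data X) (tE : is_locally_trivial E)
  (F : Z -> total_space E) z (a : triv E) :
  tdom a (tag (F z)) -> smooth_near F z ->
  smooth_near (fun z => tcrd a (tagged (F z)) : model_space R (rank E)) z.
Proof.
move=> ta sF; have aE := total_space_atlas aX tE.
exact: (smooth_near_comp aZ aE (model_atlas R _) sF (smooth_near_tcrd aX tE ta)).
Qed.

Lemma smooth_near_total_tag (E : vbundle_data X) (tE : is_locally_trivial E)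
  (F : Z -> total_space E) z :
  smooth_near F z -> smooth_near (fun z => tag (F z)) z.
Proof.
move=> sF; have aE := total_space_atlas aX tE.
exact: (smooth_near_comp aZ aE aX sF (smooth_near_tag aX tE _)).
Qed.

Lemma smooth_near_vec_add (E : vbundle_data X) (tE : is_locally_trivial E)
  (f : Z -> X) (s t : forall z, E (f z)) z :
  smooth_near (fun z => vec (s z)) z -> smooth_near (fun z => vec (t z)) z ->
  smooth_near (fun z => vec (s z + t z)) z.
Proof.
move=> ss st; pose a := triv_at E (f z); have ta : tdom a (f z) := lt_triv_at tE _.
have sf := smooth_near_total_tag tE ss.
apply: (@smooth_near_total _ _ _ aX tE _ aZ _ z a) => //.
have cs := @smooth_near_total_tcrd _ tE (fun z => vec (s z)) z a ta ss.
have ct := @smooth_near_total_tcrd _ tE (fun z => vec (t z)) z a ta st.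
have := smooth_near_op2 (op := fun u v => u + v) aZ (fun D F G => @Cinfty_add _ _ _ D F G) cs ct.
have [ O [oO Oz HO]] := smooth_near_preimage aZ aX sf (lt_tdom_open tE a) ta.
apply: (smooth_near_ext aZ (model_atlas R _) oO Oz) => y Oy /=.
have := lt_linear tE (HO y Oy) 1 (s y) (t y).
by rewrite !scale1r => ->.
Qed.

Lemma smooth_near_vec_pair (E F : vbundle_data X) (tE : is_locally_trivial E)
  (tF : is_locally_trivial F) (f : Z -> X) (s : forall z, E (f z))
  (t : forall z, F (f z)) z :
  smooth_near (fun z => vec (s z)) z -> smooth_near (fun z => vec (t z)) z ->
  smooth_near (fun z => @vec _ _ (whitney_sum E F) (f z) (s z, t z)) z.
Proof.
move=> ss st; have tW := whitney_locally_trivial aX tE tF.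
have sf := smooth_near_total_tag tE ss.
have ta := lt_triv_at tE (f z); have tb := lt_triv_at tF (f z).
apply: (@smooth_near_total _ _ _ aX tW _ aZ _ z (triv_at E (f z), triv_at F (f z))) => //.
apply: smooth_near_row_mx => //.
  exact: (@smooth_near_total_tcrd _ tE (fun z => vec (s z)) z _ ta ss).
exact: (@smooth_near_total_tcrd _ tF (fun z => vec (t z)) z _ tb st).
Qed.

End Sections.

Section WhitneyProjections.
Variables (R : realType) (X : manifold_data R) (E F : vbundle_data X).
Hypotheses (aX : is_atlas X) (tE : is_locally_trivial E) (tF : is_locally_trivial F).
Let tW := whitney_locally_trivial aX tE tF.
Let aW := total_space_atlas aX tW.

Lemma smooth_near_whitney_fst (e : total_space (whitney_sum E F)) :
  smooth_near (fun e : total_space (whitney_sum E F) => vec (tagged e).1) e.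
Proof.
have ta := lt_triv_at tE (tag e); have tb := lt_triv_at tF (tag e).
have st := smooth_near_tag aX tW e.
apply: (@smooth_near_total _ _ _ aX tE _ aW _ e (triv_at E (tag e))) => //.
have tab : @tdom _ _ (whitney_sum E F) (triv_at E (tag e), triv_at F (tag e)) (tag e) by [].
have sc := smooth_near_tcrd aX tW tab.
have := @smooth_near_op1 _ _ aW _ _
  (lsubmx : 'rV[R]_(rank E + rank F) -> 'rV[R]_(rank E)) setT _ e openT Logic.I
  (@Cinfty_lsubmx _ _ _ _) sc.
by congr smooth_near; apply/funext => f; rewrite /= row_mxKl.
Qed.

Lemma smooth_near_whitney_snd (e : total_space (whitney_sum E F)) :
  smooth_near (fun e : total_space (whitney_sum E F) => vec (tagged e).2) e.
Proof.
have ta := lt_triv_at tE (tag e); have tb := lt_triv_at tF (tag e).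
have st := smooth_near_tag aX tW e.
apply: (@smooth_near_total _ _ _ aX tF _ aW _ e (triv_at F (tag e))) => //.
have tab : @tdom _ _ (whitney_sum E F) (triv_at E (tag e), triv_at F (tag e)) (tag e) by [].
have sc := smooth_near_tcrd aX tW tab.
have := @smooth_near_op1 _ _ aW _ _
  (rsubmx : 'rV[R]_(rank E + rank F) -> 'rV[R]_(rank F)) setT _ e openT Logic.I
  (@Cinfty_rsubmx _ _ _ _) sc.
by congr smooth_near; apply/funext => f; rewrite /= row_mxKr.
Qed.

End WhitneyProjections.

Lemma tmap_tag (R : realType) (X : manifold_data R) (E : vbundle_data X)
  (aX : is_atlas X) (tE : is_locally_trivial E) (e : total_space E) u :
  tmap (tag : total_space E -> X) e u = lsubmx u.
Proof.
have aE := total_space_atlas aX tE; have de := atlas_dom aE e.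
rewrite tmapE -(dif_linear lsubmx (crd (chart_at e) e)).
apply/esym/(dif_ext _ (open_crd_dom aE (chart_at e))).
- by exists e.
- by move=> _ [q [dq _] <-] /=; rewrite !row_mxKl (atlas_crdK aX dq).
- exact: differentiable_lsubmx.
Qed.

Section BundleMap.
Variables (R : realType) (X Y : manifold_data R).
Variables (E : vbundle_data X) (F : vbundle_data Y).
Hypotheses (aX : is_atlas X) (aY : is_atlas Y).
Hypotheses (tE : is_locally_trivial E) (tF : is_locally_trivial F).

Variables (f : X -> Y) (A : forall x, E x -> F (f x)).
Hypothesis lA : forall x, linear (@A x).

Definition bundle_map (e : total_space E) : total_space F := vec (A (tagged e)).

(* Tangent vectors along the fibre are velocities of straight lines, which a
   bundle map sends to straight lines; the other directions are those of f. *)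
Lemma bundle_map_submersion :
  (forall e, smooth_near bundle_map e) ->
  (forall x, smooth_near f x) ->
  (forall x w, exists v, tmap f x v = w) ->
  (forall x (w : F (f x)), exists v, A v = w) -> submersion bundle_map.
Proof.
move=> sP sf surjf surjA.
have aE := total_space_atlas aX tE; have aF := total_space_atlas aY tF.
split; first exact/smoothP.
move=> [x v] w; have [a Ha] := surjf x (lsubmx (w : 'rV[R]_(mdim Y + rank F))).
set e : total_space E := existT _ x v.
set z : 'rV[R]_(mdim Y + rank F) := tmap bundle_map e (row_mx a 0).
have Hz : lsubmx z = lsubmx (w : 'rV[R]_(mdim Y + rank F)).
  rewrite -(tmap_tag aY tF (bundle_map e)) -(tmap_comp aE aF aY _ (sP e) (smooth_near_tag aY tF _)).
  rewrite -[LHS]/(tmap (f \o (tag : total_space E -> X)) e (row_mx a 0)).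
  rewrite (tmap_comp aE aX aY _ (smooth_near_tag aX tE e) (sf (tag e))).
  by rewrite (tmap_tag aX tE) row_mxKl.
pose c := triv_at E x; pose c' := triv_at F (f x).
have tc : tdom c x := lt_triv_at tE x; have tc' : tdom c' (f x) := lt_triv_at tF (f x).
(* The vector [row_mx a 0] already has the right image in the base directions; what is left is a
   vertical error, which [l] corrects along the fibre. *)
have [l Hl] := surjA x (tprm c' (f x) (rsubmx (w : 'rV[R]_(mdim Y + rank F)) - rsubmx z)).
have line (Z : manifold_data R) (D : vbundle_data Z) (aZ : is_atlas Z)
    (tD : is_locally_trivial D) (y : Z) (p q : D y) :
    curve_velocity (X := total_space D) (fun t => vec (p + t *: q)) (vec p)
      (row_mx 0 (tcrd (triv_at D y) q)).
  have ty := lt_triv_at tD y; split.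
    by apply: (@filterE _ (nbhs (0 : R))) => t; split => //=; exact: atlas_dom.
  move=> eps eps0; apply: (@filterE _ (nbhs (0 : R))) => t.
  have Eq : tcrd (triv_at D y) (t *: q + p) = t *: tcrd (triv_at D y) q + tcrd (triv_at D y) p.
    exact: (lt_linear tD ty t q p).
  rewrite /= (addrC p) Eq scale_row_mx !opp_row_mx !add_row_mx.
  by rewrite scaler0 subr0 subrr addrK subrr row_mx0 normr0 mulr_ge0 // ltW.
have L1 := line _ _ aX tE x v l.
have L2 := line _ _ aY tF (f x) (A v) (A l).
have L3 := curve_velocity_comp aE aF (sP e) L1.
have L4 : curve_velocity (bundle_map \o (fun t => vec (v + t *: l))) (bundle_map e)
    (row_mx 0 (tcrd c' (A l)) : 'rV[R]_(mdim Y + rank F)).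
  apply: curve_velocity_ext L2; apply: (@filterE _ (nbhs (0 : R))) => t.
  by rewrite /bundle_map /=; congr vec; rewrite (addrC v) lA addrC.
have L5 := curve_velocity_unique L3 L4.
exists (row_mx a 0 + row_mx 0 (tcrd c l)).
rewrite linearD /= L5 -/z Hl (lt_tprmK tF tc').
rewrite -[LHS](hsubmxK (z + _)) -[RHS](hsubmxK (w : 'rV[R]_(mdim Y + rank F))).
by rewrite !linearD /= row_mxKl row_mxKr Hz addr0 addrC subrK.
Qed.

End BundleMap.

Section TangentOfProduct.
Variables (R : realType) (X Y Z : manifold_data R).
Hypotheses (aX : is_atlas X) (aY : is_atlas Y) (aZ : is_atlas Z).

Lemma tcrd_tangent_prodm (i : chart X) (j : chart Y) (p : prodm X Y)
  (v : 'rV[R]_(mdim X)) (w : 'rV[R]_(mdim Y)) : dom i p.1 -> dom j p.2 ->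
  @tcrd _ _ (tangent (prodm X Y)) (i, j) p (row_mx v w) =
  row_mx (@tcrd _ _ (tangent X) i p.1 v) (@tcrd _ _ (tangent Y) j p.2 w).
Proof.
move=> di dj; have aM := model_atlas R (mdim X); have aN := model_atlas R (mdim Y).
have aXY := prodm_atlas aX aY.
have sX := smooth_near_crd aX di; have sY := smooth_near_crd aY dj.
have s1 := smooth_near_fst aX aY p; have s2 := smooth_near_snd aX aY p.
have H := tmap_pair aM aN aXY (row_mx v w : 'rV[R]_(mdim (prodm X Y)))
  (smooth_near_comp aXY aX aM s1 sX) (smooth_near_comp aXY aY aN s2 sY).
rewrite (tmap_comp aXY aX aM _ s1 sX) (tmap_comp aXY aY aN _ s2 sY) in H.
rewrite (tmap_fst aX aY) (tmap_snd aX aY) row_mxKl row_mxKr in H.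
exact: H.
Qed.

(** Assembles two tangent vectors, smoothly, into one of the product manifold, where the tangent map
    of an extension of the multiplication can be applied. *)
Lemma smooth_near_tangent_row_mx (f : Z -> X) (h : Z -> Y)
  (s : Z -> 'rV[R]_(mdim X)) (t : Z -> 'rV[R]_(mdim Y)) z :
  smooth_near (fun z => @vec _ _ (tangent X) (f z) (s z)) z ->
  smooth_near (fun z => @vec _ _ (tangent Y) (h z) (t z)) z ->
  smooth_near (fun z => @vec _ _ (tangent (prodm X Y)) (f z, h z)
    (row_mx (s z) (t z))) z.
Proof.
move=> ss st; have tX := tangent_locally_trivial aX; have tY := tangent_locally_trivial aY.
have aXY := prodm_atlas aX aY; have tXY := tangent_locally_trivial aXY.
pose i := chart_at (f z); pose j := chart_at (h z).
have di : dom i (f z) := atlas_dom aX _; have dj : dom j (h z) := atlas_dom aY _.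
have sf := smooth_near_total_tag aX aZ tX ss.
have sh := smooth_near_total_tag aY aZ tY st.
apply: (@smooth_near_total _ _ _ aXY tXY _ aZ _ z (i, j)) => //.
  exact: smooth_near_pair.
have cs := smooth_near_total_tcrd aX aZ tX (F := fun z => @vec _ _ (tangent X) (f z) (s z)) (a := i) di ss.
have ct := smooth_near_total_tcrd aY aZ tY (F := fun z => @vec _ _ (tangent Y) (h z) (t z)) (a := j) dj st.
have [V1 [oV1 V1z HV1]] := smooth_near_preimage aZ aX sf (mopen_dom aX i) di.
have [V2 [oV2 V2z HV2]] := smooth_near_preimage aZ aY sh (mopen_dom aY j) dj.
have oV : mopen (V1 `&` V2) by exact: mopenI.
apply: (smooth_near_ext aZ (model_atlas R _) oV (conj V1z V2z) _ (smooth_near_row_mx aZ cs ct)).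
by move=> y [/HV1 d1 /HV2 d2]; rewrite (tcrd_tangent_prodm (p := (f y, h y))).
Qed.

End TangentOfProduct.

(** * Groupoids *)

Section TangentGroupoid.
Variables (R : realType) (G M : manifold_data R) (GG : groupoid_data G M).
Hypothesis hG : is_lie_groupoid GG.

Let aG : is_atlas G := manifold_atlas (arrows_manifold hG).
Let aM : is_atlas M := manifold_atlas (objects_manifold hG).
Let aGG : is_atlas (prodm G G) := prodm_atlas aG aG.

Lemma smooth_near_src g : smooth_near (src GG) g.
Proof. exact: ((smoothP aG _).1 (proj1 (src_submersion hG)) g). Qed.

Lemma smooth_near_tgt g : smooth_near (tgt GG) g.
Proof. exact: ((smoothP aG _).1 (proj1 (tgt_submersion hG)) g). Qed.

Lemma smooth_near_gone x : smooth_near (gone GG) x.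
Proof. exact: ((smoothP aM _).1 (gone_smooth hG) x). Qed.

Lemma smooth_near_ginv g : smooth_near (ginv GG) g.
Proof. exact: ((smoothP aG _).1 (ginv_smooth hG) g). Qed.

Lemma ginvK g : ginv GG (ginv GG g) = g.
Proof.
rewrite -(gmul1 hG (ginv GG (ginv GG g))) (src_ginv hG) (tgt_ginv hG).
rewrite -(gmulVg hG) (gmulA hG) ?(src_ginv hG) ?(tgt_ginv hG) //.
by rewrite (gmulVg hG) (src_ginv hG) (gmul1g hG).
Qed.

Lemma curve_velocity_near (X : manifold_data R) (aX : is_atlas X) (c : R -> X) x v W :
  curve_velocity c x v -> mopen W -> W x -> \forall t \near (0 : R), W (c t).
Proof.
move=> [d H] oW Wx; have dx := atlas_dom aX x.
have oD : open (crd (chart_at x) @` (W `&` dom (chart_at x))) by exact: oW.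
have Dx : (crd (chart_at x) @` (W `&` dom (chart_at x))) (crd (chart_at x) x) by exists x.
apply: filterS2 d (has_velocity_near H oD Dx) => t dt /=.
by move=> /(crd_image aX _ dt).
Qed.

Lemma local_extension_smooth g h O F :
  local_extension (composable GG) (gmul2 GG) (g, h) O F -> smooth_near F (g, h).
Proof. by move=> [oO Oa sF _]; exists O. Qed.

(** Along composable curves [F] coincides with the multiplication, so every extension computes a
    velocity of the same product curve. *)
Lemma curve_velocity_local_extension g h O F c d v w :
  local_extension (composable GG) (gmul2 GG) (g, h) O F -> src GG g = tgt GG h ->
  curve_velocity c g v -> curve_velocity d h w ->
  (\forall t \near (0 : R), src GG (c t) = tgt GG (d t)) ->
  curve_velocity (fun t => gmul GG (c t) (d t)) (gmul GG g h)
    (tmap F (g, h) (row_mx v w)).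
Proof.
move=> eF gh Hc Hd cd; have [oO Oa sF FE] := eF.
have Hcd := curve_velocity_pair Hc Hd.
have := curve_velocity_comp aGG aG (local_extension_smooth eF) Hcd.
rewrite (FE (g, h) gh Oa); apply: curve_velocity_ext.
apply: filterS2 (curve_velocity_near aGG Hcd oO Oa) cd => t Ot cdt.
by rewrite /= FE.
Qed.

Lemma curve_lift_src g h d v w : src GG g = tgt GG h ->
  tmap (src GG) g v = tmap (tgt GG) h w -> curve_velocity d h w ->
  exists2 c, curve_velocity c g v & \forall t \near (0 : R), src GG (c t) = tgt GG (d t).
Proof.
move=> gh vw Hd; have Ht := curve_velocity_comp aG aM (smooth_near_tgt h) Hd.
rewrite -gh -vw in Ht.
have [_ surj] := src_submersion hG.
exact: (curve_velocity_lift aG aM (smooth_near_src g) (surj g) Ht).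
Qed.

(** Velocities are unique, so the value selected by [tmap_on], coming from some extension, equals
    the value for [F]. *)
Lemma tmulE g h O F (v w : 'rV[R]_(mdim G)) :
  local_extension (composable GG) (gmul2 GG) (g, h) O F -> src GG g = tgt GG h ->
  tmap (src GG) g v = tmap (tgt GG) h w ->
  @vmul _ _ _ _ _ _ (tangent_groupoid GG) g h v w = tmap F (g, h) (row_mx v w).
Proof.
move=> eF gh vw.
have [d Hd] := curve_velocity_exists aG h w.
have [c Hc cd] := curve_lift_src gh vw Hd.
rewrite /= /tmap_on; set P := (X in xget 0 X).
(* [P] contains the value for [F], so [xget] does not fall back on its default 0. *)
have [V [F' [eF' ->]]] : P (xget 0 P).
  by apply: xgetPex; exists (tmap F (g, h) (row_mx v w)); exists O, F.
exact: (curve_velocity_unique (curve_velocity_local_extension eF' gh Hc Hd cd)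
  (curve_velocity_local_extension eF gh Hc Hd cd)).
Qed.

Lemma curve_velocity_gmul g h c d v w : src GG g = tgt GG h ->
  tmap (src GG) g v = tmap (tgt GG) h w ->
  curve_velocity c g v -> curve_velocity d h w ->
  (\forall t \near (0 : R), src GG (c t) = tgt GG (d t)) ->
  curve_velocity (fun t => gmul GG (c t) (d t)) (gmul GG g h)
    (@vmul _ _ _ _ _ _ (tangent_groupoid GG) g h v w).
Proof.
move=> gh vw Hc Hd cd.
have [V [F eF]] := gmul_smooth hG (a := (g, h)) gh.
by rewrite (tmulE eF gh vw); exact: curve_velocity_local_extension eF gh Hc Hd cd.
Qed.

Local Notation ds := (tmap (src GG)).
Local Notation dt := (tmap (tgt GG)).
Local Notation du := (tmap (gone GG)).
Local Notation di := (tmap (ginv GG)).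
Local Notation dm g h := (@vmul _ _ _ _ _ _ (tangent_groupoid GG) g h).

Lemma eq_tmap (X Y : manifold_data R) (f h : X -> Y) x v :
  f =1 h -> tmap f x v = tmap h x v.
Proof. by move=> /funext ->. Qed.

Lemma tmap_linearP (X Y : manifold_data R) (f : X -> Y) x (a : R) u v :
  tmap f x (a *: u + v) = a *: tmap f x u + tmap f x v.
Proof. exact: (tmap_is_linear f x). Qed.

Lemma tmap_cancel (X Y : manifold_data R) (aX : is_atlas X) (aY : is_atlas Y)
  (f : X -> Y) (h : Y -> X) x v :
  smooth_near f x -> smooth_near h (f x) -> (forall y, h (f y) = y) ->
  tmap h (f x) (tmap f x v) = v.
Proof.
move=> sf sh hf; rewrite -(tmap_comp aX aY aX) // -[RHS](tmap_id aX x).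
exact: eq_tmap.
Qed.

Lemma tsrc_gone x v : ds (gone GG x) (du x v) = v.
Proof.
apply: tmap_cancel => //; [exact: smooth_near_gone|exact: smooth_near_src|].
exact: src_gone hG.
Qed.

Lemma ttgt_gone x v : dt (gone GG x) (du x v) = v.
Proof.
apply: tmap_cancel => //; [exact: smooth_near_gone|exact: smooth_near_tgt|].
exact: tgt_gone hG.
Qed.

Lemma tsrc_ginv g v : ds (ginv GG g) (di g v) = dt g v.
Proof.
rewrite -(tmap_comp aG aG aM); [|exact: smooth_near_ginv|exact: smooth_near_src].
by apply: eq_tmap => h; exact: (src_ginv hG h).
Qed.

Lemma ttgt_ginv g v : dt (ginv GG g) (di g v) = ds g v.
Proof.
rewrite -(tmap_comp aG aG aM); [|exact: smooth_near_ginv|exact: smooth_near_tgt].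
by apply: eq_tmap => h; exact: (tgt_ginv hG h).
Qed.

Lemma tsrc_gmul g h v w : src GG g = tgt GG h -> ds g v = dt h w ->
  ds (gmul GG g h) (dm g h v w) = ds h w.
Proof.
move=> gh vw; have [d Hd] := curve_velocity_exists aG h w.
have [c Hc cd] := curve_lift_src gh vw Hd.
have Hm := curve_velocity_gmul gh vw Hc Hd cd.
have H1 := curve_velocity_comp aG aM (smooth_near_src _) Hm.
have H2 := curve_velocity_comp aG aM (smooth_near_src _) Hd.
rewrite (src_gmul hG gh) in H1.
apply: (curve_velocity_unique _ H2); apply: curve_velocity_ext H1.
by apply: filterS cd => t cdt; exact: (src_gmul hG cdt).
Qed.

Lemma ttgt_gmul g h v w : src GG g = tgt GG h -> ds g v = dt h w ->
  dt (gmul GG g h) (dm g h v w) = dt g v.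
Proof.
move=> gh vw; have [d Hd] := curve_velocity_exists aG h w.
have [c Hc cd] := curve_lift_src gh vw Hd.
have Hm := curve_velocity_gmul gh vw Hc Hd cd.
have H1 := curve_velocity_comp aG aM (smooth_near_tgt _) Hm.
have H2 := curve_velocity_comp aG aM (smooth_near_tgt _) Hc.
rewrite (tgt_gmul hG gh) in H1.
apply: (curve_velocity_unique _ H2); apply: curve_velocity_ext H1.
by apply: filterS cd => t cdt; exact: (tgt_gmul hG cdt).
Qed.

Lemma tgmulA g h k u v w : src GG g = tgt GG h -> src GG h = tgt GG k ->
  ds g u = dt h v -> ds h v = dt k w ->
  dm g (gmul GG h k) u (dm h k v w) = dm (gmul GG g h) k (dm g h u v) w.
Proof.
(* Lifting builds the left factor from the right one, so the composable triple of curves is chosen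
   from right to left. *)
move=> gh hk uv vw; have [e He] := curve_velocity_exists aG k w.
have [d Hd de] := curve_lift_src hk vw He.
have [c Hc cd] := curve_lift_src gh uv Hd.
have ghk : src GG g = tgt GG (gmul GG h k) by rewrite (tgt_gmul hG hk).
have ghk' : src GG (gmul GG g h) = tgt GG k by rewrite (src_gmul hG gh).
have uvw : ds g u = dt (gmul GG h k) (dm h k v w) by rewrite (ttgt_gmul hk vw).
have uvw' : ds (gmul GG g h) (dm g h u v) = dt k w by rewrite (tsrc_gmul gh uv).
have Hde := curve_velocity_gmul hk vw Hd He de.
have Hcd := curve_velocity_gmul gh uv Hc Hd cd.
have H1 := curve_velocity_gmul ghk uvw Hc Hde.
have H2 := curve_velocity_gmul ghk' uvw' Hcd He.
rewrite (gmulA hG gh hk) in H1.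
apply: (curve_velocity_unique (H1 _)).
  by apply: filterS2 cd de => t cdt det; rewrite (tgt_gmul hG det).
apply: curve_velocity_ext (H2 _).
  by apply: filterS2 cd de => t cdt det; rewrite (gmulA hG cdt det).
by apply: filterS2 cd de => t cdt det; rewrite (src_gmul hG cdt).
Qed.

(** One arbitrary curve suffices: [c] and the units at its sources are composable at every time, so
    nothing has to be lifted. The other unit law and the two inverse laws work the same way. *)
Lemma tgmul1 g v : dm g (gone GG (src GG g)) v (du (src GG g) (ds g v)) = v.
Proof.
have [c Hc] := curve_velocity_exists aG g v.
have Hs := curve_velocity_comp aG aM (smooth_near_src g) Hc.
have Hu := curve_velocity_comp aM aG (smooth_near_gone _) Hs.
have gh : src GG g = tgt GG (gone GG (src GG g)) by rewrite (tgt_gone hG).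
have vw : ds g v = dt (gone GG (src GG g)) (du (src GG g) (ds g v)) by rewrite ttgt_gone.
have H := curve_velocity_gmul gh vw Hc Hu.
rewrite (gmul1 hG) in H.
apply: (curve_velocity_unique _ Hc); apply: curve_velocity_ext (H _).
  by apply: (@filterE _ (nbhs (0 : R))) => t; rewrite /= (gmul1 hG).
by apply: (@filterE _ (nbhs (0 : R))) => t; rewrite /= (tgt_gone hG).
Qed.

Lemma tgmul1g g v : dm (gone GG (tgt GG g)) g (du (tgt GG g) (dt g v)) v = v.
Proof.
have [c Hc] := curve_velocity_exists aG g v.
have Ht := curve_velocity_comp aG aM (smooth_near_tgt g) Hc.
have Hu := curve_velocity_comp aM aG (smooth_near_gone _) Ht.
have gh : src GG (gone GG (tgt GG g)) = tgt GG g by rewrite (src_gone hG).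
have vw : ds (gone GG (tgt GG g)) (du (tgt GG g) (dt g v)) = dt g v by rewrite tsrc_gone.
have H := curve_velocity_gmul gh vw Hu Hc.
rewrite (gmul1g hG) in H.
apply: (curve_velocity_unique _ Hc); apply: curve_velocity_ext (H _).
  by apply: (@filterE _ (nbhs (0 : R))) => t; rewrite /= (gmul1g hG).
by apply: (@filterE _ (nbhs (0 : R))) => t; rewrite /= (src_gone hG).
Qed.

Lemma tgmulV g v : dm g (ginv GG g) v (di g v) = du (tgt GG g) (dt g v).
Proof.
have [c Hc] := curve_velocity_exists aG g v.
have Hi := curve_velocity_comp aG aG (smooth_near_ginv g) Hc.
have Ht := curve_velocity_comp aG aM (smooth_near_tgt g) Hc.
have Hu := curve_velocity_comp aM aG (smooth_near_gone _) Ht.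
have gh : src GG g = tgt GG (ginv GG g) by rewrite (tgt_ginv hG).
have vw : ds g v = dt (ginv GG g) (di g v) by rewrite ttgt_ginv.
have H := curve_velocity_gmul gh vw Hc Hi.
rewrite (gmulV hG) in H.
apply: (curve_velocity_unique _ Hu); apply: curve_velocity_ext (H _).
  by apply: (@filterE _ (nbhs (0 : R))) => t; rewrite /= (gmulV hG).
by apply: (@filterE _ (nbhs (0 : R))) => t; rewrite /= (tgt_ginv hG).
Qed.

Lemma tgmulVg g v : dm (ginv GG g) g (di g v) v = du (src GG g) (ds g v).
Proof.
have [c Hc] := curve_velocity_exists aG g v.
have Hi := curve_velocity_comp aG aG (smooth_near_ginv g) Hc.
have Hs := curve_velocity_comp aG aM (smooth_near_src g) Hc.
have Hu := curve_velocity_comp aM aG (smooth_near_gone _) Hs.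
have gh : src GG (ginv GG g) = tgt GG g by rewrite (src_ginv hG).
have vw : ds (ginv GG g) (di g v) = dt g v by rewrite tsrc_ginv.
have H := curve_velocity_gmul gh vw Hi Hc.
rewrite (gmulVg hG) in H.
apply: (curve_velocity_unique _ Hu); apply: curve_velocity_ext (H _).
  by apply: (@filterE _ (nbhs (0 : R))) => t; rewrite /= (gmulVg hG).
by apply: (@filterE _ (nbhs (0 : R))) => t; rewrite /= (src_ginv hG).
Qed.

(** A single extension computes all three products, and its tangent map at [(g, h)] is linear. *)
Lemma tgmul_linear g h (a : R) v v' w w' : src GG g = tgt GG h ->
  ds g v = dt h w -> ds g v' = dt h w' ->
  dm g h (a *: v + v') (a *: w + w') = a *: dm g h v w + dm g h v' w'.
Proof.
move=> gh vw vw'; have [V [F eF]] := gmul_smooth hG (a := (g, h)) gh.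
rewrite !(tmulE eF gh) //; last by rewrite !tmap_linearP vw vw'.
by rewrite -tmap_linearP scale_row_mx add_row_mx.
Qed.

End TangentGroupoid.

(** * Linear algebra on fibres *)

Lemma rV_linear_inj_surj (R : realType) m n (f : {linear 'rV[R]_m -> 'rV[R]_n}) :
  m = n -> (forall u, f u = 0 -> u = 0) -> forall w, exists u, f u = w.
Proof.
move=> mn; move: f; rewrite {}mn => f inj w.
have : row_free (lin1_mx f).
  by apply: inj_row_free => u; rewrite mul_rV_lin1; exact: inj.
rewrite row_free_unit => fU; exists (w *m invmx (lin1_mx f)).
by rewrite -mul_rV_lin1 mulmxKV.
Qed.

Lemma rV1_inj (R : realType) n (i : 'I_n) (u w : 'rV[R]_n) :
  n = 1%N -> u 0 i = w 0 i -> u = w.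
Proof.
move=> n1 uw; apply/rowP => j; have -> : j = i; last exact: uw.
have ord_eq0 (k : 'I_n) : k = 0%N :> nat.
  by apply/eqP; rewrite -leqn0 -ltnS; have := ltn_ord k; rewrite [X in (_ < X)%N]n1.
by apply/val_inj; rewrite /= !ord_eq0.
Qed.

Section Fibres.
Variables (R : realType) (X : manifold_data R) (E : vbundle_data X).

(** Equality of dependent pairs compares the second components after transport along a proof of
    [x = x]; proof irrelevance makes the transport trivial. *)
Lemma vec_inj (x : X) : injective (@vec R X E x).
Proof.
move=> u v uv; have := projT2_eq uv.
by rewrite (Prop_irrelevance (projT1_eq uv) erefl).
Qed.

Lemma vec_tag (x y : X) (u : E x) (v : E y) : vec u = vec v -> x = y.
Proof. by move=> /(congr1 (@tag _ _)). Qed.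

Lemma vec_linear (a : R) (x y : X) (u u' : E x) (v v' : E y) :
  vec u = vec v -> vec u' = vec v' -> vec (a *: u + u') = vec (a *: v + v').
Proof.
move=> uv; have xy := vec_tag uv; subst y.
by rewrite (vec_inj uv) => /vec_inj ->.
Qed.

Lemma vec_add (x y : X) (u u' : E x) (v v' : E y) :
  vec u = vec v -> vec u' = vec v' -> vec (u + u') = vec (v + v').
Proof. by move=> uv uv'; have := vec_linear 1 uv uv'; rewrite !scale1r. Qed.

Lemma vec_cast (x y : X) (xy : x = y) (u : E x) : exists v : E y, vec v = vec u.
Proof. by subst y; exists u. Qed.

Lemma vec_zero (x y : X) : x = y -> vec (0 : E x) = vec (0 : E y).
Proof. by move=> ->. Qed.

End Fibres.

Lemma linear_zero (R : realType) (U V : lmodType R) (f : U -> V) :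
  linear f -> f 0 = 0.
Proof.
move=> lf; have := lf 1 0 0; rewrite !scale1r addr0 => /eqP.
by rewrite -{1}(addr0 (f 0)) (inj_eq (addrI _)) eq_sym => /eqP.
Qed.

Lemma linear_add (R : realType) (U V : lmodType R) (f : U -> V) u v :
  linear f -> f (u + v) = f u + f v.
Proof. by move=> lf; have := lf 1 u v; rewrite !scale1r. Qed.

Lemma linear_sub (R : realType) (U V : lmodType R) (f : U -> V) u v :
  linear f -> f (u - v) = f u - f v.
Proof.
by move=> lf; have := lf (-1) v u; rewrite !scaleN1r (addrC (- v)) (addrC (- f v)).
Qed.

(** In trivialisations the map becomes a square matrix, which is invertible once its kernel is
    trivial. *)
Lemma fibre_linear_inj_surj (R : realType) (X Y : manifold_data R)
  (E : vbundle_data X) (F : vbundle_data Y) (x : X) (y : Y) (f : E x -> F y) :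
  is_vbundle E -> is_vbundle F -> rank E = rank F -> linear f ->
  (forall u, f u = 0 -> u = 0) -> forall w, exists u, f u = w.
Proof.
move=> /vbundle_locally_trivial tE /vbundle_locally_trivial tF EF lf inj w.
have tx := lt_triv_at tE x; have ty := lt_triv_at tF y.
set a := triv_at E x in tx; set b := triv_at F y in ty.
have tcl := lt_linear tE tx; have tdl := lt_linear tF ty.
have tpl : linear (@tprm _ _ E a x).
  move=> c u v; apply: (can_inj (lt_tcrdK tE tx)).
  by rewrite tcl !(lt_tprmK tE tx).
pose g (u : 'rV[R]_(rank E)) := tcrd b (f (tprm a x u)).
have gl : linear g by move=> c u v; rewrite /g tpl lf tdl.
pose gg : {linear 'rV[R]_(rank E) -> 'rV[R]_(rank F)} :=
  HB.pack g (GRing.isLinear.Build _ _ _ _ g gl).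
have [|u Hu] := @rV_linear_inj_surj _ _ _ gg EF _ (tcrd b w).
  move=> u /=; rewrite /g -(linear_zero tdl) => /(can_inj (lt_tcrdK tF ty)) /inj.
  by rewrite -(linear_zero tpl) => /(can_inj (lt_tprmK tE tx)).
by exists (tprm a x u); exact: (can_inj (lt_tcrdK tF ty)).
Qed.

(** * Line bundle groupoids: source and target on fibres *)

Section LineBundleGroupoid.
Variables (R : realType) (G M : manifold_data R) (GG : groupoid_data G M).
Variables (L : vbundle_data G) (LM : vbundle_data M) (LL : vbgroupoid_data GG L LM).
Hypothesis hL : is_lbgroupoid LL.

Let vL : is_vbgroupoid LL := let: And3 v _ _ := hL in v.
Let rL : rank L = 1%N := let: And3 _ r _ := hL in r.
Let rLM : rank LM = 1%N := let: And3 _ _ r := hL in r.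
Let hG : is_lie_groupoid GG := base_groupoid vL.
Let hT : is_lie_groupoid (total_groupoid LL) := total_lie_groupoid vL.

Let lS g : linear (@vsrc _ _ _ _ _ _ LL g) := @vsrc_linear _ _ _ _ _ _ _ vL g.
Let lT g : linear (@vtgt _ _ _ _ _ _ LL g) := @vtgt_linear _ _ _ _ _ _ _ vL g.
Let lU x : linear (@vone _ _ _ _ _ _ LL x) := @vone_linear _ _ _ _ _ _ _ vL x.
Let lI g : linear (@vinv _ _ _ _ _ _ LL g) := @vinv_linear _ _ _ _ _ _ _ vL g.

Local Notation S := (@vsrc _ _ _ _ _ _ LL _).
Local Notation T := (@vtgt _ _ _ _ _ _ LL _).
Local Notation mul := (@vmul _ _ _ _ _ _ LL _ _).

Lemma vsrc_vone x (l : LM x) : vec (S (vone LL l)) = vec l.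
Proof. exact: (src_gone hT (vec l)). Qed.

Lemma vtgt_vone x (l : LM x) : vec (T (vone LL l)) = vec l.
Proof. exact: (tgt_gone hT (vec l)). Qed.

Lemma vsrc_vmul g h (l : L g) (k : L h) : vec (S l) = vec (T k) ->
  vec (S (mul l k)) = vec (S k).
Proof. exact: (@src_gmul _ _ _ _ hT (vec l) (vec k)). Qed.

Lemma vtgt_vmul g h (l : L g) (k : L h) : vec (S l) = vec (T k) ->
  vec (T (mul l k)) = vec (T l).
Proof. exact: (@tgt_gmul _ _ _ _ hT (vec l) (vec k)). Qed.

Lemma vsrc_vinv g (l : L g) : vec (S (vinv LL l)) = vec (T l).
Proof. exact: (src_ginv hT (vec l)). Qed.

Lemma vone_surj x (k : L (gone GG x)) : exists l, k = vone LL l.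
Proof.
have inj (l : LM x) : vone LL l = 0 -> l = 0.
  move=> l0; apply: vec_inj; rewrite -vsrc_vone l0 (linear_zero (@lS _)).
  by apply: vec_zero; exact: (src_gone hG).
have [l <-] := fibre_linear_inj_surj (objects_vbundle vL) (arrows_vbundle vL)
  (etrans rLM (esym rL)) (@lU x) inj k.
by exists l.
Qed.

Lemma vmul_zero g h : src GG g = tgt GG h -> mul (0 : L g) (0 : L h) = 0.
Proof.
move=> gh; have c0 : vcomposable LL (0 : L g) (0 : L h).
  rewrite /vcomposable (linear_zero (@lS _)) (linear_zero (@lT _)).
  exact: vec_zero.
have /eqP := vmul_linear vL 1 c0 c0.
rewrite !scale1r !addr0 -{1}(addr0 (vmul _ _ _)) (inj_eq (addrI _)) eq_sym.
by move/eqP.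
Qed.

(* A vector killed by the source is moved to the unit fibre by multiplying
   with the zero vector over g^-1; there it vanishes because s u = id and u is
   onto for dimension reasons. *)
Lemma vsrc_ker g (l : L g) : S l = 0 -> l = 0.
Proof.
move=> l0.
(* The arrow g g^-1 equals a unit but is not of the form [gone GG x] on the nose, hence the equation
   as a hypothesis. *)
have unit_ker h x (k : L h) : h = gone GG x -> S k = 0 -> k = 0.
  move=> hx; subst h; have [m ->] := vone_surj k => m0.
  suff -> : m = 0 by rewrite (linear_zero (@lU _)).
  apply: vec_inj; rewrite -vsrc_vone m0.
  by apply: vec_zero; exact: (src_gone hG).
have gV : src GG g = tgt GG (ginv GG g) by rewrite (tgt_ginv hG).
have Vg : src GG (ginv GG g) = tgt GG g by rewrite (src_ginv hG).
pose z : L (ginv GG g) := 0.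
have lz : vec (S l) = vec (T z).
  by rewrite l0 (linear_zero (@lT _)); exact: vec_zero.
have zg : vec (S z) = vec (T (0 : L g)).
  rewrite (linear_zero (@lS _)) (linear_zero (@lT _)).
  exact: vec_zero.
have lz0 : mul l z = 0.
  apply: (unit_ker _ (tgt GG g)); first by rewrite (gmulV hG).
  apply: vec_inj; rewrite (vsrc_vmul lz) (linear_zero (@lS _)).
  by apply: vec_zero; rewrite (src_gmul hG gV).
apply: vec_inj.
(* The triple product of [l], [z] and the zero vector over [g]: bracketed to the left it is 0
   because [l z] vanishes, bracketed to the right it is [l] times a zero vector over a unit
   arrow. *)
have := @gmulA _ _ _ _ hT (vec l) (vec z) (vec (0 : L g)) lz zg; rewrite /= lz0.
have E1 : mul z (0 : L g) = 0 by exact: vmul_zero.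
have E2 : mul (0 : L (gmul GG g (ginv GG g))) (0 : L g) = 0.
  by apply: vmul_zero; rewrite (src_gmul hG gV).
rewrite E1 E2.
(* As s(l) = 0, this zero vector is the unit at s(l), and multiplying [l] by it on the right returns
   [l]. *)
have Z : vec (0 : L (gmul GG (ginv GG g) g)) = vec (vone LL (S l)).
  rewrite l0 (linear_zero (@lU _)).
  by apply: vec_zero; rewrite (gmulVg hG).
have E3 := congr1 (gmul (total_groupoid LL) (vec l)) Z.
have E4 : vec (mul l (0 : L (gmul GG (ginv GG g) g))) = vec l := etrans E3 (gmul1 hT (vec l)).
rewrite E4 => ->.
by apply: vec_zero; rewrite -(gmulA hG gV Vg) (gmulVg hG) (gmul1 hG).
Qed.

Lemma vsrc_injective g : injective (@vsrc _ _ _ _ _ _ LL g).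
Proof.
move=> l k lk; apply/subr0_eq/vsrc_ker.
by rewrite (linear_sub _ _ (@lS g)) lk subrr.
Qed.

Lemma vec_vsrc_inj g h (l : L g) (k : L h) :
  g = h -> vec (S l) = vec (S k) -> vec l = vec k.
Proof. by move=> gh; subst h => /vec_inj /vsrc_injective ->. Qed.

Lemma vsrc_surj g (k : LM (src GG g)) : exists l : L g, S l = k.
Proof.
exact: fibre_linear_inj_surj (arrows_vbundle vL) (objects_vbundle vL)
  (etrans rL (esym rLM)) (@lS g) (@vsrc_ker g) k.
Qed.

Lemma vinv_injective g : injective (@vinv _ _ _ _ _ _ LL g).
Proof.
move=> l k lk; apply: vec_inj.
rewrite -(ginvK hT (vec l)) -(ginvK hT (vec k)).
by rewrite -[ginv _ (vec l)]/(vec (vinv LL l)) lk.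
Qed.

(** The target of [l] is the source of its inverse, and inversion is injective, so t has trivial
    kernel because s does. *)
Lemma vtgt_surj g (k : LM (tgt GG g)) : exists l : L g, T l = k.
Proof.
apply: (fibre_linear_inj_surj (arrows_vbundle vL) (objects_vbundle vL)
  (etrans rL (esym rLM)) (@lT g)) => l l0.
apply: vinv_injective; rewrite (linear_zero (@lI g)); apply: vsrc_ker.
apply: vec_inj; rewrite vsrc_vinv l0; apply: vec_zero.
by rewrite (src_ginv hG).
Qed.

Local Notation Sinv := (vsrc_inv LL).

Lemma vsrc_invK g (y : total_space LM) : tag y = src GG g ->
  vec (S (Sinv g y)) = y.
Proof.
case: y => x y /= xg; subst x; have [l Sl] := vsrc_surj y.
have P : exists l : L g, vec (S l) = vec y by exists l; rewrite Sl.
exact: (@xgetPex _ 0 [set l : L g | vec (S l) = vec y] P).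
Qed.

Lemma vsrc_inv_vec g (l : L g) h (y : total_space LM) : h = g ->
  vec (S l) = y -> vec (Sinv h y) = vec l.
Proof.
move=> hg; subst h => ly; apply: vec_vsrc_inj => //.
by rewrite vsrc_invK // -ly.
Qed.

Lemma vsrc_inv_eq g (l : L g) (y : total_space LM) :
  vec (S l) = y -> Sinv g y = l.
Proof. by move=> ly; apply: vec_inj; exact: vsrc_inv_vec. Qed.

(** * Consequences of multiplicativity *)

Section MultiplicativeForm.
Variable theta : forall g : G, tangent G g -> L g.
Hypothesis mth : multiplicative_form LL theta.

Local Notation tm g h v w := (@vmul _ _ _ _ _ _ (tangent_groupoid GG) g h v w).

Lemma theta_vec g h (v : tangent G g) (w : tangent G h) :
  g = h -> v = w :> 'rV[R]_(mdim G) -> vec (theta v) = vec (theta w).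
Proof. by move=> gh; subst h => /= ->. Qed.

(* First component of the multiplicativity equation: a1, (a2, b2) and
   theta(v) come from the faces pr_2, m and pr_1. *)
Lemma multiplicative_formP g h (v : tangent G g) (w : tangent G h) :
  src GG g = tgt GG h -> tmap (src GG) g v = tmap (tgt GG) h w ->
  exists (a1 a2 : L g) (b2 : L h),
    [/\ vec (S a1) = vec (T (theta w)), vec (S a2) = vec (T b2),
        mul a2 b2 = theta (tm g h v w) & theta v = a2 - a1].
Proof.
move=> gh vw.
have vwc : vcomposable (tangent_groupoid GG) v w.
  by rewrite /vcomposable /= /vec; rewrite vw gh.
have := mth gh vwc.
have face k (F : L g * L h -> L k) (y : L k) :
    (exists l : L g * L h, vcomposable LL l.1 l.2 /\ F l = y) ->
    vcomposable LL (face_inv LL F y).1 (face_inv LL F y).2 /\ F (face_inv LL F y) = y.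
  by move=> H; exact: (@xgetPex _ 0 [set l | vcomposable LL l.1 l.2 /\ F l = y] H).
(* For each of the three faces a composable preimage must be exhibited; without one, [face_inv]
   would silently be its default 0. *)
pose p1 (l : L g * L h) := l.1; pose p2 (l : L g * L h) := l.2.
have [c1 e1] : vcomposable LL (face_inv LL p2 (theta w)).1 (face_inv LL p2 (theta w)).2 /\
    p2 (face_inv LL p2 (theta w)) = theta w.
  apply: (face h p2 (theta w)); exists (Sinv g (vec (T (theta w))), theta w); split=> //.
  exact: vsrc_invK.
set m := fun l : L g * L h => mul l.1 l.2.
have [c2 e2] : vcomposable LL (face_inv LL m (theta (tm g h v w))).1
    (face_inv LL m (theta (tm g h v w))).2 /\
    m (face_inv LL m (theta (tm g h v w))) = theta (tm g h v w).
  (* [b] is chosen with the source of [theta] of the product, and [a] composable with [b]. Then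
     [a b] has that source too, so it is the required vector by injectivity of the source. *)
  apply: (face _ m (theta (tm g h v w))); pose b := Sinv h (vec (S (theta (tm g h v w)))).
  have Hb : vec (S b) = vec (S (theta (tm g h v w))).
    by apply: vsrc_invK; rewrite /= (src_gmul hG gh).
  pose a := Sinv g (vec (T b)).
  have ab : vec (S a) = vec (T b) by exact: vsrc_invK.
  exists (a, b); split=> //; apply: vec_inj; apply: vec_vsrc_inj => //.
  by rewrite (vsrc_vmul ab).
have [c3 e3] : vcomposable LL (face_inv LL p1 (theta v)).1 (face_inv LL p1 (theta v)).2 /\
    p1 (face_inv LL p1 (theta v)) = theta v.
  apply: (face g p1 (theta v)).
  have [k Hk] := vec_cast gh (S (theta v)); have [b Hb] := vtgt_surj k.
  by exists (theta v, b); split=> //; rewrite /vcomposable /= Hb.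
move=> E0.
have E : (face_inv LL p2 (theta w)).1 - (face_inv LL m (theta (tm g h v w))).1 +
    (face_inv LL p1 (theta v)).1 = 0 := congr1 fst E0.
exists (face_inv LL p2 (theta w)).1, (face_inv LL m (theta (tm g h v w))).1,
  (face_inv LL m (theta (tm g h v w))).2; split=> //.
- by move: c1; rewrite /vcomposable -/(p2 _) e1.
- apply/eqP; rewrite -subr_eq0 opprB addrC -{1}e3; exact/eqP.
Qed.

(** Multiplicativity is applied to the pair (w, w). On unit fibres source and target both invert u,
    which forces a1 = theta(w). Composable units are equal and idempotent, so a2 = a2 b2 = theta(w
    w) = theta(w). Hence theta(w) = a2 - a1 = 0. *)
Lemma theta_unit x (v : 'rV[R]_(mdim M)) :
  theta (tmap (gone GG) x v : tangent G (gone GG x)) = 0.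
Proof.
set w : tangent G (gone GG x) := tmap (gone GG) x v.
have gh : src GG (gone GG x) = tgt GG (gone GG x) by rewrite (src_gone hG) (tgt_gone hG).
have vw : tmap (src GG) (gone GG x) w = tmap (tgt GG) (gone GG x) w.
  by rewrite (tsrc_gone hG) (ttgt_gone hG).
have [a1 [a2 [b2 [H1 H2 H3 H4]]]] := multiplicative_formP gh vw.
have [l E] := vone_surj (theta w); have [l1 E1] := vone_surj a1.
have [l2 E2] := vone_surj a2; have [k2 F2] := vone_surj b2.
have Ea1 : a1 = theta w.
  by rewrite E1 E; move: H1; rewrite E1 E vsrc_vone vtgt_vone => /vec_inj ->.
have Ea2 : a2 = theta w.
  apply: vec_inj; rewrite E2; move: H2; rewrite E2 F2 vsrc_vone vtgt_vone => /vec_inj l2k2.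
  have <- : vec (theta (tm (gone GG x) (gone GG x) w w)) = vec (theta w).
    apply: theta_vec.
      by have := gmul1 hG (gone GG x); rewrite (src_gone hG).
    by have := tgmul1 hG (g := gone GG x) w; rewrite (src_gone hG) (tsrc_gone hG).
  rewrite -H3 E2 F2 -l2k2.
  have Eu : src (total_groupoid LL) (vec (vone LL l2)) = vec l2 := vsrc_vone l2.
  by have := gmul1 hT (vec (vone LL l2)); rewrite Eu => /esym.
by rewrite H4 Ea1 Ea2 subrr.
Qed.

End MultiplicativeForm.

End LineBundleGroupoid.

(** * Algebraic axioms of the Morita kernel *)

Section MoritaKernel.
Variables (R : realType) (G M : manifold_data R) (GG : groupoid_data G M).
Variables (L : vbundle_data G) (LM : vbundle_data M) (LL : vbgroupoid_data GG L LM).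
Variable theta : forall g : G, tangent G g -> L g.
Hypotheses (hL : is_lbgroupoid LL) (htheta : is_one_form theta)
  (hmult : multiplicative_form LL theta).

Let vL : is_vbgroupoid LL := let: And3 v _ _ := hL in v.
Let hG : is_lie_groupoid GG := base_groupoid vL.
Let hT : is_lie_groupoid (total_groupoid LL) := total_lie_groupoid vL.
Let lS g : linear (@vsrc _ _ _ _ _ _ LL g) := @vsrc_linear _ _ _ _ _ _ _ vL g.
Let lT g : linear (@vtgt _ _ _ _ _ _ LL g) := @vtgt_linear _ _ _ _ _ _ _ vL g.
Let lU x : linear (@vone _ _ _ _ _ _ LL x) := @vone_linear _ _ _ _ _ _ _ vL x.
Let lI g : linear (@vinv _ _ _ _ _ _ LL g) := @vinv_linear _ _ _ _ _ _ _ vL g.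
Let lth g : linear (@theta g) := proj1 htheta g.

Local Notation K := (morita_kernel LL theta).
Local Notation W := (whitney_sum (tangent G) L).
Local Notation WM := (whitney_sum (tangent M) LM).
Local Notation S := (@vsrc _ _ _ _ _ _ LL _).
Local Notation T := (@vtgt _ _ _ _ _ _ LL _).
Local Notation mul := (@vmul _ _ _ _ _ _ LL _ _).
Local Notation tm g h v w := (@vmul _ _ _ _ _ _ (tangent_groupoid GG) g h v w).
Local Notation Sinv := (vsrc_inv LL).

(** Fibres of the tangent bundle are the same type over all base points, so tangent components are
    compared directly; the equality of base points is carried by the line components. *)
Lemma whitney_vec_eq (X : manifold_data R) (E : vbundle_data X) (x y : X)
  (v w : 'rV[R]_(mdim X)) (l : E x) (k : E y) :
  v = w -> vec l = vec k ->
  @vec _ _ (whitney_sum (tangent X) E) x (v, l) =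
  @vec _ _ (whitney_sum (tangent X) E) y (w, k).
Proof.
move=> vw lk; have xy := vec_tag lk; subst y.
by rewrite (vec_inj lk) vw.
Qed.

Lemma whitney_vec_inj (X : manifold_data R) (E : vbundle_data X) (x y : X)
  (v w : 'rV[R]_(mdim X)) (l : E x) (k : E y) :
  @vec _ _ (whitney_sum (tangent X) E) x (v, l) =
  @vec _ _ (whitney_sum (tangent X) E) y (w, k) -> v = w /\ vec l = vec k.
Proof.
move=> H; split.
  exact: (congr1 (fun e : total_space (whitney_sum (tangent X) E) =>
    (tagged e).1 : 'rV[R]_(mdim X)) H).
exact: (congr1 (fun e : total_space (whitney_sum (tangent X) E) =>
    vec (tagged e).2) H).
Qed.

Lemma kernel_composable g h (e : W g) (f : W h) : vcomposable K e f ->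
  [/\ src GG g = tgt GG h, tmap (src GG) g e.1 = tmap (tgt GG) h f.1 &
      vec (S e.2) = vec (T (f.2 + theta f.1))].
Proof.
move=> /[dup] /vec_tag gh; rewrite /vcomposable => /whitney_vec_inj[v l].
by split.
Qed.

(** The source of an inverse is the target, so the line component of the inverse is the inverse in
    [L] of lambda + theta(v). In this form linearity and smoothness are inherited from [L]. *)
Lemma kernel_vinvE g (e : W g) :
  vsrc_inv LL (ginv GG g) (vec (T (e.2 + theta e.1))) = vinv LL (e.2 + theta e.1).
Proof. by apply: (vsrc_inv_eq hL); exact: (vsrc_vinv hL). Qed.

Lemma kernel_src_gmul g h (e : W g) (f : W h) : vcomposable K e f ->
  vec (vsrc K (vmul K e f)) = vec (vsrc K f).
Proof.
move=> /kernel_composable[gh vw _]; apply: whitney_vec_eq.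
  exact: (tsrc_gmul hG gh vw).
by rewrite (vsrc_invK hL) //= (src_gmul hG gh).
Qed.

(* For e = (v, lambda) and f = (w, mu), the line component of the product is
   rho = a mu with s(a) = t(mu).  Adding the factorisation theta(vw) = a2 b2 and
   using theta(v) = a2 - a1 and lambda = a + a1, one gets
   t(rho + theta(vw)) = t(a + a2) = t(lambda + theta(v)). *)
Lemma kernel_tgt_gmul g h (e : W g) (f : W h) : vcomposable K e f ->
  vec (vtgt K (vmul K e f)) = vec (vtgt K e).
Proof.
move=> /kernel_composable[gh vw lm]; apply: whitney_vec_eq.
  exact: (ttgt_gmul hG gh vw).
have [a1 [a2 [b2 [H1 H2 H3 H4]]]] := multiplicative_formP hL hmult gh vw.
pose a := Sinv g (vec (T f.2)).
have Ha : vec (S a) = vec (T f.2) by exact: (vsrc_invK hL).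
have rhoE : Sinv (gmul GG g h) (vec (S f.2)) = mul a f.2.
  by apply: (vsrc_inv_eq hL); exact: (vsrc_vmul hL Ha).
have sumE : mul a f.2 + mul a2 b2 = mul (a + a2) (f.2 + b2).
  by have := vmul_linear vL 1 Ha H2; rewrite !scale1r => ->.
have c : vec (S (a + a2)) = vec (T (f.2 + b2)).
  by rewrite (linear_add _ _ (@lS _)) (linear_add _ _ (@lT _)); exact: vec_add.
(* Both sides have the same source: s(lambda) = t(mu) + t(theta(w)) = s(a) + s(a1). *)
have lE : e.2 = a + a1.
  apply: vec_inj; apply: (vec_vsrc_inj hL) => //; rewrite lm.
  rewrite (linear_add _ _ (@lS _)) (linear_add _ _ (@lT _)).
  by apply: vec_add.
rewrite /= rhoE -H3 sumE (vtgt_vmul hL c) lE H4.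
by rewrite addrA (addrAC _ a1) addrK.
Qed.

(** Line components over the same arrow agree once their sources do, and both bracketings have the
    source of the last factor. *)
Lemma kernel_gmulA g h k (d : W g) (e : W h) (f : W k) :
  vcomposable K d e -> vcomposable K e f ->
  vec (vmul K d (vmul K e f)) = vec (vmul K (vmul K d e) f).
Proof.
move=> /kernel_composable[gh uv _] /kernel_composable[hk vw _].
apply: whitney_vec_eq; first exact: (tgmulA hG gh hk uv vw).
apply: (vec_vsrc_inj hL); first exact: (gmulA hG gh hk).
have ghk : src GG g = tgt GG (gmul GG h k) by rewrite (tgt_gmul hG hk).
have ghk' : src GG (gmul GG g h) = tgt GG k by rewrite (src_gmul hG gh).
by rewrite /= !(vsrc_invK hL) //= ?(src_gmul hG ghk) ?(src_gmul hG ghk') ?(src_gmul hG hk).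
Qed.

Lemma kernel_src_gone x (e : WM x) : vec (vsrc K (vone K e)) = vec e.
Proof.
case: e => v l; apply: whitney_vec_eq; first exact: (tsrc_gone hG).
exact: (vsrc_vone hL).
Qed.

Lemma kernel_tgt_gone x (e : WM x) : vec (vtgt K (vone K e)) = vec e.
Proof.
case: e => v l; apply: whitney_vec_eq; first exact: (ttgt_gone hG).
by rewrite /= (theta_unit hL hmult) addr0; exact: (vtgt_vone hL).
Qed.

Lemma kernel_gmul1 g (e : W g) : vec (vmul K e (vone K (vsrc K e))) = vec e.
Proof.
case: e => v l; apply: whitney_vec_eq; first exact: (tgmul1 hG).
apply: (vsrc_inv_vec hL); first exact: (gmul1 hG).
by rewrite /= (vsrc_vone hL).
Qed.

Lemma kernel_gmul1g g (e : W g) : vec (vmul K (vone K (vtgt K e)) e) = vec e.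
Proof.
case: e => v l; apply: whitney_vec_eq; first exact: (tgmul1g hG).
by apply: (vsrc_inv_vec hL) => //; exact: (gmul1g hG).
Qed.

Lemma kernel_src_ginv g (e : W g) : vec (vsrc K (vinv K e)) = vec (vtgt K e).
Proof.
apply: whitney_vec_eq; first exact: (tsrc_ginv hG).
by rewrite (vsrc_invK hL) //= (src_ginv hG).
Qed.

Lemma kernel_gmulVg g (e : W g) :
  vec (vmul K (vinv K e) e) = vec (vone K (vsrc K e)).
Proof.
case: e => v l; apply: whitney_vec_eq; first exact: (tgmulVg hG).
apply: (vsrc_inv_vec hL); first exact: (gmulVg hG).
by rewrite /= (vsrc_vone hL).
Qed.

Lemma kernel_gmulV g (e : W g) :
  vec (vmul K e (vinv K e)) = vec (vone K (vtgt K e)).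
Proof.
case: e => v l; apply: whitney_vec_eq; first exact: (tgmulV hG).
apply: (vsrc_inv_vec hL); first exact: (gmulV hG).
by rewrite /= (vsrc_vone hL) (vsrc_invK hL) //= (src_ginv hG).
Qed.

(** Computed as t(e^-1) = t(e^-1 e) = t(u(s(e))) = s(e). The direct route would need the value of
    [theta] on the inverse vector. *)
Lemma kernel_tgt_ginv g (e : W g) : vec (vtgt K (vinv K e)) = vec (vsrc K e).
Proof.
rewrite -(kernel_tgt_gmul (kernel_src_ginv e)).
have := congr1 (tgt (total_groupoid K)) (kernel_gmulVg e) => /= ->.
exact: (kernel_tgt_gone (vsrc K e)).
Qed.

(** * Smoothness and linearity of the structure maps of the kernel *)

Let aG : is_atlas G := manifold_atlas (arrows_manifold hG).
Let aM : is_atlas M := manifold_atlas (objects_manifold hG).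
Let tTG := tangent_locally_trivial aG.
Let tTM := tangent_locally_trivial aM.
Let tL := vbundle_locally_trivial (arrows_vbundle vL).
Let tLM := vbundle_locally_trivial (objects_vbundle vL).
Let aTG := total_space_atlas aG tTG.
Let aL := total_space_atlas aG tL.
Let aLM := total_space_atlas aM tLM.
Let tW := whitney_locally_trivial aG tTG tL.
Let tWM := whitney_locally_trivial aM tTM tLM.
Let aW := total_space_atlas aG tW.
Let aWM := total_space_atlas aM tWM.

Lemma smooth_near_theta (v : total_space (tangent G)) :
  smooth_near (fun v : total_space (tangent G) => vec (theta (tagged v))) v.
Proof. exact: ((smoothP aTG _).1 (proj2 htheta) v). Qed.

Lemma smooth_near_add_theta (e : total_space W) :
  smooth_near (fun e : total_space W => vec ((tagged e).2 + theta (tagged e).1)) e.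
Proof.
apply: (smooth_near_vec_add aG aW tL (f := tag)
  (s := fun e : total_space W => (tagged e).2)
  (t := fun e : total_space W => theta (tagged e).1)).
  exact: smooth_near_whitney_snd.
exact: (smooth_near_comp aW aTG aL (smooth_near_whitney_fst aG tTG tL e)
  (smooth_near_theta _)).
Qed.

Lemma smooth_near_tmap_fst (X Y : manifold_data R) (aX : is_atlas X)
  (aY : is_atlas Y) (E : vbundle_data X) (tE : is_locally_trivial E)
  (f : X -> Y) (e : total_space (whitney_sum (tangent X) E)) :
  smooth_near f (tag e) ->
  smooth_near (fun e : total_space (whitney_sum (tangent X) E) =>
    @vec _ _ (tangent Y) (f (tag e)) (tmap f (tag e) (tagged e).1)) e.
Proof.
move=> sf; have tTX := tangent_locally_trivial aX; have tTY := tangent_locally_trivial aY.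
exact: (smooth_near_comp
  (total_space_atlas aX (whitney_locally_trivial aX tTX tE))
  (total_space_atlas aX tTX) (total_space_atlas aY tTY)
  (smooth_near_whitney_fst aX tTX tE e)
  (smooth_near_tangent_map aX aY (e := @vec _ _ (tangent X) (tag e) (tagged e).1) sf)).
Qed.

Lemma kernel_smooth_src (e : total_space W) : smooth_near (src (total_groupoid K)) e.
Proof.
apply: (smooth_near_vec_pair aM aW tTM tLM (f := fun e : total_space W => src GG (tag e))
  (s := fun e : total_space W => tmap (src GG) (tag e) (tagged e).1)
  (t := fun e : total_space W => vsrc LL (tagged e).2)).
  exact: (smooth_near_tmap_fst aG aM tL (smooth_near_src hG (tag e))).
exact: (smooth_near_comp aW aL aLM (smooth_near_whitney_snd aG tTG tL e)
  (smooth_near_src hT _)).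
Qed.

Lemma kernel_smooth_tgt (e : total_space W) : smooth_near (tgt (total_groupoid K)) e.
Proof.
apply: (smooth_near_vec_pair aM aW tTM tLM (f := fun e : total_space W => tgt GG (tag e))
  (s := fun e : total_space W => tmap (tgt GG) (tag e) (tagged e).1)
  (t := fun e : total_space W => vtgt LL ((tagged e).2 + theta (tagged e).1))).
  exact: (smooth_near_tmap_fst aG aM tL (smooth_near_tgt hG (tag e))).
exact: (smooth_near_comp aW aL aLM (smooth_near_add_theta e) (smooth_near_tgt hT _)).
Qed.

Lemma kernel_smooth_gone (e : total_space WM) : smooth_near (gone (total_groupoid K)) e.
Proof.
apply: (smooth_near_vec_pair aG aWM tTG tL (f := fun e : total_space WM => gone GG (tag e))
  (s := fun e : total_space WM => tmap (gone GG) (tag e) (tagged e).1)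
  (t := fun e : total_space WM => vone LL (tagged e).2)).
  exact: (smooth_near_tmap_fst aM aG tLM (smooth_near_gone hG (tag e))).
exact: (smooth_near_comp aWM aLM aL (smooth_near_whitney_snd aM tTM tLM e)
  (smooth_near_gone hT _)).
Qed.

Lemma kernel_smooth_ginv (e : total_space W) : smooth_near (ginv (total_groupoid K)) e.
Proof.
have -> : ginv (total_groupoid K) = fun e : total_space W =>
    @vec _ _ W (ginv GG (tag e)) (tmap (ginv GG) (tag e) (tagged e).1,
      vinv LL ((tagged e).2 + theta (tagged e).1)).
  by apply/funext => f; rewrite -kernel_vinvE.
apply: (smooth_near_vec_pair aG aW tTG tL (f := fun e : total_space W => ginv GG (tag e))
  (s := fun e : total_space W => tmap (ginv GG) (tag e) (tagged e).1)
  (t := fun e : total_space W => vinv LL ((tagged e).2 + theta (tagged e).1))).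
  exact: (smooth_near_tmap_fst aG aG tL (smooth_near_ginv hG (tag e))).
exact: (smooth_near_comp aW aL aL (smooth_near_add_theta e) (smooth_near_ginv hT _)).
Qed.

Lemma kernel_vsrc_linear g : linear (@vsrc _ _ _ _ _ _ K g).
Proof. by move=> a [v l] [w k]; congr pair; [exact: tmap_linearP|exact: lS]. Qed.

Lemma kernel_vtgt_linear g : linear (@vtgt _ _ _ _ _ _ K g).
Proof.
move=> a [v l] [w k]; congr pair; first exact: tmap_linearP.
by rewrite /= (lth a) -lT scalerDr addrACA.
Qed.

Lemma kernel_vone_linear x : linear (@vone _ _ _ _ _ _ K x).
Proof. by move=> a [v l] [w k]; congr pair; [exact: tmap_linearP|exact: lU]. Qed.

Lemma kernel_vinv_linear g : linear (@vinv _ _ _ _ _ _ K g).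
Proof.
move=> a [v l] [w k]; congr pair; first exact: tmap_linearP.
have E (e : W g) : (vinv K e).2 = vinv LL (e.2 + theta e.1) := kernel_vinvE e.
rewrite -[RHS]/(a *: (vinv K (v, l)).2 + (vinv K (w, k)).2) (E (v, l)) (E (w, k)).
rewrite -lI; apply: etrans (E (a *: (v, l) + (w, k))) _.
by rewrite /= (lth a) scalerDr addrACA.
Qed.

Lemma kernel_vmul_linear g h (c : R) (e e' : W g) (f f' : W h) :
  vcomposable K e f -> vcomposable K e' f' ->
  vmul K (c *: e + e') (c *: f + f') = c *: vmul K e f + vmul K e' f'.
Proof.
move=> /kernel_composable[gh vw _] /kernel_composable[_ vw' _].
congr pair; first exact: (tgmul_linear hG c gh vw vw').
apply: (vsrc_inv_eq hL); rewrite /= lS [in RHS]lS.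
by apply: vec_linear; rewrite (vsrc_invK hL) //= (src_gmul hG gh).
Qed.

Lemma kernel_src_submersion : submersion (src (total_groupoid K)).
Proof.
apply: (@bundle_map_submersion _ _ _ _ _ aG aM tW tWM _ _ kernel_vsrc_linear).
- exact: kernel_smooth_src.
- exact: smooth_near_src hG.
- by have [] := src_submersion hG.
- move=> g [v l]; have [u <-] := (proj2 (src_submersion hG)) g v.
  by have [k <-] := vsrc_surj hL l; exists (u, k).
Qed.

Lemma kernel_tgt_submersion : submersion (tgt (total_groupoid K)).
Proof.
apply: (@bundle_map_submersion _ _ _ _ _ aG aM tW tWM _ _ kernel_vtgt_linear).
- exact: kernel_smooth_tgt.
- exact: smooth_near_tgt hG.
- by have [] := tgt_submersion hG.
- move=> g [v l]; have [u <-] := (proj2 (tgt_submersion hG)) g v.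
  (* Subtracting [theta u] compensates the shift by [theta] in the target of the kernel. *)
  have [k <-] := vtgt_surj hL l; exists (u, k - theta (u : tangent G g)).
  by rewrite /= subrK.
Qed.

(** * Inverting the source in coordinates, and smoothness of the product *)

Let rL : rank L = 1%N := let: And3 _ r _ := hL in r.
Let rLM : rank LM = 1%N := let: And3 _ _ r := hL in r.
Let i0 : 'I_(rank LM) := cast_ord (esym rLM) ord0.

(* The source map of L, read in the trivialisations a and b, multiplies by
   this scalar. *)
Let slope (a : triv L) (b : triv LM) (g : G) : 'rV[R]_(rank LM) :=
  tcrd b (vsrc LL (tprm a g (const_mx 1))).

(** A zero slope would put a nonzero vector of the fibre in the kernel of the source. *)
Lemma slope_neq0 a b g : tdom a g -> tdom b (src GG g) -> slope a b g 0 i0 != 0.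
Proof.
move=> ta tb; apply/eqP => s0.
have tbl := lt_linear tLM tb.
have : slope a b g = 0 by apply: (rV1_inj (i := i0) rLM); rewrite s0 mxE.
rewrite /slope -(linear_zero tbl) => /(can_inj (lt_tcrdK tLM tb)).
move=> /(vsrc_ker hL) /(congr1 (@tcrd _ _ L a g)).
rewrite (lt_tprmK tL ta) (linear_zero (lt_linear tL ta)) => /rowP.
move=> /(_ (cast_ord (esym rL) ord0)); rewrite !mxE => /eqP.
by rewrite oner_eq0.
Qed.

(** [vsrc_inv] is defined by choice, which shows nothing about its dependence on [g]. Between lines
    the inverse is division by the slope, an expression whose smoothness can be checked. *)
Lemma vsrc_inv_crd a b g (y : total_space LM) : tdom a g -> tdom b (src GG g) ->
  tag y = src GG g ->
  Sinv g y =
  tprm a g (tcrd b (tagged y) 0 i0 *: ((slope a b g 0 i0)^-1 *: const_mx 1)).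
Proof.
move=> ta tb; case: y => x y /= xg; subst x.
have tbl := lt_linear tLM tb; have tal := lt_linear tL ta.
have s0 := slope_neq0 ta tb.
have scal (U V : lmodType R) (f : U -> V) (lf : linear f) c u : f (c *: u) = c *: f u.
  by have := lf c u 0; rewrite (linear_zero lf) !addr0.
have tpl : linear (@tprm _ _ L a g).
  move=> c u v; apply: (can_inj (lt_tcrdK tL ta)).
  by rewrite tal !(lt_tprmK tL ta).
apply: (vsrc_inv_eq hL); congr vec; apply: (can_inj (lt_tcrdK tLM tb)).
rewrite (scal _ _ _ tpl) (scal _ _ _ tpl) (scal _ _ _ (@lS g)) (scal _ _ _ (@lS g)).
rewrite (scal _ _ _ tbl) (scal _ _ _ tbl) -/(slope a b g).
by apply: (rV1_inj (i := i0) rLM); rewrite !mxE mulVf // mulr1.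
Qed.

Lemma smooth_near_slope a b g : tdom a g -> tdom b (src GG g) ->
  smooth_near (slope a b : G -> model_space R (rank LM)) g.
Proof.
move=> ta tb.
have s1 := smooth_near_tprm aG tL aG (f := id) (c := fun _ : G => const_mx 1) ta
  (smooth_near_id aG g) (smooth_near_cst aG (model_atlas R _) _ _).
have s2 := smooth_near_comp aG aL aLM s1 (smooth_near_src hT _).
exact: (smooth_near_total_tcrd aM aG tLM (F := fun z => vec (S (tprm a z (const_mx 1)))) tb s2).
Qed.

(** An extension has to make sense off the composable pairs, where the product formula of the kernel
    gives no control. The arrow is replaced by the value of [F], the tangent part by the tangent map
    of [F], and the choice in s^-1 by its coordinate formula. *)
Lemma kernel_smooth_gmul :
  smooth_on (composable (total_groupoid K)) (gmul2 (total_groupoid K)).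
Proof.
move=> [p q] pq; have [gh _ _] := kernel_composable pq.
have [V [F eF]] := gmul_smooth hG (a := (tag p, tag q)) gh.
have [oV Va sVF FE] := eF; have sF := local_extension_smooth eF.
have Fgh : F (tag p, tag q) = gmul GG (tag p) (tag q) by exact: FE.
have aGG := prodm_atlas aG aG; have aWW := prodm_atlas aW aW.
pose g0 := gmul GG (tag p) (tag q).
pose a := triv_at L g0; pose b := triv_at LM (src GG g0).
have ta : tdom a g0 := lt_triv_at tL _; have tb : tdom b (src GG g0) := lt_triv_at tLM _.
have tb' : tdom b (src GG (tag q)) by rewrite -(src_gmul hG gh).
pose Wp := prodm (total_space W) (total_space W).
pose base (z : Wp) : prodm G G := (tag z.1, tag z.2).
have s1 (z : Wp) := smooth_near_fst aW aW z.
have s2 (z : Wp) := smooth_near_snd aW aW z.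
have sbase (z : Wp) : smooth_near base z.
  apply: (smooth_near_pair aG aG aWW).
    exact: (smooth_near_comp aWW aW aG (s1 z) (smooth_near_tag aG tW _)).
  exact: (smooth_near_comp aWW aW aG (s2 z) (smooth_near_tag aG tW _)).
pose prod (z : Wp) : G := F (base z).
have sprod : smooth_near prod (p, q).
  exact: (smooth_near_comp aWW aGG aG (sbase (p, q)) sF).
pose tangent_part (z : Wp) : tangent G (prod z) :=
  tmap F (base z) (row_mx ((tagged z.1).1 : 'rV[R]_(mdim G)) ((tagged z.2).1 : 'rV[R]_(mdim G))).
(* The coordinate of s(lambda') is taken over the source of the second arrow, the slope over
   [prod z]. On composable pairs near the given one the source of [prod z] is the source of the
   second arrow, and the quotient is the intended one. *)
pose line_part (z : Wp) : L (prod z) :=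
  tprm a (prod z) (tcrd b (vsrc LL (tagged z.2).2) 0 i0 *:
    ((slope a b (prod z) 0 i0)^-1 *: const_mx 1)).
pose Phi (z : Wp) : total_space W := @vec _ _ W (prod z) (tangent_part z, line_part z).
have stan : smooth_near (fun z => @vec _ _ (tangent G) (prod z) (tangent_part z)) (p, q).
  have t1 := smooth_near_comp aWW aW aTG (s1 (p, q)) (smooth_near_whitney_fst aG tTG tL p).
  have t2 := smooth_near_comp aWW aW aTG (s2 (p, q)) (smooth_near_whitney_fst aG tTG tL q).
  have t3 := smooth_near_tangent_row_mx aG aG aWW
    (s := fun z : Wp => (tagged z.1).1) (t := fun z : Wp => (tagged z.2).1) t1 t2.
  have aTGG := total_space_atlas aGG (tangent_locally_trivial aGG).
  exact: (smooth_near_comp aWW aTGG aTG t3 (smooth_near_tangent_map aGG aG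
    (e := @vec _ _ (tangent (prodm G G)) (tag p, tag q)
      (row_mx (tagged p).1 (tagged q).1)) sF)).
have slin : smooth_near (fun z => vec (line_part z)) (p, q).
  apply: (smooth_near_tprm aG tL aWW (a := a)); first by rewrite /prod /base Fgh.
    exact: sprod.
  have c1 : smooth_near (fun z : Wp => tcrd b (vsrc LL (tagged z.2).2) : model_space R (rank LM)) (p, q).
    have h1 := smooth_near_comp aWW aW aL (s2 (p, q)) (smooth_near_whitney_snd aG tTG tL q).
    have h2 := smooth_near_comp aWW aL aLM h1 (smooth_near_src hT _).
    exact: (smooth_near_total_tcrd aM aWW tLM
      (F := fun z : Wp => vec (S (tagged z.2).2)) (z := (p, q)) tb' h2).
  have c2 : smooth_near (fun z : Wp => slope a b (prod z) : model_space R (rank LM)) (p, q).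
    apply: (smooth_near_comp aWW aG (model_atlas R _) sprod).
    by apply: smooth_near_slope; rewrite /prod /base Fgh.
  pose U := [set u : 'rV[R]_(rank LM) | u 0 i0 != 0].
  have oU : open U.
    apply: (@open_comp _ _ (fun u : 'rV[R]_(rank LM) => u 0 i0) [set x | x != 0]) => [u _|].
      exact: coord_continuous.
    exact: open_neq.
  have c3 : smooth_near (fun z : Wp => (slope a b (prod z) 0 i0)^-1 *: const_mx 1 : model_space R (rank L)) (p, q).
    apply: (smooth_near_op1 aWW (op := fun u => (u 0 i0)^-1 *: const_mx 1) oU _ _ c2).
      by rewrite /U /= /prod /base Fgh; exact: slope_neq0.
    apply: Cinfty_inv => //; exact: Cinfty_id.
  apply: (smooth_near_op2 aWW (op := fun u w => u 0 i0 *: w) _ c1 c3) => D f1 f2.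
  exact: Cinfty_scale.
have [Q [oQ Qpq sPhi]] : smooth_near Phi (p, q).
  exact: (smooth_near_vec_pair aG aWW tTG tL stan slin).
have [V1 [oV1 V1pq HV1]] := smooth_near_preimage aWW aGG (sbase (p, q)) oV Va.
(* Where [F] lands in this set, both trivialisations are valid and the coordinate formula really
   computes s^-1. *)
have oA : mopen (tdom a `&` src GG @^-1` tdom b).
  apply: mopenI => //; first exact: lt_tdom_open.
  by apply: (mopen_preimage aG aM) => [g|]; [exact: smooth_near_src hG g|exact: lt_tdom_open].
have Apq : (tdom a `&` src GG @^-1` tdom b) (prod (p, q)) by rewrite /prod /base Fgh.
have [V2 [oV2 V2pq HV2]] := smooth_near_preimage aWW aG sprod oA Apq.
exists (Q `&` (V1 `&` V2)), Phi; split.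
- by apply: mopenI => //; apply: mopenI.
- by [].
- apply/(smooth_on_openP aWW); first by apply: mopenI => //; apply: mopenI.
  by move=> z [Qz _]; exists Q.
- move=> z zc [Qz [/HV1 Vz /HV2 [taz tbz]]].
  have [zgh zvw _] := kernel_composable zc.
  have Fz : prod z = gmul GG (tag z.1) (tag z.2) by exact: FE.
  have eFz : local_extension (composable GG) (gmul2 GG) (tag z.1, tag z.2) V F by [].
  apply: whitney_vec_eq; first exact: (esym (tmulE hG eFz zgh zvw)).
  have sz : tag (vec (vsrc LL (tagged z.2).2)) = src GG (prod z).
    by rewrite Fz (src_gmul hG zgh).
  rewrite /line_part -(vsrc_inv_crd taz tbz sz).
  (* The type of the fibre depends on [prod z], so this arrow is generalised before the equation is
     substituted. *)
  by move: (prod z) Fz => g ->.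
Qed.

Lemma kernel_is_vbgroupoid : is_vbgroupoid K.
Proof.
have vW : is_vbundle W.
  exact: (whitney_vbundle (tangent_vbundle (arrows_manifold hG)) (arrows_vbundle vL)).
have vWM : is_vbundle WM.
  exact: (whitney_vbundle (tangent_vbundle (objects_manifold hG)) (objects_vbundle vL)).
split=> //.
- split=> //.
  + exact: total_manifold vW.
  + exact: total_manifold vWM.
  + exact: kernel_src_submersion.
  + exact: kernel_tgt_submersion.
  + exact/(smoothP aWM)/kernel_smooth_gone.
  + exact/(smoothP aW)/kernel_smooth_ginv.
  + exact: kernel_smooth_gmul.
  + by move=> [x e]; exact: kernel_src_gone.
  + by move=> [x e]; exact: kernel_tgt_gone.
  + by move=> [g e] [h f]; exact: kernel_src_gmul.
  + by move=> [g e] [h f]; exact: kernel_tgt_gmul.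
  + by move=> [g d] [h e] [k f]; exact: kernel_gmulA.
  + by move=> [g e]; exact: kernel_gmul1.
  + by move=> [g e]; exact: kernel_gmul1g.
  + by move=> [g e]; exact: kernel_src_ginv.
  + by move=> [g e]; exact: kernel_tgt_ginv.
  + by move=> [g e]; exact: kernel_gmulV.
  + by move=> [g e]; exact: kernel_gmulVg.
- exact: kernel_vsrc_linear.
- exact: kernel_vtgt_linear.
- exact: kernel_vone_linear.
- exact: kernel_vinv_linear.
- exact: kernel_vmul_linear.
Qed.

End MoritaKernel.

Theorem mainTheorem3 (R : realType) (G M : manifold_data R)
    (GG : groupoid_data G M) (L : vbundle_data G) (LM : vbundle_data M)
    (LL : vbgroupoid_data GG L LM) (theta : forall g : G, tangent G g -> L g)
    (hL : is_lbgroupoid LL) (htheta : is_one_form theta)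
    (hmult : multiplicative_form LL theta) :
  is_vbgroupoid (morita_kernel LL theta).
Proof. exact: kernel_is_vbgroupoid. Qed.
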